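(* Let $\mathbb{K}=\mathbb{Q}(\sqrt{-m})\subseteq\mathbb{C}$, with $m\in\mathbb{N}$ squarefree, be an imaginary-quadratic number field. Then the map $$\phi: SU(2,2;\mathbb{C})\to SO_0(S_1;\mathbb{R}),\qquad M\mapsto\widetilde{M},$$ with $\widetilde{M}$ given by the explicit formulas in the context, is a surjective homomorphism of groups with kernel $\{\pm I\}$. It satisfies $$\phi(\mathcal{G}_{\mathbb{K}})=SO_0(S_1;\mathbb{Q}),\qquad \phi(\Delta_{2,\mathbb{K}}^{*})=\Sigma_{\mathbb{K}}^{*},\qquad \phi(\Gamma_2(\mathcal{O}_{\mathbb{K}}))=\Sigma_{\mathbb{K}}.$$
   Context: Unitary side. $\mathcal{O}_{\mathbb{K}}=\mathbb{Z}+\mathbb{Z}\omega_{\mathbb{K}}$ is the ring of integers of $\mathbb{K}$, with $\omega_{\mathbb{K}}=(1+\sqrt{-m})/2$ if $m\equiv3\pmod4$ and $\omega_{\mathbb{K}}=\sqrt{-m}$ if $m\equiv1,2\pmod4$. $SU(2,2;\mathbb{C})$ is the group of all $M\in SL_4(\mathbb{C})$ with $\overline{M}^{tr}JM=J$, $J=\begin{pmatrix}0&-I\\ I&0\end{pmatrix}$ ($2\times2$ blocks); write $M=\begin{pmatrix}A&B\\C&D\end{pmatrix}$ with $2\times2$ blocks. $\Gamma_2(\mathcal{O}_{\mathbb{K}}):=SU(2,2;\mathbb{C})\cap\mathcal{O}_{\mathbb{K}}^{4\times4}$. With $\mathcal{I}(L)$ the ideal of $\mathcal{O}_{\mathbb{K}}$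 generated by the entries of $L$, $$\Delta_{2,\mathbb{K}}^{*}:=\left\{\tfrac1u L\in SU(2,2;\mathbb{C})\;;\;L\in\mathcal{O}_{\mathbb{K}}^{4\times4},\ 0\neq u\in\mathbb{C},\ u^2\in\mathcal{O}_{\mathbb{K}},\ u^2\mathcal{O}_{\mathbb{K}}=\mathcal{I}(L)^2\right\},$$ $$\mathcal{G}_{\mathbb{K}}:=\left\{\tfrac{1}{\sqrt k}M\in SU(2,2;\mathbb{C})\;;\;k\in\mathbb{N},\ M\in\mathcal{O}_{\mathbb{K}}^{4\times4}\right\}.$$ Orthogonal side. Let $$S=\begin{pmatrix}2&2\operatorname{Re}(\omega_{\mathbb{K}})\\2\operatorname{Re}(\omega_{\mathbb{K}})&2\omega_{\mathbb{K}}\overline{\omega}_{\mathbb{K}}\end{pmatrix},\quad S_0=\begin{pmatrix}0&0&1\\0&-S&0\\1&0&0\end{pmatrix}\ (4\times4),\quad S_1=\begin{pmatrix}0&0&1\\0&S_0&0\\1&0&0\end{pmatrix}\ (6\times6).$$ Write $S_j[X]:=X^{tr}S_jX$. $SO(S_1;\mathbb{R}):=\{M\in SL_6(\mathbb{R});\ S_1[M]=S_1\}$, and $SO_0(S_1;\mathbb{R})$ is the connected component of the identity matrix. $SO_0(S_1;\mathbb{Q})$ and $SO_0(S_1;\mathbb{Z})$ denote the subgroups of matrices in $SO_0(S_1;\mathbb{R})$ with rational, respectively integral, entries. $\Sigma_{\mathbb{K}}:=\{M\in SO_0(S_1;\mathbb{R});\ M\in I+\mathbb{Z}^{6\times6}S_1\}$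 (discriminant kernel), and $\Sigma_{\mathbb{K}}^{*}:=SO_0(S_1;\mathbb{Z})$. The map. Let $\varphi$ be the bijection from the Hermitian $2\times2$ matrices to $\mathbb{R}^4$ (and, complexified, from the complex $2\times2$ matrices to $\mathbb{C}^4$) given by $$\varphi:\begin{pmatrix}\alpha&\beta+\gamma\omega_{\mathbb{K}}\\ \beta+\gamma\overline{\omega}_{\mathbb{K}}&\delta\end{pmatrix}\mapsto(\alpha,\beta,\gamma,\delta)^{tr}.$$ For a $2\times2$ matrix let $\begin{pmatrix}\alpha&\beta\\ \gamma&\delta\end{pmatrix}^{\sharp}=\begin{pmatrix}\delta&-\beta\\-\gamma&\alpha\end{pmatrix}$. For $M=\begin{pmatrix}A&B\\C&D\end{pmatrix}\in SU(2,2;\mathbb{C})$ the matrix $\widetilde{M}$ is $$\widetilde{M}=\begin{pmatrix}\alpha&a^{tr}S_0&\beta\\ b&K&c\\ \gamma&d^{tr}S_0&\delta\end{pmatrix},$$ where $$\alpha=\det A,\ \beta=-\det B,\ \gamma=-\det C,\ \delta=\det D,$$ $$a=-\varphi(A^{\sharp}B),\ b=-\varphi(AC^{\sharp}),\ c=\varphi(BD^{\sharp}),\ d=\varphi(C^{\sharp}D),$$ and the $4\times4$ matrix $K$ is determined by $Kz=\varphi(AZD^{\sharp}+BZ^{\sharp}C^{\sharp})$ for $z=\varphi(Z)$. Equivalently, let $\mathbb{H}_2=\{Z\in\mathbb{C}^{2\times2};\ \tfrac{1}{2i}(Z-\overline{Z}^{tr})\text{ positive definite}\}$, $M\langle Z\rangle=(AZ+B)(CZ+D)^{-1}$,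 and, for $z=x+iy$ in $\mathcal{H}_{\mathbb{K}}=\varphi(\mathbb{H}_2)=\{z=(\tau_1,z_2,w,\tau_2)^{tr}\in\mathbb{C}^4;\ \operatorname{Im}\tau_1>0,\ y^{tr}S_0y>0\}$, $$\widetilde{M}\{z\}=-\tfrac{\gamma}{2}S_0[z]+d^{tr}S_0z+\delta,\qquad \widetilde{M}\langle z\rangle=\frac{1}{\widetilde{M}\{z\}}\left(-\tfrac12S_0[z]b+Kz+c\right).$$ Then $\widetilde{M}$ satisfies $\varphi(M\langle Z\rangle)=\widetilde{M}\langle\varphi(Z)\rangle$ and $\det(CZ+D)=\widetilde{M}\{\varphi(Z)\}$ for all $Z\in\mathbb{H}_2$. *)

(* Defs.v *)
From HB Require Import structures.
From mathcomp Require Import all_boot all_order all_algebra.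
From mathcomp Require Import complex ring.
From mathcomp Require Import classical_sets reals topology normedtype.
Import numFieldNormedType.Exports.
Import Order.TTheory GRing.Theory Num.Theory.

Set Implicit Arguments.
Unset Strict Implicit.
Unset Printing Implicit Defensive.

Local Open Scope classical_set_scope.
Local Open Scope ring_scope.
Local Open Scope complex_scope.

(* Excludes m = 0, since 2 ^ 2 divides 0. *)
Definition squarefree (m : nat) : Prop :=
  forall d : nat, (d ^ 2 %| m)%N -> d = 1%N.

Section Definitions.
Variables (R : realType) (m : nat).
Local Notation C := R[i].
Local Notation toC := (real_complex R).

Definition mx2 (F : nmodType) (a b c d : F) : 'M[F]_2 :=
  \matrix_(i, j) (nth [::] [:: [:: a; b]; [:: c; d]] i)`_j.

Definition col4 (F : nmodType) (a b c d : F) : 'cV[F]_4 :=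
  \col_i [:: a; b; c; d]`_i.

Definition omega : C :=
  if (m %% 4 == 3)%N then (1 + 'i * (Num.sqrt m%:R)%:C) / 2
  else 'i * (Num.sqrt m%:R)%:C.

Definition OK : set C :=
  [set z | exists a b : int, z = a%:~R + b%:~R * omega].

Definition OKmx n : set 'M[C]_n := [set M | forall i j, OK (M i j)].

Definition OKideal (A : set C) : set C :=
  [set z | exists n (c a : 'I_n -> C),
     [/\ forall i, OK (c i), forall i, A (a i) & z = \sum_i c i * a i]].

Definition entries_ideal n (L : 'M[C]_n) : set C :=
  OKideal [set z | exists i j, z = L i j].

Definition ideal_mul (I I' : set C) : set C :=
  OKideal [set z | exists x y, [/\ I x, I' y & z = x * y]].

Definition Jmx : 'M[C]_4 := block_mx (0 : 'M_2) (- 1%:M) 1%:M (0 : 'M_2).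

Definition SU22 : set 'M[C]_4 :=
  [set M | \det M = 1 /\ (map_mx Num.conj M)^T *m Jmx *m M = Jmx].

Definition Gamma2 : set 'M[C]_4 := SU22 `&` @OKmx 4.

Definition Delta2_star : set 'M[C]_4 :=
  SU22 `&` [set N | exists (L : 'M[C]_4) (u : C),
    [/\ OKmx L, u != 0, OK (u ^+ 2),
        OKideal [set u ^+ 2] = ideal_mul (entries_ideal L) (entries_ideal L)
      & N = u^-1 *: L]].

Definition GK : set 'M[C]_4 :=
  SU22 `&` [set N | exists (k : nat) (M : 'M[C]_4),
    [/\ (0 < k)%N, OKmx M & N = (Num.sqrt k%:R)%:C^-1 *: M]].

Definition Smx : 'M[R]_2 :=
  mx2 2                        (2 * complex.Re omega)
      (2 * complex.Re omega)   (2 * complex.Re (omega * omega^*)).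

(* (x, z, y) |-> 2 x y + Q[z] as a symmetric matrix. *)
Definition hyperbolic_ext n (Q : 'M[R]_n) : 'M[R]_(1 + n + 1) :=
  block_mx (block_mx 0 0 0 Q) (col_mx 1 0) (row_mx 1 0) 0.

Definition S0 : 'M[R]_4 := hyperbolic_ext (- Smx).
Definition S1 : 'M[R]_6 := hyperbolic_ext S0.

Definition SO_S1 : set 'M[R]_6 :=
  [set M | \det M = 1 /\ M^T *m S1 *m M = S1].

Definition SO0 : set 'M[R]_6 := connected_component SO_S1 1%:M.

Definition SO0_Q : set 'M[R]_6 :=
  SO0 `&` [set M | exists X : 'M[rat]_6, M = map_mx ratr X].

Definition SO0_Z : set 'M[R]_6 :=
  SO0 `&` [set M | exists X : 'M[int]_6, M = map_mx intr X].

Definition Sigma : set 'M[R]_6 :=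
  SO0 `&` [set M | exists X : 'M[int]_6, M = 1%:M + map_mx intr X *m S1].

Definition Sigma_star : set 'M[R]_6 := SO0_Z.

Definition varphi_inv (z : 'cV[C]_4) : 'M[C]_2 :=
  let alpha := z 0 0 in let beta := z 1 0 in
  let gamma := z 2 0 in let delta := z 3 0 in
  mx2 alpha                      (beta + gamma * omega)
      (beta + gamma * omega^*)   delta.

(* Obtained by solving varphi_inv (varphi Z) = Z; see varphiK and varphi_invK. *)
Definition varphi (Z : 'M[C]_2) : 'cV[C]_4 :=
  let gamma := (Z 0 1 - Z 1 0) / (omega - omega^*) in
  col4 (Z 0 0) (Z 0 1 - gamma * omega) gamma (Z 1 1).

Definition sharp (Z : 'M[C]_2) : 'M[C]_2 :=
  mx2 (Z 1 1) (- Z 0 1) (- Z 1 0) (Z 0 0).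

Definition Kmx (A B C' D : 'M[C]_2) : 'M[C]_4 :=
  \matrix_(i, j) varphi (let Z := varphi_inv (delta_mx j 0) in
    A *m Z *m sharp D + B *m sharp Z *m sharp C') i 0.

(* M~ with complex entries; they are real when M is in SU(2,2;C). *)
Definition tilde (M : 'M[C]_4) : 'M[C]_6 :=
  let A := ulsubmx (M : 'M_(2 + 2)) in let B := ursubmx (M : 'M_(2 + 2)) in
  let C' := dlsubmx (M : 'M_(2 + 2)) in let D := drsubmx (M : 'M_(2 + 2)) in
  let S0C := map_mx toC S0 in
  let alpha := \det A in let beta := - \det B in
  let gamma := - \det C' in let delta := \det D in
  let a := - varphi (sharp A *m B) in let b := - varphi (A *m sharp C') in
  let c := varphi (B *m sharp D) in let d := varphi (sharp C' *m D) in
  let K := Kmx A B C' D in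
  block_mx (block_mx alpha%:M (a^T *m S0C)
                     b        K) (col_mx beta%:M c)
           (row_mx gamma%:M (d^T *m S0C)) delta%:M
  : 'M_(1 + 4 + 1).

Definition phi (M : 'M[C]_4) : 'M[R]_6 := map_mx (@complex.Re R) (tilde M).

End Definitions.

Arguments omega : clear implicits.
Arguments OK : clear implicits.
Arguments SU22 : clear implicits.
Arguments Gamma2 : clear implicits.
Arguments Delta2_star : clear implicits.
Arguments GK : clear implicits.
Arguments Smx : clear implicits.
Arguments S0 : clear implicits.
Arguments S1 : clear implicits.
Arguments SO_S1 : clear implicits.
Arguments SO0 : clear implicits.
Arguments SO0_Q : clear implicits.
Arguments SO0_Z : clear implicits.
Arguments Sigma : clear implicits.
Arguments Sigma_star : clear implicits.

Lemma squarefree_gt0 m : squarefree m -> (0 < m)%N.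
Proof. by case: m => // /(_ 2%N (dvdn0 _)). Qed.

Section Varphi.
Variables (R : realType) (m : nat).
Hypothesis m_gt0 : (0 < m)%N.
Local Notation C := R[i].
Local Notation w := (omega R m).

Lemma omega_sub_conj_neq0 : w - w^* != 0.
Proof.
have s_gt0 : 0 < Num.sqrt (m%:R : R) by rewrite sqrtr_gt0 ltr0n.
have h : complex.Im w != 0.
  rewrite /omega; case: ifP => _.
    have -> : (2 : C)^-1 = (2^-1)%:C by rewrite fmorphV rmorph_nat.
    by simpc => /=; rewrite mulf_neq0 ?invr_eq0 ?pnatr_eq0 ?gt_eqF.
  by simpc; rewrite /= gt_eqF.
apply: contraNneq h; case: w => x y /= /eqP.
rewrite eq_complex /= opprK => /andP[_].
by rewrite -mulr2n mulrn_eq0.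
Qed.

Lemma varphiK : cancel (varphi m) (@varphi_inv R m).
Proof.
move=> Z; apply/matrixP => i j; rewrite !mxE /=.
case: i j => [[|[|i]] hi] [[|[|j]] hj] //=; rewrite ?mxE /=.
- by congr (Z _ _); apply/val_inj.
- by rewrite subrK; congr (Z _ _); apply/val_inj.
- rewrite -addrA [- _ + _]addrC -mulrBr -[w^* - w]opprB mulrN divfK ?omega_sub_conj_neq0 //.
  by rewrite opprB addrC subrK; congr (Z _ _); apply/val_inj.
- by congr (Z _ _); apply/val_inj.
Qed.

Lemma varphi_invK : cancel (@varphi_inv R m) (varphi m).
Proof.
move=> z; have gE : (z 1 0 + z 2 0 * w - (z 1 0 + z 2 0 * w^*)) / (w - w^*)
    = z 2 0.
  rewrite opprD addrACA subrr add0r -mulrBr mulfK //.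
  exact: omega_sub_conj_neq0.
apply/matrixP => i j; rewrite !mxE /= gE ord1.
case: i => [[|[|[|[|i]]]] hi] //=; rewrite ?addrK;
  by congr (z _ _); apply/val_inj.
Qed.

Lemma mulKmx (A B C' D : 'M[C]_2) (z : 'cV[C]_4) :
  Kmx m A B C' D *m z =
  varphi m (A *m varphi_inv m z *m sharp D
            + B *m sharp (varphi_inv m z) *m sharp C').
Proof.
have lin_sharp : linear (@sharp R).
  move=> k u v; apply/matrixP => i j; rewrite !mxE.
  by case: i j => [[|[|i]] hi] [[|[|j]] hj] //=; rewrite ?mxE; ring.
have lin_inv : linear (@varphi_inv R m).
  move=> k u v; apply/matrixP => i j; rewrite !mxE.
  by case: i j => [[|[|i]] hi] [[|[|j]] hj] //=; rewrite ?mxE; ring.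
have lin_phi : linear (@varphi R m).
  move=> k u v; apply/matrixP => i j; rewrite !mxE.
  by case: i => [[|[|[|[|i]]]] hi] //=; rewrite ?mxE; ring.
pose f z := varphi m (A *m varphi_inv m z *m sharp D
            + B *m sharp (varphi_inv m z) *m sharp C').
have lin_f : linear f.
  move=> k u v; rewrite /f -lin_phi lin_inv lin_sharp; congr (varphi m _).
  rewrite !mulmxDr !mulmxDl -!scalemxAr -!scalemxAl scalerDr.
  by rewrite addrACA.
have f0 : f 0 = 0 by have := lin_f (-1) 0 0; rewrite !scaleN1r !oppr0 !addr0 addNr.
have fD u v : f (u + v) = f u + f v by rewrite -[u]scale1r lin_f !scale1r.
have fZ k u : f (k *: u) = k *: f u by rewrite -[k *: u]addr0 lin_f f0 addr0.
rewrite -/(f z) [in RHS](matrix_sum_delta z) (big_morph f fD f0).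
apply/matrixP => i j; rewrite !mxE summxE; apply: eq_bigr => k _.
by rewrite big_ord1 fZ !mxE ord1 mulrC.
Qed.

End Varphi.

(* Main.v *)
(* A vector (x, z, y) of C^6 is identified with Y = [[-x, Z], [Z^#, y]], z = varphi(Z).  Up
   to the factor Om = diag(eps, eps), eps = [[0, 1], [-1, 0]], this is the general
   antisymmetric 4 x 4 matrix, and M~ becomes the exterior square of M, in the form
   Y |-> M Y M^s with M^s = - Om M^tr Om.  So M |-> M~ is multiplicative on all matrices.
   SU(2,2) is generated by the matrices [[1, H], [0, 1]] and [[1, 0], [H, 1]] with H
   Hermitian.  For these M~ is visibly a real isometry of S1, it has determinant 1 because
   they are squares, and t |-> tH joins it to the identity.
   Conversely the image moves every isometry of determinant 1 to the identity or to
   rho = diag(-1, 1, 1, 1, 1, -1), and rho is not in the identity component because it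
   reverses the orientation of a maximal positive definite plane.
   If M~ is rational or integral, then conjugation by M preserves the even Clifford algebra
   over K or OK, hence maps the matrix units to matrices over K or OK; as
   M^-1 = - J conj(M)^tr J, the products p conj(q) of entries p, q of M lie in K or OK.  It
   follows that p q is in K.  In the integral case (p q)^2 is integral because
   conj(det M) = 1 is a sum of fourfold products of conjugates of entries, so p q is in OK,
   and M = u^-1 (u M) with any nonzero entry u shows that M is in Delta*.  In the rational
   case u is replaced by the real number u + conj(u) or (omega - conj(omega)) (u - conj(u)).
   Finally, modulo integral vectors the dual lattice lies in the OK-span of
   (omega - conj(omega))^-1 J Om, and M~ acts trivially on it iff M J (M - conj(M))^tr is
   divisible by omega - conj(omega). *)
Require Import Defs.
From HB Require Import structures.
From mathcomp Require Import all_boot all_order all_algebra.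
From mathcomp Require Import perm complex ring lra zify.
From mathcomp Require Import boolp classical_sets reals topology normedtype.
Import numFieldNormedType.Exports.
Import Order.TTheory GRing.Theory Num.Theory.

Set Implicit Arguments.
Unset Strict Implicit.
Unset Printing Implicit Defensive.

Local Open Scope classical_set_scope.
Local Open Scope ring_scope.

Local Notation "A ^h" := ((map_mx Num.conj A)^T) (at level 2, format "A ^h").

(** * Two by two matrices and the quadratic space *)

Section Mx2.
Variable F : comNzRingType.
Implicit Types A B : 'M[F]_2.

(** The formulas for M~ do not show that it is real, isometric and in the identity component when M
    is in SU(2,2). These properties are stable under products, which is why a generating set is
    wanted; the topology of SU(2,2) itself never enters. Everything is computed with the complex
    matrix [tilde M] acting on vectors written as (x, Z, y); once its reality is known, the real
    part in the definition of [phi] is harmless. In the arithmetic part the obstacle is that a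
    preimage M of a rational or integral matrix is found by real methods and is determined only up
    to sign. Its entries need not lie in K, and only products of two entries are accessible.
    Integrality of M~, integrality of all these products and membership in [Delta2_star] turn out to
    be equivalent. For the discriminant kernel this is not enough, because M itself has to be
    integral: there the action on the dual lattice controls the imaginary parts of the entries, and
    the fractional ideal which the entries generate is reduced to its real elements. *)

Lemma mx2P (A : 'M[F]_2) (a b c d : F) :
  A 0 0 = a -> A 0 1 = b -> A 1 0 = c -> A 1 1 = d -> A = mx2 a b c d.
Proof.
move=> <- <- <- <-; apply/matrixP => i j; rewrite !mxE.
by case: i j => [[|[|i]] hi] [[|[|j]] hj] //=; congr (A _ _); apply/val_inj.
Qed.

Lemma mx2_eta (A : 'M[F]_2) : A = mx2 (A 0 0) (A 0 1) (A 1 0) (A 1 1).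
Proof. exact: mx2P. Qed.

Lemma mulmx2 (a b c d a' b' c' d' : F) : mx2 a b c d *m mx2 a' b' c' d' =
  mx2 (a * a' + b * c') (a * b' + b * d') (c * a' + d * c') (c * b' + d * d').
Proof. by apply: mx2P; rewrite mxE !big_ord_recl big_ord0 !mxE /= addr0. Qed.

Lemma addmx2 (a b c d a' b' c' d' : F) : mx2 a b c d + mx2 a' b' c' d' =
  mx2 (a + a') (b + b') (c + c') (d + d').
Proof. by apply: mx2P; rewrite !mxE. Qed.

Lemma oppmx2 (a b c d : F) : - mx2 a b c d = mx2 (- a) (- b) (- c) (- d).
Proof. by apply: mx2P; rewrite !mxE. Qed.

Lemma scalemx2 (k a b c d : F) : k *: mx2 a b c d = mx2 (k * a) (k * b) (k * c) (k * d).
Proof. by apply: mx2P; rewrite !mxE. Qed.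

Lemma scalarmx2 (a : F) : a%:M = mx2 a 0 0 a.
Proof. by apply: mx2P; rewrite !mxE. Qed.

Lemma trmx2 (a b c d : F) : (mx2 a b c d)^T = mx2 a c b d.
Proof. by apply: mx2P; rewrite !mxE. Qed.

Lemma zeromx2 : 0 = mx2 0 0 0 0 :> 'M[F]_2.
Proof. by apply: mx2P; rewrite !mxE. Qed.

Lemma mapmx2 (f : F -> F) (a b c d : F) :
  map_mx f (mx2 a b c d) = mx2 (f a) (f b) (f c) (f d).
Proof. by apply: mx2P; rewrite !mxE. Qed.

Lemma det_mx2 (a b c d : F) : \det (mx2 a b c d) = a * d - b * c.
Proof.
rewrite (expand_det_row _ 0) !big_ord_recl big_ord0 addr0 /cofactor !det_mx11.
by rewrite !mxE /= expr0 expr1 mul1r mulN1r mulrN.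
Qed.

Lemma tr_mx2 (a b c d : F) : \tr (mx2 a b c d) = a + d.
Proof. by rewrite /mxtrace !big_ord_recl big_ord0 !mxE /= addr0. Qed.

Lemma mx2_inj (a b c d a' b' c' d' : F) : mx2 a b c d = mx2 a' b' c' d' ->
  [/\ a = a', b = b', c = c' & d = d'].
Proof.
move=> /matrixP e.
by split; [move: (e 0 0) | move: (e 0 1) | move: (e 1 0) | move: (e 1 1)]; rewrite !mxE.
Qed.

Definition mx2E := (mulmx2, addmx2, oppmx2, scalemx2, scalarmx2, trmx2, zeromx2,
  mapmx2, det_mx2, tr_mx2).
End Mx2.

(** * The action of M~ in terms of 2 x 2 matrices *)

Section Model.
Variables (R : realType) (m : nat).
Local Notation C := R[i].
Local Notation toC := (real_complex R).
Local Notation w := (omega R m).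

Lemma sharp_mx2 (a b c d : C) : sharp (mx2 a b c d) = mx2 d (- b) (- c) a.
Proof. by rewrite /sharp !mxE. Qed.

Let simp2 := (sharp_mx2, mx2E).

Lemma sharpK : involutive (@sharp R).
Proof. by move=> A; rewrite [RHS]mx2_eta /sharp !mxE /= !opprK. Qed.

Lemma sharpM (A B : 'M[C]_2) : sharp (A *m B) = sharp B *m sharp A.
Proof. by rewrite (mx2_eta A) (mx2_eta B) !simp2 ?mxE /=; congr mx2; ring. Qed.

Lemma sharpD (A B : 'M[C]_2) : sharp (A + B) = sharp A + sharp B.
Proof. by rewrite (mx2_eta A) (mx2_eta B) !simp2 ?mxE /=; congr mx2; ring. Qed.

Lemma sharpN (A : 'M[C]_2) : sharp (- A) = - sharp A.
Proof. by rewrite (mx2_eta A) !simp2 ?mxE. Qed.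

Lemma sharpZ k (A : 'M[C]_2) : sharp (k *: A) = k *: sharp A.
Proof. by rewrite (mx2_eta A) !simp2 ?mxE /= ?mulrN. Qed.

Lemma sharp0 : sharp (0 : 'M[C]_2) = 0.
Proof. by rewrite !simp2 oppr0. Qed.

Lemma sharp_scalar (k : C) : sharp k%:M = k%:M.
Proof. by rewrite !simp2 oppr0. Qed.

Lemma mul_sharp (A : 'M[C]_2) : A *m sharp A = (\det A)%:M.
Proof. by rewrite (mx2_eta A) !simp2 ?mxE /=; congr mx2; ring. Qed.

Lemma mul_sharpl (A : 'M[C]_2) : sharp A *m A = (\det A)%:M.
Proof. by rewrite (mx2_eta A) !simp2 ?mxE /=; congr mx2; ring. Qed.

Lemma add_sharp (A : 'M[C]_2) : A + sharp A = (\tr A)%:M.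
Proof. by rewrite (mx2_eta A) !simp2 ?mxE /=; congr mx2; ring. Qed.

Lemma varphi_invD u v : @varphi_inv R m (u + v) = varphi_inv m u + varphi_inv m v.
Proof. by rewrite /varphi_inv !mxE !mx2E; congr mx2; ring. Qed.

Lemma varphi_invN u : @varphi_inv R m (- u) = - varphi_inv m u.
Proof. by rewrite /varphi_inv !mxE !mx2E; congr mx2; ring. Qed.

Lemma varphi_invZ k u : @varphi_inv R m (k *: u) = k *: varphi_inv m u.
Proof. by rewrite /varphi_inv !mxE !mx2E; congr mx2; ring. Qed.

Definition vec6 (x : C) (Z : 'M[C]_2) (y : C) : 'cV[C]_6 :=
  col_mx (col_mx x%:M (varphi m Z)) y%:M : 'cV_(1 + 4 + 1).

Definition antisym (x : C) (Z : 'M[C]_2) (y : C) : 'M[C]_4 :=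
  block_mx (- x)%:M Z (sharp Z) y%:M : 'M_(2 + 2).

(** The matrix M^s in block form, with the off-diagonal blocks exchanged. In this form it reverses
    products because [sharp] does; [sharp4_Om] recovers - Om M^tr Om. *)
Definition sharp4 (M : 'M[C]_4) : 'M[C]_4 :=
  let N := M : 'M_(2 + 2) in
  block_mx (sharp (ulsubmx N)) (sharp (dlsubmx N))
           (sharp (ursubmx N)) (sharp (drsubmx N)).

Lemma sharp4_block (A B C' D : 'M[C]_2) :
  sharp4 (block_mx A B C' D) = block_mx (sharp A) (sharp C') (sharp B) (sharp D).
Proof. by rewrite /sharp4 block_mxKul block_mxKdl block_mxKur block_mxKdr. Qed.

Lemma block4 (M : 'M[C]_4) :
  exists A B C' D : 'M[C]_2, M = (block_mx A B C' D : 'M_(2 + 2)).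
Proof. by rewrite -[M](@submxK _ 2 2 2 2); do 4 eexists. Qed.

Lemma sharp4M (M N : 'M[C]_4) : sharp4 (M *m N) = sharp4 N *m sharp4 M.
Proof.
have [A [B [C' [D ->]]]] := block4 M; have [a [b [c [d ->]]]] := block4 N.
rewrite (@mulmx_block _ 2 2 2 2 2 2) !sharp4_block.
rewrite (@mulmx_block _ 2 2 2 2 2 2) !sharpD !sharpM //.
Qed.

(** Stated for arbitrary [Q] because both S0 (over -S) and S1 (over S0) are hyperbolic
    extensions. *)
Lemma hyperbolic_form n (Q : 'M[R]_n) (a b c d : C) (u v : 'cV[C]_n) :
  (col_mx (col_mx a%:M u) b%:M)^T *m map_mx toC (hyperbolic_ext Q)
    *m col_mx (col_mx c%:M v) d%:M
  = (a * d + b * c)%:M + u^T *m map_mx toC Q *m v.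
Proof.
rewrite /hyperbolic_ext !map_block_mx map_col_mx map_row_mx !tr_col_mx !map_mx0 !map_mx1.
rewrite mul_row_block mul_row_block.
rewrite mul_row_col !mulmx0 !add0r ?addr0 !tr_scalar_mx mul_mx_row mulmx1 mulmx0.
rewrite add_row_mx add0r addr0 !mul_row_col mulmx0 addr0 mulmx1.
by rewrite addrC addrA -!scalar_mxM -raddfD.
Qed.

Lemma omegaD : w + w^* = toC (2 * complex.Re w).
Proof. by rewrite addcJ rmorphM rmorph_nat. Qed.

Lemma Smx_toC : map_mx toC (Smx R m) =
  mx2 2 (w + w^*) (w + w^*) (2 * (w * w^*)).
Proof.
have e : toC (complex.Re (w * w^*)) = w * w^*.
  rewrite RRe_real //; apply: ger0_real; exact: mul_conjC_ge0.
apply: mx2P; rewrite !mxE /= ?omegaD ?rmorphM ?rmorph_nat //; congr (_ * _); exact: e.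
Qed.

Lemma col4E (a b c d : C) :
  col4 a b c d = col_mx (col_mx a%:M (\col_(i < 2) [:: b; c]`_i)) d%:M :> 'M_(1 + 2 + 1, 1).
Proof.
apply/matrixP => i j; rewrite ord1 [LHS]mxE.
case: (splitP i) => [k ki|k ki].
  case: (splitP k) => [l lk|l lk].
    have -> : i = lshift 1 (lshift 2 l) by apply/val_inj; rewrite /= ki.
    by rewrite col_mxEu col_mxEu !mxE ord1.
  have -> : i = lshift 1 (rshift 1 l) by apply/val_inj; rewrite /= ki.
  by rewrite col_mxEu col_mxEd !mxE; case: l {lk} => [[|[|l]] hl].
have -> : i = rshift (1 + 2) k by apply/val_inj; rewrite /= ki.
by rewrite col_mxEd !mxE !ord1 ?mulr1n.
Qed.

(** The trace tr(U Z^#) is the polar form of the determinant, so S0[z] = 2 det Z. *)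
Lemma S0_form (u z : 'cV[C]_4) :
  u^T *m map_mx toC (S0 R m) *m z
  = (\tr (varphi_inv m u *m sharp (varphi_inv m z)))%:M.
Proof.
have e (v : 'cV[C]_4) : v = col4 (v 0 0) (v 1 0) (v 2 0) (v 3 0).
  apply/matrixP => i j; rewrite !mxE ord1.
  by case: i => [[|[|[|[|i]]]] hi] //=; congr (v _ _); apply/val_inj.
rewrite {1}(e u) {1}(e z) !col4E.
apply: etrans (hyperbolic_form (- Smx R m) _ _ _ _ _ _) _.
rewrite map_mxN Smx_toC mx2E.
have -> (x y : C) : (\col_(i < 2) [:: x; y]`_i)^T = \row_j [:: x; y]`_j.
  by apply/matrixP => i j; rewrite !mxE.
rewrite [X in _ + X = _]mx11_scalar -raddfD /=; congr _%:M.
rewrite !mxE !big_ord_recl big_ord0 !mxE !big_ord_recl !big_ord0 !mxE /=.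
rewrite /varphi_inv !sharp_mx2 !mx2E /=.
ring.
Qed.

Lemma tr_sharp (A : 'M[C]_2) : \tr (sharp A) = \tr A.
Proof. by rewrite [in RHS](mx2_eta A) /sharp !tr_mx2 addrC. Qed.

Lemma tr_flip (A B Z : 'M[C]_2) :
  \tr (sharp A *m B *m sharp Z) = \tr (A *m Z *m sharp B).
Proof. by rewrite -[LHS]tr_sharp !sharpM !sharpK mulmxA [LHS]mxtrace_mulC mulmxA. Qed.

Hypothesis m_gt0 : (0 < m)%N.

(** Coordinates of M Y M^s. One formula serves both scalar coordinates: [act_x A B] is the first and
    [- act_x C' D] the last, because x and y stand in the diagonal blocks of Y with opposite
    signs. *)
Definition act_x (A B : 'M[C]_2) x Z y :=
  \det A * x - \tr (A *m Z *m sharp B) - \det B * y.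
Definition act_z (A B C' D : 'M[C]_2) x Z y :=
  A *m Z *m sharp D + B *m sharp Z *m sharp C' - x *: (A *m sharp C') + y *: (B *m sharp D).

Lemma tilde_vec (A B C' D : 'M[C]_2) x Z y :
  tilde m (block_mx A B C' D : 'M_(2 + 2)) *m vec6 x Z y =
  vec6 (act_x A B x Z y) (act_z A B C' D x Z y) (- act_x C' D x Z y).
Proof.
rewrite /tilde /vec6 block_mxKul block_mxKdl block_mxKur block_mxKdr.
rewrite [LHS](@mul_block_col _ (1 + 4) 1 (1 + 4) 1) mul_block_col mul_col_mx.
rewrite !add_col_mx mul_row_col !S0_form Defs.mulKmx // !varphi_invN !varphiK //.
rewrite -!mulmxA.
apply: (congr2 (@col_mx _ (1 + 4) 1 1)); first apply: (congr2 (@col_mx _ 1 4 1)).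
- rewrite -!scalar_mxM -!raddfD; congr _%:M.
  rewrite /act_x mulNmx raddfN /= mulNr; congr (_ - _ - _).
  by rewrite ?mulmxA tr_flip.
- rewrite mul_mx_scalar mul_mx_scalar.
  apply: (can_inj (varphi_invK m_gt0)); rewrite !varphi_invD !varphi_invZ varphi_invN !varphiK //.
  rewrite /act_z -!mulmxA scalerN; congr (_ + _); rewrite addrC //.
- rewrite -!scalar_mxM -!raddfD; congr _%:M.
  rewrite /act_x mulNr !opprD !opprK; congr (_ + _ + _).
  by rewrite ?mulmxA tr_flip.
Qed.

End Model.

Section Model2.
Variables (R : realType) (m : nat).
Local Notation C := R[i].
Local Notation toC := (real_complex R).
Local Notation w := (omega R m).

Lemma block4_eq (A B C' D A' B' C'' D' : 'M[C]_2) :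
  A = A' -> B = B' -> C' = C'' -> D = D' ->
  block_mx A B C' D = block_mx A' B' C'' D' :> 'M_(2 + 2).
Proof. by move=> -> -> -> ->. Qed.

Lemma antisym_act (A B C' D : 'M[C]_2) x Z y :
  let M := block_mx A B C' D : 'M_(2 + 2) in
  M *m antisym x Z y *m sharp4 M =
  antisym (act_x A B x Z y) (act_z A B C' D x Z y) (- act_x C' D x Z y).
Proof.
rewrite /= sharp4_block /antisym (@mulmx_block _ 2 2 2 2 2 2) (@mulmx_block _ 2 2 2 2 2 2).
have tl (P Q : 'M[C]_2) : (P *m (- x)%:M + Q *m sharp Z) *m sharp P
    + (P *m Z + Q *m y%:M) *m sharp Q = (- act_x P Q x Z y)%:M.
  rewrite !mulmxDl !mul_mx_scalar -!scalemxAl !mul_sharp.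
  rewrite -addrA [X in _ + X]addrA [Q *m _ *m _ + _]addrC.
  (* The second summand is the sharp of the first, and X + X^# is the scalar tr X. *)
  have -> : P *m Z *m sharp Q + Q *m sharp Z *m sharp P = (\tr (P *m Z *m sharp Q))%:M.
    by rewrite -add_sharp !sharpM sharpK !mulmxA.
  rewrite !scale_scalar_mx -!raddfD /=; congr _%:M; rewrite /act_x; ring.
have tr (P Q P' Q' : 'M[C]_2) : (P *m (- x)%:M + Q *m sharp Z) *m sharp P'
    + (P *m Z + Q *m y%:M) *m sharp Q' = act_z P Q P' Q' x Z y.
  rewrite /act_z !mulmxDl !mul_mx_scalar -!scalemxAl scaleNr.
  by rewrite addrA; congr (_ + _); rewrite addrC [- _ + _]addrC addrA.
rewrite !tl !tr; apply: block4_eq => //.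
rewrite /act_z !sharpD sharpN !sharpZ !sharpM !sharpK !mulmxA.
by rewrite [C' *m Z *m _ + _]addrC.
Qed.

End Model2.

(** * Generators of SU(2,2) *)

Section Hermitian.
Variable R : realType.
Local Notation C := R[i].
Local Notation toC := (real_complex R).

Lemma conjC_toC (x : R) : (toC x)^* = toC x.
Proof. exact: conjc_real. Qed.

Lemma ReK (z : C) : z^* = z -> toC (complex.Re z) = z.
Proof. by move=> /CrealP /RRe_real. Qed.

Lemma hM n p q (A : 'M[C]_(n, p)) (B : 'M[C]_(p, q)) : (A *m B)^h = B^h *m A^h.
Proof. by rewrite map_mxM trmx_mul. Qed.

Lemma hK n p (A : 'M[C]_(n, p)) : (A^h)^h = A.
Proof. by apply/matrixP => i j; rewrite !mxE conjCK. Qed.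

Lemma hD n p (A B : 'M[C]_(n, p)) : (A + B)^h = A^h + B^h.
Proof. by rewrite map_mxD raddfD. Qed.

Lemma hN n p (A : 'M[C]_(n, p)) : (- A)^h = - A^h.
Proof. by rewrite map_mxN raddfN. Qed.

Lemma hZ n p k (A : 'M[C]_(n, p)) : (k *: A)^h = k^* *: A^h.
Proof. by apply/matrixP => i j; rewrite !mxE rmorphM. Qed.

Lemma h1 n : (1%:M : 'M[C]_n)^h = 1%:M.
Proof. by rewrite map_mx1 trmx1. Qed.

Lemma h0 n p : (0 : 'M[C]_(n, p))^h = 0.
Proof. by rewrite map_mx0 trmx0. Qed.

Lemma det_h n (A : 'M[C]_n) : \det (A^h) = (\det A)^*.
Proof. by rewrite det_tr det_map_mx. Qed.

Lemma h_mx2 (a b c d : C) : (mx2 a b c d)^h = mx2 a^* c^* b^* d^*.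
Proof. by rewrite !mx2E. Qed.

Lemma hermitian2P (H : 'M[C]_2) : H^h = H ->
  exists (a d : R) (b : C), H = mx2 (toC a) b b^* (toC d).
Proof.
move=> e; exists (complex.Re (H 0 0)), (complex.Re (H 1 1)), (H 0 1).
have {}e i j : (H j i)^* = H i j by rewrite -[in RHS]e !mxE.
by rewrite !ReK ?e //; apply: mx2P.
Qed.

Lemma h_block (A B C' D : 'M[C]_2) :
  ((block_mx A B C' D : 'M_(2 + 2)) : 'M[C]_4)^h
  = (block_mx A^h C'^h B^h D^h : 'M_(2 + 2)).
Proof. by rewrite (@map_block_mx _ _ _ 2 2 2 2) (@tr_block_mx _ 2 2 2 2). Qed.

Definition upperU (H : 'M[C]_2) : 'M[C]_4 := block_mx 1%:M H 0 1%:M : 'M_(2 + 2).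
Definition lowerU (H : 'M[C]_2) : 'M[C]_4 := block_mx 1%:M 0 H 1%:M : 'M_(2 + 2).
Definition levi (V U : 'M[C]_2) : 'M[C]_4 := block_mx V 0 0 U : 'M_(2 + 2).

Lemma SU22_block (A B C' D : 'M[C]_2) :
  let M := block_mx A B C' D : 'M_(2 + 2) in
  (M : 'M[C]_4)^h *m Jmx R *m M = Jmx R <->
  [/\ A^h *m C' = C'^h *m A, B^h *m D = D^h *m B, A^h *m D - C'^h *m B = 1%:M
    & D^h *m A - B^h *m C' = 1%:M].
Proof.
rewrite /= h_block /Jmx !(@mulmx_block _ 2 2 2 2 2 2).
rewrite !mulmx0 !mulmx1 !mulmxN !mulmx1 !add0r !addr0 !mulNmx.
split=> [/(@eq_block_mx _ 2 2 2 2)[e1 e2 e3 e4]|[e1 e2 e3 e4]].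
  split; [|apply/esym| |].
  - by apply/esym/eqP; rewrite -subr_eq0 e1.
  - by apply/eqP; rewrite -subr_eq0 e4.
  - by apply: oppr_inj; rewrite opprB.
  - by [].
apply: block4_eq.
- by rewrite e1 subrr.
- by rewrite -e3 opprB.
- by [].
- by rewrite e2 subrr.
Qed.

Lemma SU22M (M N : 'M[C]_4) : SU22 R M -> SU22 R N -> SU22 R (M *m N).
Proof.
move=> [dM eM] [dN eN]; split; first by rewrite det_mulmx dM dN mulr1.
by rewrite hM mulmxA -(mulmxA N^h) -(mulmxA N^h) eM eN.
Qed.

Lemma SU22_1 : SU22 R 1%:M.
Proof. by split; rewrite ?det1 // h1 mul1mx mulmx1. Qed.

Lemma JmxJ : Jmx R *m Jmx R = - 1%:M.
Proof.
rewrite /Jmx (@mulmx_block _ 2 2 2 2 2 2) !mulmx0 !mul0mx !addr0 !add0r mulmx1 mul1mx.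
by rewrite (@scalar_mx_block _ 2 2) (@opp_block_mx _ 2 2 2 2) !oppr0.
Qed.

Lemma SU22_inv (M : 'M[C]_4) : SU22 R M ->
  M *m (- (Jmx R *m M^h *m Jmx R)) = 1%:M /\ (- (Jmx R *m M^h *m Jmx R)) *m M = 1%:M.
Proof.
move=> [_ e].
have e2 : (- (Jmx R *m M^h *m Jmx R)) *m M = 1%:M.
  by rewrite mulNmx -!mulmxA (mulmxA _ _ M) e JmxJ opprK.
by split=> //; apply: mulmx1C.
Qed.

Lemma SU22_JmxV (M : 'M[C]_4) : SU22 R M -> M *m Jmx R *m M^h = Jmx R.
Proof.
move=> /SU22_inv[e _]; have /(congr1 (mulmx^~ (Jmx R))) := e.
by rewrite mulmxN mulNmx -!mulmxA JmxJ !mulmxN mulmx1 opprK mul1mx.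
Qed.

Lemma det_upperU H : \det (upperU H) = 1.
Proof. by rewrite /upperU (@det_ublock _ 2 2) !det1 mulr1. Qed.

Lemma det_lowerU H : \det (lowerU H) = 1.
Proof. by rewrite /lowerU (@det_lblock _ 2 2) !det1 mulr1. Qed.

Lemma upperU_SU22 H : H^h = H -> SU22 R (upperU H).
Proof.
move=> e; split; first exact: det_upperU.
by apply/SU22_block; rewrite e !h1 !h0 !mul1mx !mulmx1 !mulmx0 !mul0mx !subr0.
Qed.

Lemma lowerU_SU22 H : H^h = H -> SU22 R (lowerU H).
Proof.
move=> e; split; first exact: det_lowerU.
by apply/SU22_block; rewrite e !h1 !h0 !mul1mx !mulmx1 !mulmx0 !mul0mx !subr0.
Qed.

(** Reality of det U is the determinant condition: V = (U^h)^-1 gives det V = 1 / conj(det U). *)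
Lemma levi_SU22 V U : V *m U^h = 1%:M -> (\det U)^* = \det U -> SU22 R (levi V U).
Proof.
move=> e dU; split.
  by rewrite /levi (@det_ublock _ 2 2) -dU -det_h -det_mulmx e det1.
apply/SU22_block; rewrite !h0 !mul0mx !mulmx0 !subr0; split=> //.
  by rewrite -[U]hK -hM (mulmx1C e) h1.
exact: mulmx1C.
Qed.

End Hermitian.

Section Generation.
Variable R : realType.
Local Notation C := R[i].
Local Notation toC := (real_complex R).

Lemma conj_mul_neq0 (z : C) : z != 0 -> z * z^* != 0.
Proof. by move=> z0; rewrite mulf_neq0 // conjC_eq0. Qed.

(** Weyl elements directly produce [levi V U] for Hermitian U; this extends the supply to products.
    Hermitian matrices have real determinant, so nothing beyond real determinants can be reached,
    and the Bruhat decomposition shows that all of these are. *)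
Lemma GL2_hermitian_ind (P : 'M[C]_2 -> Prop) :
    (forall U V, P U -> P V -> P (U *m V)) ->
    (forall H, H^h = H -> \det H != 0 -> P H) ->
  forall U, (\det U)^* = \det U -> \det U != 0 -> P U.
Proof.
move=> PM PH.
have Pdiag a d : a^* = a -> d^* = d -> a * d != 0 -> P (mx2 a 0 0 d).
  move=> ea ed ad; apply: PH; first by rewrite h_mx2 ea ed conjC0.
  by rewrite det_mx2 mulr0 subr0.
have Pu z : P (mx2 1 z 0 1).
  have [->|z0] := eqVneq z 0; first by apply: Pdiag; rewrite ?conjC1 ?mulr1 ?oner_eq0.
  have r0 := conj_mul_neq0 z0; set r := z * z^* in r0.
  have rr : r^* = r.
    by rewrite /r rmorphM /= conjCK mulrC.
  (* The product of the two Hermitian matrices on the right is r = |z|^2 times the unipotent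
     matrix. *)
  have -> : mx2 1 z 0 1 = mx2 r^-1 0 0 r^-1 *m (mx2 0 z z^* 0 *m mx2 0 z z^* r).
    by rewrite !mulmx2; congr mx2; rewrite /r; field; rewrite conjC_eq0 z0.
  have ri : (r^-1)^* = r^-1 by rewrite fmorphV /= rr.
  apply: (PM); first by apply: Pdiag; rewrite // mulf_neq0 ?invr_eq0.
  apply: PM; apply: PH; rewrite ?h_mx2 ?conjC0 ?conjCK ?rr // det_mx2 ?mulr0 ?mul0r sub0r oppr_eq0 //.
have Pc a b c d : (a * d - b * c)^* = a * d - b * c -> a * d - b * c != 0 ->
    c != 0 -> P (mx2 a b c d).
  move=> e n0 c0; have r0 := conj_mul_neq0 c0.
  set q := a * d - b * c in e n0.
  (* Bruhat decomposition for c != 0. Its antidiagonal factor, with entries -q/c and c, splits into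
     a diagonal matrix, real because q is, and a Hermitian matrix. *)
  have -> : mx2 a b c d = mx2 1 (a / c) 0 1 *m
      (mx2 (- q / (c * c^*)) 0 0 1 *m mx2 0 c^* c 0) *m mx2 1 (d / c) 0 1.
    by rewrite !mulmx2; congr mx2; rewrite /q; field; rewrite ?conjC_eq0 c0.
  apply: (PM); [apply: (PM) => //; apply: (PM)|by []].
    apply: Pdiag; rewrite ?conjC1 //; last by rewrite mulr1 mulf_neq0 ?oppr_eq0 ?invr_eq0.
    by rewrite rmorphM fmorphV rmorphM /= conjCK rmorphN /= e [c^* * c]mulrC.
  by apply: PH; rewrite ?h_mx2 ?conjC0 ?conjCK // det_mx2 mul0r sub0r oppr_eq0 mulrC.
move=> U; rewrite (mx2_eta U) det_mx2; move: (U 0 0) (U 0 1) (U 1 0) (U 1 1).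
move=> a b c d e n0; have [c0|] := eqVneq c 0; last exact: Pc.
have d0 : d != 0 by apply: contraNneq n0 => ->; rewrite c0 !mulr0 subrr.
have -> : mx2 a b c d = mx2 b a d c *m mx2 0 1 1 0.
  by rewrite mulmx2; congr mx2; ring.
have eN : b * c - a * d = - (a * d - b * c) by ring.
apply: PM; first by apply: Pc; rewrite ?eN ?rmorphN /= ?e ?oppr_eq0.
by apply: PH; rewrite ?h_mx2 ?conjC0 ?conjC1 // det_mx2 !mul0r mulr1 sub0r oppr_eq0 oner_eq0.
Qed.

Lemma gram_eq0 n p (A : 'M[C]_(n, p)) : A *m A^h = 0 -> A = 0.
Proof.
move=> e; apply/matrixP => i j; move/matrixP: e => /(_ i i).
rewrite !mxE => /eqP; rewrite psumr_eq0 => [/allP/(_ j)|k _]; last first.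
  by rewrite !mxE mul_conjC_ge0.
by rewrite mem_index_enum !mxE mul_conjC_eq0 => /(_ isT)/eqP.
Qed.

Lemma levi_mul V U V' U' : levi V U *m levi V' U' = levi (V *m V') (U *m U') :> 'M[C]_4.
Proof.
by rewrite /levi (@mulmx_block _ 2 2 2 2 2 2) !mulmx0 !mul0mx !addr0 add0r.
Qed.

Lemma upperU_mul H a b c d : upperU H *m (block_mx a b c d : 'M[C]_(2 + 2)) =
  (block_mx (a + H *m c) (b + H *m d) c d : 'M[C]_(2 + 2)).
Proof. by rewrite (@mulmx_block _ 2 2 2 2 2 2) !mul1mx !mul0mx !add0r. Qed.

Lemma mul_upperU H a b c d : (block_mx a b c d : 'M[C]_(2 + 2)) *m upperU H =
  (block_mx a (a *m H + b) c (c *m H + d) : 'M[C]_(2 + 2)).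
Proof. by rewrite (@mulmx_block _ 2 2 2 2 2 2) !mulmx1 !mulmx0 !addr0. Qed.

Lemma mul_lowerU H a b c d : (block_mx a b c d : 'M[C]_(2 + 2)) *m lowerU H =
  (block_mx (a + b *m H) b (c + d *m H) d : 'M[C]_(2 + 2)).
Proof. by rewrite (@mulmx_block _ 2 2 2 2 2 2) !mulmx1 !mulmx0 !add0r. Qed.

Lemma antidiag_levi b c V U : (block_mx 0 b c 0 : 'M[C]_(2 + 2)) *m levi V U =
  (block_mx 0 (b *m U) (c *m V) 0 : 'M[C]_(2 + 2)).
Proof. by rewrite (@mulmx_block _ 2 2 2 2 2 2) !mul0mx !mulmx0 !addr0 !add0r. Qed.

(** The SL2 identity that builds a Weyl element from three unipotents, here with K = H^-1. *)
Lemma weyl_factor (H K : 'M[C]_2) : H *m K = 1%:M -> K *m H = 1%:M ->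
  upperU (- K) *m lowerU H *m upperU (- K) = block_mx 0 (- K) H 0 :> 'M_(2 + 2).
Proof.
move=> e1 e2; rewrite /lowerU upperU_mul mul_upperU !mulmx1 !mulmxN !mulNmx e1 e2.
by rewrite subrr mul0mx oppr0 !add0r addNr.
Qed.

Lemma weyl_mul (H K H' K' : 'M[C]_2) :
  (block_mx 0 (- K) H 0 : 'M_(2 + 2)) *m (block_mx 0 (- K') H' 0 : 'M_(2 + 2))
  = levi (- (K *m H')) (- (H *m K')) :> 'M[C]_4.
Proof.
rewrite (@mulmx_block _ 2 2 2 2 2 2) !mulmx0 !mul0mx !addr0 !add0r.
by rewrite mulNmx mulmxN.
Qed.

Section Induction.
Variable P : 'M[C]_4 -> Prop.
Hypothesis PM : forall M N, P M -> P N -> P (M *m N).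
Hypothesis Pu : forall H, H^h = H -> P (upperU H).
Hypothesis Pl : forall H, H^h = H -> P (lowerU H).

Lemma weyl_ind (H K : 'M[C]_2) : H *m K = 1%:M -> K *m H = 1%:M ->
  H^h = H -> K^h = K -> P (block_mx 0 (- K) H 0 : 'M_(2 + 2)).
Proof.
move=> e1 e2 hH hK; rewrite -(weyl_factor e1 e2).
by apply: PM; [apply: PM|]; [apply: Pu|apply: Pl|apply: Pu]; rewrite ?hN ?hH ?hK.
Qed.

Lemma levi_ind V U : V *m U^h = 1%:M -> (\det U)^* = \det U -> P (levi V U).
Proof.
pose Q (U : 'M[C]_2) := exists2 V, V *m U^h = 1%:M & P (levi V U).
move=> eVU dU.
suff [V' eV' PV'] : Q U.
  by have -> : V = V' by rewrite -[V]mul1mx -eV' -mulmxA (mulmx1C eVU) mulmx1.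
apply: (GL2_hermitian_ind (P := Q)) => //.
- move=> U1 U2 [V1 e1 P1] [V2 e2 P2]; exists (V1 *m V2).
    by rewrite hM mulmxA -(mulmxA V1) e2 mulmx1.
  by rewrite -levi_mul; apply: PM.
- move=> H hH dH.
  have uH : H \in unitmx by rewrite unitmxE unitfE.
  have hK : (invmx H)^h = invmx H.
    by rewrite map_invmx trmx_inv hH.
  exists (invmx H); first by rewrite hH mulVmx.
  (* The Weyl element of H times that of -I is [levi (invmx H) H]. *)
  have := PM (weyl_ind (mulmxV uH) (mulVmx uH) hH hK)
    (weyl_ind (H := - 1%:M) (K := - 1%:M) _ _ _ _).
  by rewrite weyl_mul !mulmxN !mulmx1 !opprK; apply; rewrite ?mulNmx ?mul1mx ?opprK // hN h1.
- have /(congr1 determinant) := eVU; rewrite det_mulmx det_h det1 => e.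
  by apply: contra_eq_neq e => ->; rewrite conjC0 mulr0 eq_sym oner_eq0.
Qed.

(** The big cell: M is the translation by A C^-1, a Weyl element, a Levi matrix and the translation
    by C^-1 D. Both translations are Hermitian, by the column relations and the row relations of
    SU(2,2) respectively. *)
Lemma SU22_ind_aux (A B C' D : 'M[C]_2) : \det C' != 0 ->
  let M := block_mx A B C' D : 'M_(2 + 2) in SU22 R M -> P M.
Proof.
move=> dC M SM; have [dM /SU22_block [e1 e2 e3 e4]] := SM.
have uC : C' \in unitmx by rewrite unitmxE unitfE.
have f1 : C' *m D^h = D *m C'^h.
  have := SU22_JmxV SM; rewrite /M /Jmx h_block !(@mulmx_block _ 2 2 2 2 2 2).
  rewrite !mulmx0 !mulmx1 !mulmxN !mulmx1 !add0r !addr0 !mulNmx.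
  by move=> /(@eq_block_mx _ 2 2 2 2)[_ _ _ /eqP]; rewrite subr_eq0 => /eqP.
set K := invmx C'.
have KC : K *m C' = 1%:M by rewrite mulVmx.
have CK : C' *m K = 1%:M by rewrite mulmxV.
have hCK : K^h *m C'^h = 1%:M by rewrite -hM CK h1.
have H1 : (A *m K)^h = A *m K.
  rewrite hM -[LHS]mulmx1 -CK mulmxA -(mulmxA K^h) e1 mulmxA hCK mul1mx //.
have H2 : (K *m D)^h = K *m D.
  rewrite hM -[LHS]mul1mx -KC -mulmxA (mulmxA C') f1 -!mulmxA.
  by rewrite -hM KC h1 mulmx1.
have eM : M = upperU (A *m K) *m (upperU (- 1%:M) *m lowerU 1%:M *m upperU (- 1%:M)
    *m levi C' K^h) *m upperU (K *m D).
  rewrite weyl_factor ?mulmx1 // antidiag_levi upperU_mul mul_upperU.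
  rewrite mul1mx mulmx0 addr0 add0r mulNmx mul1mx -(mulmxA A) KC mulmx1 (mulmxA C') CK mul1mx addr0 /M.
  apply: block4_eq => //; rewrite mulmxA -H1 hM -mulmxA.
  by rewrite -[in LHS](mul1mx B) -hCK -mulmxA -[X in _ - X]mulmx1 -mulmxBr; congr (_ *m _); rewrite -e3 subKr.
rewrite eM; apply: PM; [apply: PM|exact: Pu]; first exact: Pu.
apply: PM; first by rewrite weyl_factor ?mulmx1 //; apply: weyl_ind; rewrite ?mulmx1 ?h1.
apply: levi_ind; first by rewrite hK.
(* Here det M = 1 enters: it gives det C' conj(det K) = 1, which with det C' det K = 1 makes det K
   real. *)
have /(congr1 determinant) := eM; rewrite dM !det_mulmx !det_upperU det_lowerU !mul1r !mulr1.
rewrite /levi (@det_ublock _ 2 2) det_h => e.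
have e' : \det C' * \det K = 1 by rewrite -det_mulmx CK det1.
by apply: (mulfI dC); rewrite conjCK e' -e.
Qed.

(** Right multiplication by [lowerU t%:M] replaces C by C + t D, so it is enough to find a real t
    with det(C + t D) != 0. If t = 0, 1, -1 all fail, this polynomial of degree at most 2 vanishes
    identically, in particular at t = i. A row vector u killed by C + i D is then killed by both C
    and D, which contradicts the invertibility of M. *)
Lemma SU22_ind M : SU22 R M -> P M.
Proof.
have [A [B [C' [D ->]]]] := block4 M => SM.
pose Q t := P (block_mx A B C' D : 'M_(2 + 2)) \/ \det (C' + t *: D) = 0.
have Qt t : t^* = t -> Q t.
  move=> tt; have [|dC] := eqVneq (\det (C' + t *: D)) 0; [by right|left].
  have ht s : s^* = s -> (s%:M : 'M[C]_2)^h = s%:M.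
    by move=> e; rewrite map_scalar_mx /= e tr_scalar_mx.
  have eM : (block_mx A B C' D : 'M_(2 + 2)) =
      (block_mx (A + t *: B) B (C' + t *: D) D : 'M_(2 + 2)) *m lowerU (- t)%:M.
    by rewrite mul_lowerU !mul_mx_scalar !scaleNr !addrK.
  rewrite eM; apply: PM; last by apply: Pl; rewrite ht // rmorphN /= tt.
  apply: SU22_ind_aux => //; move: SM; rewrite {1}eM => SM.
  have := SU22M SM (lowerU_SU22 (ht t tt)).
  rewrite -mulmxA {1}/lowerU mul_lowerU !mul1mx mul0mx addr0 -raddfD addNr.
  by rewrite raddf0 -(@scalar_mx_block _ 2 2) mulmx1.
have [//|d0] := Qt 0 (conjC0 _); have [//|d1] := Qt 1 (conjC1 _).
have [|//|dm1] := Qt (- 1); first by rewrite rmorphN /= conjC1.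
have {d0 d1 dm1} d : \det (C' + 'i *: D) = 0.
  move: d0 d1 dm1; rewrite (mx2_eta C') (mx2_eta D) !mx2E.
  move: (C' 0 0) (C' 0 1) (C' 1 0) (C' 1 1) (D 0 0) (D 0 1) (D 1 0) (D 1 1).
  move=> a b c d a' b' c' d' d0 d1 dm1.
  have ii : 'i * 'i = -1 :> C by rewrite -expr2 sqrCi.
  (* [E t] is det(C' + t D); its coefficients are read off from the values at 0, 1 and -1. *)
  pose E t := (a + t * a') * (d + t * d') - (b + t * b') * (c + t * c').
  have dD : a' * d' - b' * c' = 0.
    apply: (mulfI (x := 2)); rewrite ?pnatr_eq0 // mulr0.
    transitivity (E 1 + E (- 1) - 2 * E 0); first by rewrite /E; ring.
    by rewrite [E 1]d1 [E (- 1)]dm1 [E 0]d0; ring.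
  have dp : a * d' + a' * d - b * c' - b' * c = 0.
    apply: (mulfI (x := 2)); rewrite ?pnatr_eq0 // mulr0.
    transitivity (E 1 - E (- 1)); first by rewrite /E; ring.
    by rewrite [E 1]d1 [E (- 1)]dm1; ring.
  transitivity ((a * d - b * c) + 'i * (a * d' + a' * d - b * c' - b' * c)
     + 'i * 'i * (a' * d' - b' * c')); first by ring.
  by rewrite dD dp -[RHS]d0; ring.
have /eqP/det0P[u u0 e] := d.
have f1 : C' *m D^h = D *m C'^h.
  have := SU22_JmxV SM; rewrite /Jmx h_block !(@mulmx_block _ 2 2 2 2 2 2).
  rewrite !mulmx0 !mulmx1 !mulmxN !mulmx1 !add0r !addr0 !mulNmx.
  by move=> /(@eq_block_mx _ 2 2 2 2)[_ _ _ /eqP]; rewrite subr_eq0 => /eqP.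
have eC : u *m C' = - 'i *: (u *m D).
  by apply/eqP; rewrite scaleNr -addr_eq0 scalemxAr -mulmxDr e.
have eD : u *m D = 0.
  apply: gram_eq0; rewrite hM mulmxA.
  (* Inserting u C = -i u D in this identity gives -i |u D|^2 = i |u D|^2, hence u D = 0. *)
  have : u *m C' *m D^h *m u^h = u *m D *m C'^h *m u^h by rewrite -!(mulmxA u) f1.
  rewrite eC -(mulmxA _ C'^h) -hM eC hZ hM -!scalemxAl -scalemxAr mulmxA rmorphN /= conjCi opprK.
  move=> /eqP; rewrite -subr_eq0 -scalerBl scaler_eq0 -opprD oppr_eq0.
  by rewrite -mulr2n mulrn_eq0 /= (negPf (neq0Ci _)) => /eqP.
have [+ _] := SU22_inv SM; move=> /(congr1 (mulmx (row_mx 0 u : 'M_(1, 2 + 2)))).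
rewrite mulmxA (@mul_row_block _ 1 2 2 2 2) !mul0mx !add0r eC eD scaler0 row_mx0 mul0mx.
rewrite mulmx1 -[0](@row_mx0 _ 1 2 2) => /(@eq_row_mx _ 1 2 2)[_ e0].
by rewrite -e0 eqxx in u0.
Qed.

End Induction.
End Generation.

(** * The quadratic form *)

Section Form.
Variables (R : realType) (m : nat).
Hypothesis m_gt0 : (0 < m)%N.
Local Notation C := R[i].
Local Notation toC := (real_complex R).
Local Notation w := (omega R m).
Local Notation vec := (@vec6 R m).
Local Notation tilde := (@tilde R m).
Local Notation S1C := (map_mx toC (S1 R m)).

Lemma mulmx_ext n p (A B : 'M[C]_(n, p)) :
  (forall u : 'cV_p, A *m u = B *m u) -> A = B.
Proof.
move=> e; apply/matrixP => i j; have := e (delta_mx j 0).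
by rewrite -!colE => /colP/(_ i); rewrite !mxE.
Qed.

Lemma vecP (u : 'cV[C]_6) : exists x Z y, u = vec x Z y.
Proof.
pose u' := u : 'cV_(1 + 4 + 1).
exists ((usubmx (usubmx u')) 0 0), (varphi_inv m (dsubmx (usubmx u'))), ((dsubmx u') 0 0).
by rewrite /vec6 varphi_invK // -!mx11_scalar !vsubmxK.
Qed.

Lemma vec_inj x Z y x' Z' y' : vec x Z y = vec x' Z' y' -> [/\ x = x', Z = Z' & y = y'].
Proof.
move=> /(@eq_col_mx _ 5 1 1)[/(@eq_col_mx _ 1 4 1)[ex eZ] ey]; split.
- by have := congr1 (fun A : 'M_1 => A 0 0) ex; rewrite !mxE.
- by rewrite -[Z](varphiK m_gt0) eZ varphiK.
- by have := congr1 (fun A : 'M_1 => A 0 0) ey; rewrite !mxE.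
Qed.

Definition amat (u : 'cV[C]_6) : 'M[C]_4 :=
  let u' := u : 'cV_(1 + 4 + 1) in
  antisym ((usubmx (usubmx u')) 0 0) (varphi_inv m (dsubmx (usubmx u'))) ((dsubmx u') 0 0).

Lemma amat_vec x Z y : amat (vec x Z y) = antisym x Z y.
Proof. by rewrite /amat /vec6 !col_mxKu !col_mxKd varphiK // !mxE !mulr1n. Qed.

Lemma antisym_inj x Z y x' Z' y' : antisym x Z y = antisym x' Z' y' :> 'M[C]_4 ->
  [/\ x = x', Z = Z' & y = y'].
Proof.
move=> /(@eq_block_mx _ 2 2 2 2)[ex eZ _ ey]; split=> //.
- by apply: oppr_inj; have := congr1 (fun A : 'M_2 => A 0 0) ex; rewrite !mxE.
- by have := congr1 (fun A : 'M_2 => A 0 0) ey; rewrite !mxE.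
Qed.

Lemma amat_inj : injective amat.
Proof.
move=> u v; have [x [Z [y ->]]] := vecP u; have [x' [Z' [y' ->]]] := vecP v.
by rewrite !amat_vec => /antisym_inj[-> -> ->].
Qed.

Lemma amat_tilde M u : amat (tilde M *m u) = M *m amat u *m sharp4 M.
Proof.
have [A [B [C' [D ->]]]] := block4 M; have [x [Z [y ->]]] := vecP u.
by rewrite tilde_vec // !amat_vec antisym_act.
Qed.

Lemma amatD u v : amat (u + v) = amat u + amat v.
Proof.
rewrite /amat /antisym (@add_block_mx _ 2 2 2 2) -sharpD -varphi_invD.
apply: block4_eq; do ?congr sharp; do ?congr varphi_inv.
- by rewrite -raddfD; congr _%:M; rewrite !mxE opprD.
- by apply/matrixP => i j; rewrite !mxE.
- by apply/matrixP => i j; rewrite !mxE.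
- by rewrite -raddfD; congr _%:M; rewrite !mxE.
Qed.

Lemma amatZ k u : amat (k *: u) = k *: amat u.
Proof.
rewrite /amat /antisym (@scale_block_mx _ 2 2 2 2) -sharpZ -varphi_invZ.
rewrite !scale_scalar_mx; apply: block4_eq => //; do ?congr sharp; do ?congr varphi_inv.
- by rewrite !mxE mulrN.
- by apply/matrixP => i j; rewrite !mxE.
- by apply/matrixP => i j; rewrite !mxE.
- by rewrite !mxE.
Qed.

Lemma tildeM M N : tilde (M *m N) = tilde M *m tilde N.
Proof.
apply: mulmx_ext => u; apply: amat_inj.
by rewrite -mulmxA !amat_tilde sharp4M !mulmxA.
Qed.

Lemma sharp4_1 : sharp4 1%:M = 1%:M :> 'M[C]_4.
Proof.
by rewrite (@scalar_mx_block _ 2 2) sharp4_block sharp_scalar sharp0.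
Qed.

Lemma tilde1 : tilde 1%:M = 1%:M.
Proof.
apply: mulmx_ext => u; apply: amat_inj.
by rewrite amat_tilde sharp4_1 !mul1mx mulmx1.
Qed.

Lemma sharp_h (A : 'M[C]_2) : (sharp A)^h = sharp A^h.
Proof.
by rewrite (mx2_eta A) sharp_mx2 !h_mx2 sharp_mx2 !rmorphN.
Qed.

(** Conjugating coordinates means taking the adjoint matrix, so the real vectors are those with x, y
    real and Z Hermitian. *)
Lemma varphi_h (Z : 'M[C]_2) : map_mx Num.conj (varphi m Z) = varphi m Z^h.
Proof.
have w0 := omega_sub_conj_neq0 R m_gt0.
have g : ((Z 0 1 - Z 1 0) / (w - w^*))^* = (Z^h 0 1 - Z^h 1 0) / (w - w^*).
  rewrite rmorphM fmorphV !rmorphB /= conjCK !mxE -[w^* - w]opprB -[(Z 0 1)^* - _]opprB.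
  by rewrite invrN mulrNN.
apply/matrixP => i j; rewrite !mxE.
case: i => [[|[|[|[|i]]]] hi] //=; rewrite ?mxE //.
have -> (a : C) : (a - (Z 0 1 - Z 1 0) / (w - w^*) * w)^*
    = a^* - (Z^h 0 1 - Z^h 1 0) / (w - w^*) * w^* by rewrite rmorphB rmorphM /= g.
rewrite !mxE; field; exact: w0.
by rewrite g !mxE.
Qed.

Lemma vec_conj x Z y : map_mx Num.conj (vec x Z y) = vec x^* Z^h y^*.
Proof.
rewrite /vec6 (@map_col_mx _ _ _ 5 1 1) (@map_col_mx _ _ _ 1 4 1) varphi_h.
by rewrite !map_scalar_mx.
Qed.

Lemma tr_h (A : 'M[C]_2) : (\tr A)^* = \tr A^h.
Proof. by rewrite mxtrace_tr trace_map_mx. Qed.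

(** This is an Eichler transformation of S1: it fixes (1, 0, 0) and moves (0, 0, 1) to (- det H, H,
    1). *)
Lemma upperU_vec H x Z y : tilde (upperU H) *m vec x Z y =
  vec (x - \tr (Z *m sharp H) - \det H * y) (Z + y *: H) y.
Proof.
rewrite tilde_vec // /act_x /act_z !sharp0 !sharp_scalar !mulmx0 !mulmx1 !mul1mx.
rewrite !mul0mx mxtrace0 det0 !mul0r subrr sub0r !det1 !mul1r opprK scaler0.
by rewrite subr0 addr0.
Qed.

Lemma lowerU_vec H x Z y : tilde (lowerU H) *m vec x Z y =
  vec x (Z - x *: sharp H) (y + \tr (H *m Z) - \det H * x).
Proof.
rewrite tilde_vec // /act_x /act_z !sharp0 !sharp_scalar !mulmx0 !mulmx1 !mul1mx.
rewrite !mul0mx mxtrace0 det0 !mul0r !det1 !mul1r !subr0 scaler0 !addr0.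
by congr vec; ring.
Qed.

Lemma S1_form x Z y x' Z' y' : (vec x Z y)^T *m S1C *m vec x' Z' y' =
  (x * y' + y * x' + \tr (Z *m sharp Z'))%:M.
Proof.
rewrite (hyperbolic_form (S0 R m) x y x' y' (varphi m Z) (varphi m Z')).
by rewrite S0_form !varphiK // -raddfD.
Qed.

Lemma vec0 : vec 0 0 0 = 0.
Proof.
apply: amat_inj; rewrite -[0 in RHS](scale0r (0 : 'cV_6)) amatZ scale0r amat_vec.
by rewrite /antisym oppr0 sharp0 raddf0; apply: (@block_mx0 _ 2 2 2 2).
Qed.

Lemma det_S1C_neq0 : \det S1C != 0.
Proof.
apply/negP => /det0P[u u0 e]; move: u0.
rewrite -[u]trmxK; have [x [Z [y eu]]] := vecP u^T; move: e; rewrite -[u]trmxK eu => e.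
have {}e x' Z' y' : x * y' + y * x' + \tr (Z *m sharp Z') = 0.
  have := S1_form x Z y x' Z' y'; rewrite e mul0mx => /esym/(congr1 (fun A : 'M_1 => A 0 0)).
  by rewrite !mxE mulr1n.
have ey : y = 0 by have := e 1 0 0; rewrite sharp0 mulmx0 raddf0 !mulr0 mulr1 addr0 add0r.
have ex : x = 0 by have := e 0 0 1; rewrite sharp0 mulmx0 raddf0 !mulr0 mulr1 !addr0.
have eZ : Z = 0.
  have {}e a b c d : \tr (Z *m sharp (mx2 a b c d)) = 0.
    by have := e 0 (mx2 a b c d) 0; rewrite !mulr0 !add0r.
  have := e 1 0 0 0; have := e 0 1 0 0; have := e 0 0 1 0; have := e 0 0 0 1.
  rewrite (mx2_eta Z) !sharp_mx2 !mulmx2 !tr_mx2 !(oppr0, mulr0, mulr1, addr0, add0r, mulrN).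
  by move=> -> /eqP + /eqP + ->; rewrite !oppr_eq0 => /eqP-> /eqP->; rewrite [RHS]zeromx2.
by rewrite ex ey eZ vec0 !trmx0 eqxx.
Qed.

(** The group [SO_S1] inside the complex matrices: [tilde M] is complex until its reality is proved,
    and computations with [vec6] need complex coordinates. *)
Definition proper_real_isometry (T : 'M[C]_6) :=
  [/\ map_mx Num.conj T = T, T^T *m S1C *m T = S1C & \det T = 1].

Lemma isometry_of_vec (T : 'M[C]_6) :
  (forall u v : 'cV[C]_6, (T *m u)^T *m S1C *m (T *m v) = u^T *m S1C *m v) -> T^T *m S1C *m T = S1C.
Proof.
move=> e; apply: mulmx_ext => v; apply: trmx_inj; apply: mulmx_ext => u.
apply: trmx_inj; rewrite trmx_mul trmxK [RHS]trmx_mul trmxK !mulmxA.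
by have := e u v; rewrite trmx_mul !mulmxA.
Qed.

Lemma isometry_det (T : 'M[C]_6) : T^T *m S1C *m T = S1C -> \det T * \det T = 1.
Proof.
move=> /(congr1 determinant); rewrite !det_mulmx det_tr => e.
apply: (mulIf det_S1C_neq0); rewrite mul1r -[RHS]e; ring.
Qed.

Lemma real_of_vec (T : 'M[C]_6) :
  (forall x Z y, x^* = x -> y^* = y -> Z^h = Z ->
     map_mx Num.conj (T *m vec x Z y) = T *m vec x Z y) -> map_mx Num.conj T = T.
Proof.
move=> e; have {}e (u : 'cV_6) : map_mx Num.conj u = u -> map_mx Num.conj T *m u = T *m u.
  have [x [Z [y ->]]] := vecP u; move=> eu; move: (eu); rewrite vec_conj.
  move=> /vec_inj[ex eZ ey]; have := e _ _ _ ex ey eZ; rewrite map_mxM.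
  by rewrite vec_conj ex eZ ey.
apply/matrixP => i j; have := e (delta_mx j 0); rewrite -!colE => /(_ _)/colP/(_ i).
by rewrite !mxE; apply; apply/matrixP => k l; rewrite !mxE rmorph_nat.
Qed.

Lemma proper_real_isometryM S T :
  proper_real_isometry S -> proper_real_isometry T -> proper_real_isometry (S *m T).
Proof.
move=> [rS iS dS] [rT iT dT]; split; first by rewrite map_mxM /= rS rT.
  by rewrite trmx_mul mulmxA -(mulmxA T^T) -(mulmxA T^T) iS iT.
by rewrite det_mulmx dS dT mulr1.
Qed.

Lemma upperU_isometry H :
  (tilde (upperU H))^T *m S1C *m tilde (upperU H) = S1C.
Proof.
apply: isometry_of_vec => u v.
have [x [Z [y ->]]] := vecP u; have [x' [Z' [y' ->]]] := vecP v.
rewrite !upperU_vec !S1_form; congr _%:M.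
rewrite (mx2_eta H) (mx2_eta Z) (mx2_eta Z').
move: (H 0 0) (H 0 1) (H 1 0) (H 1 1) (Z 0 0) (Z 0 1) (Z 1 0) (Z 1 1)
  (Z' 0 0) (Z' 0 1) (Z' 1 0) (Z' 1 1) => *.
by rewrite !scalemx2 !addmx2 !sharp_mx2 !mulmx2 !tr_mx2 !det_mx2; ring.
Qed.

Lemma lowerU_isometry H :
  (tilde (lowerU H))^T *m S1C *m tilde (lowerU H) = S1C.
Proof.
apply: isometry_of_vec => u v.
have [x [Z [y ->]]] := vecP u; have [x' [Z' [y' ->]]] := vecP v.
rewrite !lowerU_vec !S1_form; congr _%:M.
rewrite sharpD sharpN sharpZ sharpK (mx2_eta H) (mx2_eta Z) (mx2_eta Z').
move: (H 0 0) (H 0 1) (H 1 0) (H 1 1) (Z 0 0) (Z 0 1) (Z 1 0) (Z 1 1)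
  (Z' 0 0) (Z' 0 1) (Z' 1 0) (Z' 1 1) => a b c d a1 b1 c1 d1 a2 b2 c2 d2.
rewrite (sharp_mx2 a b c d) (sharp_mx2 a2 b2 c2 d2) !scalemx2 !oppmx2 !addmx2 !mulmx2.
by rewrite !tr_mx2 !det_mx2; ring.
Qed.

Lemma upperUD H K : upperU (H + K) = upperU H *m upperU K :> 'M[C]_4.
Proof. by rewrite {2}/upperU mul_upperU mul1mx mul0mx add0r addrC. Qed.

Lemma lowerUD H K : lowerU (H + K) = lowerU H *m lowerU K :> 'M[C]_4.
Proof. by rewrite {2}/lowerU mul_lowerU mul1mx mul0mx addr0. Qed.

Lemma det_upperU_tilde H : \det (tilde (upperU H)) = 1.
Proof.
have -> : H = 2^-1 *: H + 2^-1 *: H.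
  by rewrite -scalerDl -[2^-1]mul1r -splitr scale1r.
by rewrite upperUD tildeM det_mulmx (isometry_det (upperU_isometry _)).
Qed.

Lemma det_lowerU_tilde H : \det (tilde (lowerU H)) = 1.
Proof.
have -> : H = 2^-1 *: H + 2^-1 *: H.
  by rewrite -scalerDl -[2^-1]mul1r -splitr scale1r.
by rewrite lowerUD tildeM det_mulmx (isometry_det (lowerU_isometry _)).
Qed.

Lemma tilde_proper_real_isometry M : SU22 R M -> proper_real_isometry (tilde M).
Proof.
apply: (SU22_ind (P := fun M => proper_real_isometry (tilde M))) => {M}.
- by move=> M N PM PN; rewrite tildeM; apply: proper_real_isometryM.
- move=> H hH; split; [|exact: upperU_isometry|exact: det_upperU_tilde].
  apply: real_of_vec => x Z y ex ey eZ; rewrite upperU_vec vec_conj ey.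
  rewrite hD hZ ey eZ hH !rmorphB rmorphM /= ex ey -det_h hH.
  by rewrite tr_h hM sharp_h hH eZ mxtrace_mulC.
- move=> H hH; split; [|exact: lowerU_isometry|exact: det_lowerU_tilde].
  apply: real_of_vec => x Z y ex ey eZ; rewrite lowerU_vec vec_conj ex.
  rewrite hD hN hZ sharp_h ex eZ hH !rmorphB !rmorphD rmorphM /= ex ey -det_h hH.
  by rewrite tr_h hM hH eZ mxtrace_mulC.
Qed.

Lemma conj_fixed_toC n p (A : 'M[C]_(n, p)) :
  map_mx Num.conj A = A -> map_mx toC (map_mx (@complex.Re R) A) = A.
Proof. by move=> e; apply/matrixP => i j; rewrite !mxE ReK // -[in RHS]e mxE. Qed.

Lemma toC_mx_inj n p : injective (map_mx toC : 'M[R]_(n, p) -> 'M[C]_(n, p)).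
Proof. exact: (@map_mx_inj _ _ toC). Qed.

(** Since [tilde M] is already real, statements on [phi] reduce to statements on [tilde] by
    injectivity of the embedding of R in C. *)
Lemma toC_phi M : SU22 R M -> map_mx toC (phi m M) = tilde M.
Proof. by case/tilde_proper_real_isometry => e _ _; apply: conj_fixed_toC. Qed.

Lemma phiM M N : SU22 R M -> SU22 R N -> phi m (M *m N) = phi m M *m phi m N.
Proof.
move=> SM SN; apply: toC_mx_inj.
rewrite (toC_phi (SU22M SM SN)) (map_mxM toC (phi m M) (phi m N)).
by rewrite tildeM -(toC_phi SM) -(toC_phi SN).
Qed.

Lemma phi1 : phi m (1%:M : 'M[C]_4) = 1%:M.
Proof.
by apply: toC_mx_inj; rewrite (toC_phi (SU22_1 R)) tilde1 map_mx1.
Qed.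

Lemma phi_SO M : SU22 R M -> SO_S1 R m (phi m M).
Proof.
move=> SM; have [_ i d] := tilde_proper_real_isometry SM; split.
  by apply: (fmorph_inj toC); rewrite -det_map_mx (toC_phi SM) d rmorph1.
apply: toC_mx_inj; rewrite (map_mxM toC (_ *m _)) (map_mxM toC _^T).
by rewrite -map_trmx (toC_phi SM).
Qed.

End Form.

(** * Connectedness *)

Section MatrixContinuity.
Variable R : realType.

Lemma continuous_mx (T : topologicalType) n p (f : T -> 'M[R]_(n, p)) :
  (forall i j, continuous (fun x => f x i j)) -> continuous f.
Proof.
move=> cf x A [P HP sPA]; apply: (filterS (P := fun y => forall i j, P i j (f y i j))).
  by move=> y Hy; apply: sPA.
apply: filter_forall => i; apply: filter_forall => j.
exact: (cf i j x _ (HP i j)).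
Qed.

Lemma continuous_mx_entry (T : topologicalType) n p (f : T -> 'M[R]_(n, p)) i j :
  continuous f -> continuous (fun x => f x i j).
Proof.
move=> cf x.
apply: (continuous_comp (f := f) (g := fun M : 'M_(n, p) => M i j)); first exact: cf.
exact: coord_continuous.
Qed.

Lemma continuous_mulmx (T : topologicalType) n p q
    (f : T -> 'M[R]_(n, p)) (g : T -> 'M[R]_(p, q)) :
  continuous f -> continuous g -> continuous (fun x => f x *m g x).
Proof.
move=> cf cg; apply: continuous_mx => i j x.
have -> : (fun x => (f x *m g x) i j) = (fun x => \sum_k f x i k * g x k j).
  by apply/funext => y; rewrite mxE.
apply: cvg_big; first exact: add_continuous.
by move=> k _; apply: cvgM; apply: continuous_mx_entry.
Qed.

End MatrixContinuity.

Section Component.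
Variables (R : realType) (m : nat).
Hypothesis m_gt0 : (0 < m)%N.
Local Notation C := R[i].
Local Notation toC := (real_complex R).
Local Notation vec := (@vec6 R m).
Local Notation tilde := (@tilde R m).
Local Notation phi := (@phi R m).
Local Notation S1C := (map_mx toC (S1 R m)).

Lemma SO_S1M X Y : SO_S1 R m X -> SO_S1 R m Y -> SO_S1 R m (X *m Y).
Proof.
move=> [dX iX] [dY iY]; split; first by rewrite det_mulmx dX dY mulr1.
by rewrite trmx_mul mulmxA -(mulmxA Y^T) -(mulmxA Y^T) iX iY.
Qed.

Lemma SO0_SO X : SO0 R m X -> SO_S1 R m X.
Proof. exact: connected_component_sub. Qed.

(** [SO0] is given as a connected component of a set, so closure under products has to be proved. If
    B is connected and contains 1 and X, and D is connected and contains 1 and Y, then B and X D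
    meet in X, so their union is connected and contains X Y. *)
Lemma SO0M X Y : SO0 R m X -> SO0 R m Y -> SO0 R m (X *m Y).
Proof.
move=> [B [B1 sB cB] BX] [D [D1 sD cD] DY].
have SX := sB _ BX.
exists (B `|` [set X *m Z | Z in D]); last by right; exists Y.
split; first by left.
- by move=> Z [/sB //|[W /sD SW <-]]; apply: SO_S1M.
- apply: connectedU => //; first by exists X; split=> //; exists 1%:M => //; rewrite mulmx1.
  apply: connected_continuous_connected => //; apply: continuous_subspaceT.
  apply: continuous_mulmx; first exact: cst_continuous.
  by move=> Z.
Qed.

Lemma SO0_path (c : R -> 'M[R]_6) :
  continuous c -> c 0 = 1%:M -> (forall t, SO_S1 R m (c t)) -> SO0 R m (c 1).
Proof.
move=> cc c0 Sc; exists (range c); last by exists 1.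
split; first by exists 0.
  by move=> _ [t _ <-].
apply: connected_continuous_connected; last exact: continuous_subspaceT.
by apply/connected_intervalP => x y _ _ z _.
Qed.

Lemma vec_linear k x Z y x' Z' y' :
  vec (x + k * x') (Z + k *: Z') (y + k * y') = vec x Z y + k *: vec x' Z' y'.
Proof.
apply: (amat_inj m_gt0); rewrite amatD amatZ !amat_vec //.
rewrite /antisym (@scale_block_mx _ 2 2 2 2) (@add_block_mx _ 2 2 2 2).
apply: block4_eq => //.
- by rewrite scale_scalar_mx -raddfD /= mulrN -opprD.
- by rewrite sharpD sharpZ.
- by rewrite scale_scalar_mx -raddfD.
Qed.

(** The matrices attached to t H depend on t by polynomials of degree at most 2, and continuity is
    checked on these rather than on the formulas for M~. *)
Lemma SO0_quadratic_path (c : R -> 'M[R]_6) (A B : 'M[R]_6) :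
  (forall t, c t = 1%:M + t *: A + (t * t) *: B) -> (forall t, SO_S1 R m (c t)) ->
  SO0 R m (c 1).
Proof.
move=> ec; apply: SO0_path; last by rewrite ec mul0r !scale0r !addr0.
apply: continuous_mx => i j t.
have -> : (fun t => c t i j) = (fun t => (1%:M : 'M[R]_6) i j + t * A i j + t * t * B i j).
  by apply/funext => s; rewrite ec !mxE.
apply: cvgD; last by apply: cvgM; [apply: cvgM; exact: cvg_id|exact: cvg_cst].
by apply: cvgD; [exact: cvg_cst|apply: cvgM; [exact: cvg_id|exact: cvg_cst]].
Qed.

Lemma conj_fixed_half (S T : 'M[C]_6) :
  map_mx Num.conj S = S -> map_mx Num.conj T = T ->
  map_mx Num.conj (2^-1 *: (S - T)) = 2^-1 *: (S - T) /\
  map_mx Num.conj (2^-1 *: (S + T) - 1%:M) = 2^-1 *: (S + T) - 1%:M.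
Proof.
have hh : (2^-1 : C)^* = 2^-1 by rewrite fmorphV rmorph_nat.
have cZ k (U : 'M[C]_6) : map_mx Num.conj (k *: U) = k^* *: map_mx Num.conj U.
  by apply/matrixP => i j; rewrite !mxE rmorphM.
by move=> rS rT; rewrite map_mxB !cZ map_mxB map_mxD hh rS rT map_mx1.
Qed.

(** The coefficients come from interpolation at 0, 1 and -1. As combinations of values at real
    parameters they are real, so the path exists over R. *)
Lemma quadratic_family (M : C -> 'M[C]_4) :
  let A := 2^-1 *: (tilde (M 1) - tilde (M (- 1))) in
  let B := 2^-1 *: (tilde (M 1) + tilde (M (- 1))) - 1%:M in
  (forall t : R, SU22 R (M (toC t))) ->
  (forall t : C, tilde (M t) = 1%:M + t *: A + (t * t) *: B) ->
  SO0 R m (phi (M 1)).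
Proof.
move=> A B SM eM.
have [r1 _ _] : proper_real_isometry m (tilde (M 1)).
  by have := SM 1; rewrite rmorph1; apply: tilde_proper_real_isometry.
have [rm _ _] : proper_real_isometry m (tilde (M (- 1))).
  by have := SM (- 1); rewrite rmorphN1; apply: tilde_proper_real_isometry.
have [rA rB] := conj_fixed_half r1 rm; rewrite -/A -/B in rA rB.
clearbody A B.
have := SO0_quadratic_path (c := fun t => phi (M (toC t)))
  (A := map_mx (@complex.Re R) A) (B := map_mx (@complex.Re R) B).
rewrite rmorph1; apply=> t; last exact: phi_SO.
apply: toC_mx_inj; rewrite (toC_phi m_gt0 (SM t)) eM.
rewrite !(map_mxD toC) !(map_mxZ toC) (conj_fixed_toC rA) (conj_fixed_toC rB).
by rewrite (map_mx1 toC) (rmorphM toC).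
Qed.

Lemma vecD x Z y x' Z' y' : vec x Z y + vec x' Z' y' = vec (x + x') (Z + Z') (y + y').
Proof. by rewrite -[vec x' _ _]scale1r -vec_linear !mul1r scale1r. Qed.

Lemma vecZ k x Z y : k *: vec x Z y = vec (k * x) (k *: Z) (k * y).
Proof. by rewrite -[LHS]add0r -(@vec0 R m m_gt0) -vec_linear !add0r. Qed.

Lemma vecN x Z y : - vec x Z y = vec (- x) (- Z) (- y).
Proof. by rewrite -scaleN1r vecZ !mulN1r scaleN1r. Qed.

Lemma quadratic_family_vec (T : C -> 'M[C]_6) :
  (forall u : 'cV[C]_6, exists v w : 'cV[C]_6,
     forall t, T t *m u = u + t *: v + (t * t) *: w) ->
  forall t, T t = 1%:M + t *: (2^-1 *: (T 1 - T (- 1)))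
                + (t * t) *: (2^-1 *: (T 1 + T (- 1)) - 1%:M).
Proof.
move=> e t; apply: mulmx_ext => u; have [v [w evw]] := e u.
rewrite !(mulmxDl, mulNmx) -!scalemxAl !(mulmxDl, mulNmx) -!scalemxAl !(mulmxDl, mulNmx).
by rewrite !evw mul1mx; apply/matrixP => i j; rewrite !mxE; field; rewrite ?pnatr_eq0.
Qed.

Lemma SO0_upperU H : H^h = H -> SO0 R m (phi (upperU H)).
Proof.
move=> hH; rewrite -[H]scale1r.
apply: (quadratic_family (M := fun t => upperU (t *: H))) => [t|].
  by apply: upperU_SU22; rewrite hZ hH conjC_toC.
apply: quadratic_family_vec => u; have [x [Z [y ->]]] := vecP m_gt0 u.
exists (vec (- \tr (Z *m sharp H)) (y *: H) 0), (vec (- (\det H * y)) 0 0) => t.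
rewrite -!vec_linear upperU_vec // sharpZ -scalemxAr mxtraceZ detZ.
by rewrite !scaler0 addr0 !scalerA; congr vec; rewrite ?[t * y]mulrC //; ring.
Qed.

Lemma SO0_lowerU H : H^h = H -> SO0 R m (phi (lowerU H)).
Proof.
move=> hH; rewrite -[H]scale1r.
apply: (quadratic_family (M := fun t => lowerU (t *: H))) => [t|].
  by apply: lowerU_SU22; rewrite hZ hH conjC_toC.
apply: quadratic_family_vec => u; have [x [Z [y ->]]] := vecP m_gt0 u.
exists (vec 0 (- x *: sharp H) (\tr (H *m Z))), (vec 0 0 (- (\det H * x))) => t.
rewrite -!vec_linear lowerU_vec // sharpZ -scalemxAl mxtraceZ detZ.
rewrite !scaler0 addr0 !scalerA; congr vec; [by ring| |by ring].
by rewrite mulrN scaleNr [t * x]mulrC.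
Qed.

Lemma SO0_phi M : SU22 R M -> SO0 R m (phi M).
Proof.
move=> SM; suff [] : SU22 R M /\ SO0 R m (phi M) by [].
apply: (SU22_ind (P := fun M => SU22 R M /\ SO0 R m (phi M))) SM => {M}.
- move=> M N [SM PM] [SN PN]; split; first exact: SU22M.
  by rewrite phiM //; apply: SO0M.
- by move=> H hH; split; [exact: upperU_SU22|exact: SO0_upperU].
- by move=> H hH; split; [exact: lowerU_SU22|exact: SO0_lowerU].
Qed.

End Component.

(** * Surjectivity *)

Section Surjectivity.
Variables (R : realType) (m : nat).
Hypothesis m_gt0 : (0 < m)%N.
Local Notation C := R[i].
Local Notation toC := (real_complex R).
Local Notation w := (omega R m).
Local Notation vec := (@vec6 R m).
Local Notation tilde := (@tilde R m).
Local Notation phi := (@phi R m).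
Local Notation S1C := (map_mx toC (S1 R m)).
Local Notation iso := (@proper_real_isometry R m).

Lemma vecE x z0 z1 z2 z3 y : vec x (varphi_inv m (col4 z0 z1 z2 z3)) y =
  \col_(i < 6) [:: x; z0; z1; z2; z3; y]`_i.
Proof.
rewrite /vec6 varphi_invK //; apply/matrixP => i j; rewrite ord1 [RHS]mxE.
case: (@splitP 5 1 i) => [k ki|k ki].
  have -> : i = lshift 1 k by apply/val_inj.
  rewrite (@col_mxEu _ 5 1); case: (@splitP 1 4 k) ki => [l lk|l lk] ki.
    have -> : k = lshift 4 l by apply/val_inj.
    by rewrite (@col_mxEu _ 1 4) !mxE ord1.
  have -> : k = rshift 1 l by apply/val_inj.
  by rewrite (@col_mxEd _ 1 4) !mxE; case: l {lk ki} => [[|[|[|[|l]]]] hl].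
have -> : i = rshift 5 k by apply/val_inj.
by rewrite (@col_mxEd _ 5 1) !mxE !ord1 mulr1n.
Qed.

Lemma delta_vec (j : 'I_6) : delta_mx j 0 =
  [:: vec 1 0 0; vec 0 (mx2 1 0 0 0) 0; vec 0 (mx2 0 1 1 0) 0;
      vec 0 (mx2 0 w w^* 0) 0; vec 0 (mx2 0 0 0 1) 0; vec 0 0 1]`_j.
Proof.
have e (z0 z1 z2 z3 : C) : varphi_inv m (col4 z0 z1 z2 z3) =
    mx2 z0 (z1 + z2 * w) (z1 + z2 * w^*) z3 by rewrite /varphi_inv !mxE.
have e0 : 0 = varphi_inv m (col4 0 0 0 0) :> 'M[C]_2.
  by rewrite e !mul0r addr0 [LHS]zeromx2.
have ea : mx2 1 0 0 0 = varphi_inv m (col4 1 0 0 0) :> 'M[C]_2.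
  by rewrite e !mul0r addr0.
have eb : mx2 0 1 1 0 = varphi_inv m (col4 0 1 0 0) :> 'M[C]_2.
  by rewrite e !mul0r addr0.
have ec : mx2 0 w w^* 0 = varphi_inv m (col4 0 0 1 0) :> 'M[C]_2.
  by rewrite e !mul1r !add0r.
have ed : mx2 0 0 0 1 = varphi_inv m (col4 0 0 0 1) :> 'M[C]_2.
  by rewrite e !mul0r addr0.
rewrite ea eb ec ed e0 !vecE.
apply/matrixP => i k; rewrite ord1 mxE eqxx andbT.
by case: j i => [[|[|[|[|[|[|j]]]]]] hj] [[|[|[|[|[|[|i]]]]]] hi] //=; rewrite !mxE.
Qed.

Lemma levi_vec V U x Z y : tilde (levi V U) *m vec x Z y =
  vec (\det V * x) (V *m Z *m sharp U) (\det U * y).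
Proof.
rewrite tilde_vec // /act_x /act_z !sharp0 !mulmx0 !mul0mx mxtrace0 det0.
rewrite !scaler0 !mul0r.
by rewrite !subr0 !addr0 sub0r opprK.
Qed.

Lemma Jmx_vec x Z y : tilde (Jmx R) *m vec x Z y = vec (- y) (- sharp Z) (- x).
Proof.
rewrite /Jmx tilde_vec // /act_x /act_z !sharp0 !sharpN !sharp_scalar.
have dN : \det (- 1%:M : 'M[C]_2) = 1 by rewrite scalarmx2 oppmx2 det_mx2; ring.
rewrite !mulmx0 !mul0mx mxtrace0 det0 !mul0r !scaler0 dN det1 !mul1r mulmx1 mulNmx mul1mx.
by rewrite !(subr0, addr0, sub0r, add0r).
Qed.

Lemma Jmx_SU22 : SU22 R (Jmx R).
Proof.
have h : (- 1%:M : 'M[C]_2)^h = - 1%:M by rewrite hN h1.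
rewrite /Jmx -(weyl_factor (mulmx1 1%:M) (mulmx1 1%:M)).
by apply: SU22M; [apply: SU22M|]; [apply: upperU_SU22|apply: lowerU_SU22|apply: upperU_SU22];
  rewrite ?h1.
Qed.

End Surjectivity.

(** * Transitivity on real isotropic vectors *)

Section Transitivity.
Variables (R : realType) (m : nat).
Hypothesis m_gt0 : (0 < m)%N.
Local Notation C := R[i].
Local Notation toC := (real_complex R).
Local Notation w := (omega R m).
Local Notation vec := (@vec6 R m).
Local Notation tilde := (@tilde R m).
Local Notation S1C := (map_mx toC (S1 R m)).
Local Notation iso := (@proper_real_isometry R m).

Definition moves (u v : 'cV[C]_6) := exists2 M, SU22 R M & tilde M *m u = v.

Lemma det_sharp (V : 'M[C]_2) : \det (sharp V) = \det V.
Proof. by rewrite [in RHS](mx2_eta V) /sharp !det_mx2; ring. Qed.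

Lemma moves_trans u v t : moves u v -> moves v t -> moves u t.
Proof.
move=> [M SM <-] [N SN <-]; exists (N *m M); first exact: SU22M.
by rewrite tildeM // mulmxA.
Qed.

(** The translation by -Z/y removes Z; the first coordinate then vanishes because xy + det Z is
    preserved. *)
Lemma upperU_isotropic x Z y : y != 0 -> x * y + \det Z = 0 ->
  tilde (upperU (- y^-1 *: Z)) *m vec x Z y = vec 0 0 y.
Proof.
move=> y0 e; rewrite upperU_vec // sharpZ -scalemxAr mul_sharp mxtraceZ detZ mxtrace_scalar.
have -> : \det Z = - (x * y) by apply/eqP; rewrite -addr_eq0 addrC e.
have -> : Z + y *: (- y^-1 *: Z) = 0 by rewrite scalerA mulrN divff // scaleN1r subrr.
by congr vec; rewrite -mulr_natr; field.
Qed.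

Lemma diag_conj (a d : C) : a^* = a -> d^* = d -> (mx2 a 0 0 d)^h = mx2 a 0 0 d.
Proof. by move=> ea ed; rewrite h_mx2 ea ed conjC0. Qed.

Lemma isotropic_moves_nz x Z y : x^* = x -> y^* = y -> Z^h = Z -> y != 0 ->
  x * y + \det Z = 0 -> moves (vec x Z y) (vec 1 0 0).
Proof.
move=> ex ey eZ y0 e; apply: (moves_trans (v := vec 0 0 y)).
  exists (upperU (- y^-1 *: Z)); last exact: upperU_isotropic.
  by apply: upperU_SU22; rewrite hZ rmorphN fmorphV /= ey eZ.
apply: (moves_trans (v := vec (- y) 0 0)).
  by exists (Jmx R); [exact: Jmx_SU22|rewrite Jmx_vec // sharp0 !oppr0].
exists (levi (mx2 (- y^-1) 0 0 1) (mx2 (- y) 0 0 1)); last first.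
  by rewrite levi_vec // !det_mx2 mulmx0 mul0mx mulr0; congr vec; field.
apply: levi_SU22; last by rewrite det_mx2 !mulr0 mulr1 subr0 rmorphN /= ey.
rewrite diag_conj ?rmorphN ?conjC1 /= ?ey // mulmx2 scalarmx2.
by congr mx2; field.
Qed.

Lemma hermitian_tr_det0 (Z : 'M[C]_2) : Z^h = Z -> \det Z = 0 -> \tr Z = 0 -> Z = 0.
Proof.
move=> /hermitian2P[a [d [b ->]]]; rewrite det_mx2 tr_mx2 => eD eT.
have ed : toC d = - toC a by apply/eqP; rewrite -addr_eq0 addrC eT.
move: eD; rewrite ed mulrN -{2}(conjC_toC a) -opprD => /eqP.
rewrite oppr_eq0 paddr_eq0 ?mul_conjC_ge0 // !mul_conjC_eq0 => /andP[/eqP-> /eqP->].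
by rewrite oppr0 conjC0 [RHS]zeromx2.
Qed.

(** If y != 0, a translation removes Z and then x. If y = 0 but x != 0, the matrix J exchanges the
    two coordinates up to sign. The remaining vectors are first moved to one with x != 0. *)
Lemma isotropic_moves x Z y : x^* = x -> y^* = y -> Z^h = Z -> vec x Z y != 0 ->
  x * y + \det Z = 0 -> moves (vec x Z y) (vec 1 0 0).
Proof.
move=> ex ey eZ v0 e.
have [y0|] := eqVneq y 0; last by move=> y0; apply: isotropic_moves_nz.
have nz_x x' Z' : x'^* = x' -> Z'^h = Z' -> x' != 0 -> \det Z' = 0 ->
    moves (vec x' Z' 0) (vec 1 0 0).
  move=> ex' eZ' x0 dZ'; apply: (moves_trans (v := vec 0 (- sharp Z') (- x'))).
    by exists (Jmx R); [exact: Jmx_SU22|rewrite Jmx_vec // oppr0].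
  apply: isotropic_moves_nz; rewrite ?oppr_eq0 ?conjC0 //.
  - by rewrite rmorphN /= ex'.
  - by rewrite hN sharp_h eZ'.
  - by rewrite mul0r add0r -scaleN1r detZ det_sharp dZ' mulr0.
have dZ : \det Z = 0 by move: e; rewrite y0 mulr0 add0r.
rewrite y0 in v0 *.
have [x0|] := eqVneq x 0; last by move=> x0; apply: nz_x.
have tZ : \tr Z != 0.
  apply: contraNneq v0 => tZ; rewrite x0 (hermitian_tr_det0 eZ dZ tZ) vec0 //.
(* A nonzero singular Hermitian Z has nonzero trace, and translating by I turns x = 0 into x = - tr
   Z. *)
apply: (moves_trans (v := vec (- \tr Z) Z 0)).
  exists (upperU 1%:M); first by apply: upperU_SU22; rewrite h1.
  by rewrite upperU_vec // sharp_scalar mulmx1 mulr0 scale0r addr0 x0 subr0 sub0r.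
by apply: nz_x => //; rewrite ?oppr_eq0 // rmorphN /= tr_h eZ.
Qed.

(** These Levi matrices realise the action Z -> V Z V^h of SL2(C) on Hermitian matrices, with x and
    y fixed. *)
Lemma SL2_levi_SU22 (V : 'M[C]_2) : \det V = 1 -> SU22 R (levi V (sharp V)^h).
Proof.
move=> dV; have dS : \det (sharp V) = 1 by rewrite det_sharp.
apply: levi_SU22; first by rewrite hK mul_sharp dV.
by rewrite det_h dS !conjC1.
Qed.

Lemma SL2_levi_vec (V : 'M[C]_2) x Z y : \det V = 1 ->
  tilde (levi V (sharp V)^h) *m vec x Z y = vec x (V *m Z *m V^h) y.
Proof.
move=> dV; have dS : \det (sharp V) = 1 by rewrite det_sharp.
by rewrite levi_vec // -sharp_h sharpK det_h dS conjC1 dV !mul1r.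
Qed.

(** The sign tells whether Z is positive or negative semidefinite, which V Z V^h inherits. It is the
    origin of the alternative in [iso_in_image_or]. *)
Lemma hermitian_rank1 (Z : 'M[C]_2) : Z^h = Z -> \det Z = 0 -> Z != 0 ->
  exists V : 'M[C]_2, \det V = 1 /\
   (V *m Z *m V^h = mx2 1 0 0 0 \/ V *m Z *m V^h = mx2 (- 1) 0 0 0).
Proof.
have sc (a : R) : a != 0 -> exists V : 'M[C]_2, \det V = 1 /\
   (V *m mx2 (toC a) 0 0 0 *m V^h = mx2 1 0 0 0 \/
    V *m mx2 (toC a) 0 0 0 *m V^h = mx2 (- 1) 0 0 0).
  move=> a0; set s := Num.sqrt `|a|.
  have s0 : s != 0 by rewrite gt_eqF // sqrtr_gt0 normr_gt0.
  have ss : s * s = `|a| by rewrite -expr2 sqr_sqrtr.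
  exists (mx2 (toC s^-1) 0 0 (toC s)); split.
    by rewrite det_mx2 mul0r subr0 -rmorphM /= mulVf // rmorph1.
  rewrite diag_conj ?conjC_toC // !mulmx2 !mulr0 !mul0r !addr0 !mul0r !addr0 -!rmorphM /=.
  have [agt|alt|a1] := ltrgt0P a; last by rewrite a1 eqxx in a0.
    left; congr mx2; have -> : s^-1 * a * s^-1 = 1; last by rewrite rmorph1.
    by rewrite -(gtr0_norm agt) -ss; field.
  right; congr mx2; have -> : s^-1 * a * s^-1 = - 1; last by rewrite rmorphN1.
  by rewrite -[a]opprK -(ltr0_norm alt) -ss; field.
have nz (a d : R) (b : C) : a != 0 -> toC a * toC d - b * b^* = 0 ->
   exists V : 'M[C]_2, \det V = 1 /\
   (V *m mx2 (toC a) b b^* (toC d) *m V^h = mx2 1 0 0 0 \/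
    V *m mx2 (toC a) b b^* (toC d) *m V^h = mx2 (- 1) 0 0 0).
  move=> a0 eD; have [V [dV eV]] := sc a a0.
  have a0' : toC a != 0 by rewrite fmorph_eq0.
  exists (V *m mx2 1 0 (- b^* / toC a) 1); split.
    by rewrite det_mulmx dV det_mx2; ring.
  rewrite hM !mulmxA -(mulmxA V) -(mulmxA V _ (mx2 _ _ _ _)^h).
  (* Elimination of b by a row operation and its adjoint; the last diagonal entry vanishes because
     the determinant does. *)
  suff -> : mx2 1 0 (- b^* / toC a) 1 *m mx2 (toC a) b b^* (toC d) *m
      (mx2 1 0 (- b^* / toC a) 1)^h = mx2 (toC a) 0 0 0 by [].
  rewrite h_mx2 conjC1 conjC0 rmorphM fmorphV rmorphN /= conjCK conjC_toC !mulmx2.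
  congr mx2; [by ring|by field|by field|].
  by apply: (mulfI a0'); rewrite mulr0 -[RHS]eD; field.
move=> /hermitian2P[a [d [b ->]]]; rewrite det_mx2 => eD n0.
have [a0|] := eqVneq a 0; last by move=> a0; apply: nz.
have b0 : b = 0.
  by move: eD; rewrite a0 rmorph0 mul0r sub0r => /eqP; rewrite oppr_eq0 mul_conjC_eq0 => /eqP.
have d0 : d != 0.
  by apply: contraNneq n0 => ->; rewrite a0 b0 conjC0 rmorph0 [in X in _ == X]zeromx2.
have [V [dV eV]] := sc d d0.
exists (V *m mx2 0 1 (- 1) 0); split.
  by rewrite det_mulmx dV det_mx2; ring.
rewrite hM !mulmxA -(mulmxA V) -(mulmxA V _ (mx2 _ _ _ _)^h).
suff -> : mx2 0 1 (- 1) 0 *m mx2 (toC a) b b^* (toC d) *m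
    (mx2 0 1 (- 1) 0)^h = mx2 (toC d) 0 0 0 by [].
rewrite h_mx2 a0 b0 rmorph0 !conjC0 conjC1 rmorphN /= conjC1 !mulmx2.
by congr mx2; ring.
Qed.

End Transitivity.

(** * Isometries fixing a hyperbolic plane and an isotropic vector orthogonal to it *)

Section Image.
Variables (R : realType) (m : nat).
Hypothesis m_gt0 : (0 < m)%N.
Local Notation C := R[i].
Local Notation toC := (real_complex R).
Local Notation w := (omega R m).
Local Notation vec := (@vec6 R m).
Local Notation tilde := (@tilde R m).
Local Notation S1C := (map_mx toC (S1 R m)).
Local Notation iso := (@proper_real_isometry R m).
Local Notation E11 := (mx2 1 0 0 0 : 'M[C]_2).
Local Notation E22 := (mx2 0 0 0 1 : 'M[C]_2).
Local Notation offdiag b := (mx2 0 b b^* 0 : 'M[C]_2).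

Lemma iso_form T x1 Z1 y1 x2 Z2 y2 x1' Z1' y1' x2' Z2' y2' : iso T ->
  T *m vec x1 Z1 y1 = vec x1' Z1' y1' -> T *m vec x2 Z2 y2 = vec x2' Z2' y2' ->
  x1' * y2' + y1' * x2' + \tr (Z1' *m sharp Z2') =
  x1 * y2 + y1 * x2 + \tr (Z1 *m sharp Z2).
Proof.
move=> [_ iT _] e1 e2.
have : (vec x1' Z1' y1')^T *m S1C *m vec x2' Z2' y2' = (vec x1 Z1 y1)^T *m S1C *m vec x2 Z2 y2.
  by rewrite -e1 -e2 trmx_mul !mulmxA -(mulmxA _ T^T) -(mulmxA _ (T^T *m _)) iT.
rewrite !(S1_form m_gt0) => /(congr1 (fun A : 'M_1 => A 0 0)).
by rewrite !mxE !mulr1n.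
Qed.

Lemma iso_real T x Z y : iso T -> x^* = x -> y^* = y -> Z^h = Z ->
  exists x' Z' y', [/\ x'^* = x', y'^* = y', Z'^h = Z' & T *m vec x Z y = vec x' Z' y'].
Proof.
move=> [rT _ _] ex ey eZ; have [x' [Z' [y' e]]] := vecP m_gt0 (T *m vec x Z y).
exists x', Z', y'; have : map_mx Num.conj (T *m vec x Z y) = T *m vec x Z y.
  by rewrite (map_mxM Num.conj T (vec x Z y)) rT (vec_conj m_gt0) ex ey eZ.
by rewrite e (vec_conj m_gt0) => /(vec_inj m_gt0)[-> -> ->].
Qed.

Lemma SU22_invP (M : 'M[C]_4) : SU22 R M ->
  exists N, [/\ SU22 R N, N *m M = 1%:M & M *m N = 1%:M].
Proof.
move=> SM; have [e1 e2] := SU22_inv SM; case: SM => dM eM.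
set N := - _ in e1 e2; exists N; split=> //; split.
  by have /(congr1 determinant) := e2; rewrite det_mulmx dM mulr1 det1.
rewrite -[in LHS]eM !mulmxA -hM -(mulmxA _ M) e1 h1 mul1mx mulmx1 //.
Qed.

Definition in_image (T : 'M[C]_6) := exists2 M, SU22 R M & tilde M = T.

Lemma in_image_left M T : SU22 R M -> in_image (tilde M *m T) -> in_image T.
Proof.
move=> SM [N SN e]; have [M' [SM' e1 e2]] := SU22_invP SM.
exists (M' *m N); first exact: SU22M.
by rewrite (tildeM m_gt0 M' N) e mulmxA -(tildeM m_gt0 M' M) e1 tilde1 // mul1mx.
Qed.

Lemma iso_tilde M T : SU22 R M -> iso T -> iso (tilde M *m T).
Proof.
by move=> SM iT; apply: proper_real_isometryM => //; apply: tilde_proper_real_isometry.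
Qed.

Lemma basis_ext (S T : 'M[C]_6) :
  S *m vec 1 0 0 = T *m vec 1 0 0 -> S *m vec 0 E11 0 = T *m vec 0 E11 0 ->
  S *m vec 0 (mx2 0 1 1 0) 0 = T *m vec 0 (mx2 0 1 1 0) 0 ->
  S *m vec 0 (offdiag w) 0 = T *m vec 0 (offdiag w) 0 ->
  S *m vec 0 E22 0 = T *m vec 0 E22 0 -> S *m vec 0 0 1 = T *m vec 0 0 1 -> S = T.
Proof.
move=> e0 e1 e2 e3 e4 e5; apply/matrixP => i j.
suff : S *m (delta_mx j 0 : 'cV_6) = T *m (delta_mx j 0 : 'cV_6) by rewrite -!colE => /colP/(_ i); rewrite !mxE.
by rewrite (@delta_vec R m m_gt0) //; case: j => [[|[|[|[|[|[|j]]]]]] hj].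
Qed.

(** As [offdiag] of conj(w) is (w + conj(w)) times [offdiag 1] minus [offdiag w], the matrix T is
    triangular in the standard basis, with diagonal entries 1 except for a single -1. *)
Lemma reflection_det (T : 'M[C]_6) :
  T *m vec 1 0 0 = vec 1 0 0 -> T *m vec 0 E11 0 = vec 0 E11 0 ->
  T *m vec 0 (mx2 0 1 1 0) 0 = vec 0 (mx2 0 1 1 0) 0 ->
  T *m vec 0 (offdiag w) 0 = vec 0 (offdiag w^*) 0 ->
  T *m vec 0 E22 0 = vec 0 E22 0 -> T *m vec 0 0 1 = vec 0 0 1 -> \det T = -1.
Proof.
move=> e0 e1 e2 e3 e4 e5.
pose j3 : 'I_6 := @Ordinal 6 3 isT; pose j2 : 'I_6 := @Ordinal 6 2 isT.
have Tn j : j != j3 -> T *m (delta_mx j 0 : 'cV_6) = delta_mx j 0.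
  by rewrite (@delta_vec R m m_gt0); case: j => [[|[|[|[|[|[|j]]]]]] hj].
have T3 : T *m (delta_mx j3 0 : 'cV_6) = (w + w^*) *: delta_mx j2 0 - delta_mx j3 0.
  rewrite !(@delta_vec R m m_gt0) /= e3 -scaleN1r !vecZ // vecD // !mulr0 addr0 conjCK.
  by congr vec; rewrite !scalemx2 addmx2; congr mx2; ring.
have Tc i j : T i j = (T *m (delta_mx j 0 : 'cV_6)) i 0 by rewrite -colE mxE.
have trigT : is_trig_mx T^T.
  apply/is_trig_mxP => i j ij; rewrite mxE Tc.
  have [e|ne] := eqVneq i j3; last by rewrite Tn // mxE -(inj_eq val_inj) (gtn_eqF ij).
  by rewrite e T3; move: ij; rewrite e !mxE; case: j => [[|[|[|[|[|[|j]]]]]] hj] //= _; rewrite mulr0 subr0.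
rewrite -det_tr det_trig // (bigD1 j3) //= mxE Tc T3 big1 => [|i ne].
  by rewrite !mxE /=; ring.
by rewrite mxE Tc Tn // mxE eqxx.
Qed.

Lemma tr_herm_sharp (a d a' d' : C) (b b' : C) :
  \tr (mx2 a b b^* d *m sharp (mx2 a' b' b'^* d')) = a * d' + d * a' - b * b'^* - b^* * b'.
Proof. by rewrite sharp_mx2 mulmx2 tr_mx2; ring. Qed.

(** The images of E22 and of [offdiag 1] are normalised in turn by elements of SL2(C) which fix
    everything normalised before. What is left acts on the off-diagonal plane and fixes [offdiag 1]:
    it is the identity or a reflection, and the reflection has determinant -1. *)
Lemma stabilizer_in_image T : iso T ->
  T *m vec 1 0 0 = vec 1 0 0 -> T *m vec 0 0 1 = vec 0 0 1 ->
  T *m vec 0 E11 0 = vec 0 E11 0 -> in_image T.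
Proof.
have sl V U : \det V = 1 -> V *m U *m V^h = U -> forall T, T *m vec 0 U 0 = vec 0 U 0 ->
    tilde (levi V (sharp V)^h) *m T *m vec 0 U 0 = vec 0 U 0.
  by move=> dV eU {}T eT; rewrite -mulmxA eT SL2_levi_vec // eU.
have sl0 V x y : \det V = 1 -> forall T, T *m vec x 0 y = vec x 0 y ->
    tilde (levi V (sharp V)^h) *m T *m vec x 0 y = vec x 0 y.
  by move=> dV {}T eT; rewrite -mulmxA eT SL2_levi_vec // mulmx0 mul0mx.
have h11 : E11^h = E11 by rewrite h_mx2 conjC0 conjC1.
have h22 : E22^h = E22 by rewrite h_mx2 conjC0 conjC1.
have ho b : (offdiag b)^h = offdiag b by rewrite h_mx2 conjCK conjC0.
have c0 := conjC0 C.
(* Once the other four vectors are fixed, the off-diagonal plane is their orthogonal complement, so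
   T' acts on it and preserves |z|. *)
have orth T' (iT : iso T') (e1 : T' *m vec 1 0 0 = vec 1 0 0)
    (e6 : T' *m vec 0 0 1 = vec 0 0 1) (e11 : T' *m vec 0 E11 0 = vec 0 E11 0)
    (e22 : T' *m vec 0 E22 0 = vec 0 E22 0) b x Z y : Z^h = Z -> T' *m vec 0 (offdiag b) 0 = vec x Z y ->
    exists2 z, z * z^* = b * b^* & T' *m vec 0 (offdiag b) 0 = vec 0 (offdiag z) 0.
  move=> eZ eT; have [a [d [z eab]]] := hermitian2P eZ.
  have := iso_form iT e1 eT; rewrite !mul0mx !mxtrace0 !mul0r !mulr0 !addr0 !mul1r => y0.
  have := iso_form iT e6 eT; rewrite !mul0mx !mxtrace0 !mul0r !mulr0 !addr0 !mul1r !add0r => x0.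
  have := iso_form iT e11 eT; rewrite eab !sharp_mx2 !mulmx2 !tr_mx2.
  rewrite !(mul0r, mulr0, add0r, addr0, mul1r, mulr1) => d1.
  have := iso_form iT e22 eT; rewrite eab !sharp_mx2 !mulmx2 !tr_mx2.
  rewrite !(mul0r, mulr0, add0r, addr0, mul1r, mulr1) => a1.
  have := iso_form iT eT eT; rewrite eab !tr_herm_sharp x0 y0 d1 a1 => zE.
  rewrite eab x0 y0 d1 a1 in eT; exists z => //.
  apply: (mulfI (x := - 2)); rewrite ?oppr_eq0 ?pnatr_eq0 //.
  transitivity (0 * 0 + 0 * 0 + (0 * 0 + 0 * 0 - z * z^* - z^* * z)); first by ring.
  by rewrite zE; ring.
move=> iT e1 e6 e11.
wlog e22 : T iT e1 e6 e11 / T *m vec 0 E22 0 = vec 0 E22 0.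
  move=> IH; have [x [Z [y [ex ey eZ eT]]]] := iso_real iT c0 c0 h22.
  have [a [d [b eab]]] := hermitian2P eZ.
  have := iso_form iT e1 eT; rewrite !mul0mx !mxtrace0 !mul0r !mulr0 !addr0 !mul1r => y0.
  have := iso_form iT e6 eT; rewrite !mul0mx !mxtrace0 !mul0r !mulr0 !addr0 !mul1r !add0r => x0.
  have := iso_form iT e11 eT; rewrite eab !sharp_mx2 !mulmx2 !tr_mx2.
  rewrite !(mul0r, mulr0, add0r, addr0, mul1r, mulr1) => d1.
  have := iso_form iT eT eT; rewrite eab tr_herm_sharp !sharp_mx2 !mulmx2 !tr_mx2 x0 y0 d1.
  rewrite !(mul0r, mulr0, add0r, addr0, mul1r, mulr1, oppr0) => aE.
  have {}aE : toC a = b * b^*.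
    by apply: (mulfI (x := 2)); rewrite ?pnatr_eq0 // -[LHS]subr0 -aE; ring.
  rewrite eab x0 y0 d1 aE in eT.
  (* The image of E22 is [[b conj(b), b], [conj(b), 1]], which this V takes back to E22 while fixing
     E11. *)
  pose V := mx2 1 (- b) 0 1 : 'M[C]_2.
  have dV : \det V = 1 by rewrite det_mx2; ring.
  apply: (in_image_left (SL2_levi_SU22 dV)).
  apply: IH.
  - by apply: iso_tilde => //; apply: SL2_levi_SU22.
  - exact: sl0.
  - exact: sl0.
  - by apply: sl => //; rewrite /V h_mx2 !mulmx2 conjC0 conjC1; congr mx2; ring.
  - rewrite -mulmxA eT SL2_levi_vec // /V h_mx2 !mulmx2 conjC0 conjC1 rmorphN /=.
    by congr vec; congr mx2; ring.
have e_1 : mx2 0 1 1 0 = offdiag 1 :> 'M[C]_2 by rewrite conjC1.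
wlog eo : T iT e1 e6 e11 e22 / T *m vec 0 (offdiag 1) 0 = vec 0 (offdiag 1) 0.
  move=> IH; have [x [Z [y [_ _ eZ eT]]]] := iso_real iT c0 c0 (ho 1).
  have [z zz {}eT] := orth _ iT e1 e6 e11 e22 _ _ _ _ eZ eT; rewrite conjC1 mulr1 in zz.
  (* For |v| = 1 the matrix diag(v, conj(v)) multiplies the upper right entry by v^2, so v^2 =
     conj(z) moves z to 1. *)
  pose v := sqrtC (z^*).
  have vv : v * v = z^* by rewrite -expr2 sqrtCK.
  have v1 : v * v^* = 1.
    have : (v * v^*) ^+ 2 = 1 by rewrite exprMn -rmorphXn /= expr2 vv conjCK mulrC.
    have : 0 <= v * v^* by apply: mul_conjC_ge0.
    by move=> v0 /eqP; rewrite sqrf_eq1 => /orP[/eqP //|/eqP e]; move: v0; rewrite e oppr_ge0 ler10.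
  pose V := mx2 v 0 0 v^* : 'M[C]_2.
  have dV : \det V = 1 by rewrite det_mx2 mulr0 subr0.
  apply: (in_image_left (SL2_levi_SU22 dV)).
  have eL : V *m E11 *m V^h = E11.
    by rewrite /V h_mx2 !mulmx2 conjC0; congr mx2; rewrite -1?[RHS]v1; ring.
  have eR : V *m E22 *m V^h = E22.
    by rewrite /V h_mx2 !mulmx2 conjC0 conjCK; congr mx2; rewrite -1?[RHS]v1; ring.
  have iT' : iso (tilde (levi V (sharp V)^h) *m T).
    by apply: iso_tilde => //; apply: SL2_levi_SU22.
  apply: (IH _ iT'); [exact: sl0|exact: sl0|exact: sl|exact: sl|].
  rewrite -mulmxA eT SL2_levi_vec // /V h_mx2 !mulmx2 !conjC0 conjCK.
  have vz : v * z * v = 1 by rewrite -zz -vv; ring.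
  have vz' : v^* * z^* * v^* = 1 by rewrite -[RHS]conjC1 -vz !rmorphM.
  congr vec; rewrite conjC1; congr mx2; [by ring|rewrite -[RHS]vz|rewrite -[RHS]vz'|by ring]; ring.
have cw0 : w^*^* = w by rewrite conjCK.
have [x [Z [y [_ _ eZ eT]]]] := iso_real iT c0 c0 (ho w).
have [z zz {}eT] := orth _ iT e1 e6 e11 e22 _ _ _ _ eZ eT.
have zw : z + z^* = w + w^*.
  have := iso_form iT eo eT; rewrite !tr_herm_sharp conjC1 => e.
  apply: oppr_inj; transitivity (0 * 0 + 0 * 0 + (0 * 0 + 0 * 0 - 1 * z^* - 1 * z)).
    by ring.
  by rewrite e; ring.
(* The numbers z and w have the same trace and the same norm. *)
have : (z - w) * (z - w^*) = 0.
  transitivity (z * z - z * (w + w^*) + w * w^*); first by ring.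
  by rewrite -zw -zz; ring.
move=> /eqP; rewrite mulf_eq0 !subr_eq0 => /orP[]/eqP zE; rewrite zE in eT.
  exists 1%:M; first exact: SU22_1.
  by rewrite tilde1 //; apply: basis_ext; rewrite !mul1mx ?e_1.
rewrite -e_1 in eo.
have := reflection_det e1 e11 eo eT e22 e6; case: iT => _ _ -> /eqP.
by rewrite -subr_eq0 opprK -mulr2n pnatr_eq0.
Qed.

End Image.

(** * Reduction of an isometry to 1 or rho, and separation of these two *)

Section Surjectivity.
Variables (R : realType) (m : nat).
Hypothesis m_gt0 : (0 < m)%N.
Local Notation C := R[i].
Local Notation toC := (real_complex R).
Local Notation w := (omega R m).
Local Notation vec := (@vec6 R m).
Local Notation tilde := (@tilde R m).
Local Notation S1C := (map_mx toC (S1 R m)).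
Local Notation iso := (@proper_real_isometry R m).
Local Notation E11 := (mx2 1 0 0 0 : 'M[C]_2).
Local Notation E22 := (mx2 0 0 0 1 : 'M[C]_2).
Local Notation in_image := (@in_image R m).

Definition rho : 'M[R]_6 :=
  block_mx (block_mx (- 1)%:M 0 0 1%:M) 0 0 (- 1)%:M : 'M_(1 + 4 + 1).
Local Notation rhoC := (map_mx toC rho).

Lemma rho_vec x Z y : rhoC *m vec x Z y = vec (- x) Z (- y).
Proof.
have -> : rhoC = (block_mx (block_mx (- 1)%:M 0 0 1%:M) 0 0 (- 1)%:M : 'M[C]_(1 + 4 + 1)).
  rewrite /rho (@map_block_mx _ _ toC 5 1 5 1) (@map_block_mx _ _ toC 1 4 1 4).
  by rewrite !map_scalar_mx !map_mx0 /= rmorphN rmorph1.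
rewrite /vec6 (@mul_block_col _ 5 1 5 1) (@mul_block_col _ 1 4 1 4).
rewrite !mul0mx !mul1mx !addr0 !add0r.
by rewrite -!scalar_mxM !mulN1r.
Qed.

Lemma rhoC_iso : iso rhoC.
Proof.
have iR : rhoC^T *m S1C *m rhoC = S1C.
  apply: isometry_of_vec => u v.
  have [x [Z [y ->]]] := vecP m_gt0 u; have [x' [Z' [y' ->]]] := vecP m_gt0 v.
  by rewrite !rho_vec !(S1_form m_gt0) !mulrNN.
split=> //.
  by apply/matrixP => i j; rewrite mxE; set z := rhoC i j; rewrite /z mxE conjC_toC.
rewrite det_map_mx /= /rho (@det_ublock _ 5 1) (@det_ublock _ 1 4) !det_scalar.
by rewrite !expr1 expr1n mulr1 mulrNN mulr1 rmorph1.
Qed.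

Lemma unit_vec_neq0 (T : 'M[C]_6) (u : 'cV[C]_6) : iso T -> u != 0 -> T *m u != 0.
Proof.
move=> [_ _ dT]; apply: contraNneq => e.
have uT : T \in unitmx by rewrite unitmxE dT unitr1.
by rewrite -[u]mul1mx -(mulVmx uT) -mulmxA e mulmx0.
Qed.

(** The images of (1, 0, 0) and (0, 0, 1) are normalised by transitivity and by a translation fixing
    (1, 0, 0). The image of E11 is then a Hermitian matrix of rank one, hence conjugate to E11 or
    -E11; the second case needs rho. *)
Lemma iso_in_image_or T : iso T -> in_image T \/ in_image (T *m rhoC).
Proof.
have c0 := conjC0 C; have c1 := conjC1 C.
have h11 : E11^h = E11 by rewrite h_mx2 conjC0 conjC1.
have h0' : (0 : 'M[C]_2)^h = 0 by rewrite h0.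
have vec_neq0 x Z y : [|| x != 0, Z != 0 | y != 0] -> vec x Z y != 0.
  by move=> n0; apply/eqP; rewrite -(@vec0 R m m_gt0) => /(vec_inj m_gt0)[ex eZ ey];
    move: n0; rewrite ex eZ ey !eqxx.
have E11_neq0 : E11 != 0.
  by apply/eqP; rewrite [RHS]zeromx2 => /mx2_inj[/eqP]; rewrite oner_eq0.
have two0 : (2 : C) != 0 by rewrite pnatr_eq0.
have isoq (S : 'M[C]_6) x Z y x' Z' y' : iso S -> S *m vec x Z y = vec x' Z' y' ->
    x' * y' + \det Z' = x * y + \det Z.
  move=> iS e; have := iso_form m_gt0 iS e e; rewrite !mul_sharp !mxtrace_scalar => e2.
  apply: (mulfI two0); transitivity (x' * y' + y' * x' + \det Z' *+ 2); first by ring.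
  by rewrite e2; ring.
have left M S : SU22 R M -> in_image (tilde M *m S) \/ in_image (tilde M *m S *m rhoC) ->
    in_image S \/ in_image (S *m rhoC).
  move=> SM [|]; first by move/(in_image_left m_gt0 SM); left.
  by rewrite -mulmxA => /(in_image_left m_gt0 SM); right.
move=> iT.
wlog e1 : T iT / T *m vec 1 0 0 = vec 1 0 0.
  move=> IH; have [x [Z [y [ex ey eZ eT]]]] := iso_real m_gt0 iT c1 c0 h0'.
  have q := isoq _ _ _ _ _ _ _ iT eT; rewrite mulr0 det0 // addr0 in q.
  have n0 : vec x Z y != 0.
    by rewrite -eT; apply: unit_vec_neq0 => //; apply: vec_neq0; rewrite oner_eq0.
  have [M SM eM] := isotropic_moves m_gt0 ex ey eZ n0 q.
  apply: (left _ _ SM); apply: IH; first exact: iso_tilde.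
  by rewrite -mulmxA eT.
wlog e6 : T iT e1 / T *m vec 0 0 1 = vec 0 0 1.
  move=> IH; have [x [Z [y [ex ey eZ eT]]]] := iso_real m_gt0 iT c0 c1 h0'.
  have := iso_form m_gt0 iT e1 eT; rewrite !mul0mx !mxtrace0 !mul0r !mulr1 !addr0 !mul1r => y1.
  have q := isoq _ _ _ _ _ _ _ iT eT; rewrite mul0r det0 // addr0 in q.
  have SM : SU22 R (upperU (- y^-1 *: Z)).
    by apply: upperU_SU22; rewrite hZ y1 invr1 rmorphN /= conjC1 eZ.
  apply: (left _ _ SM); apply: IH; first exact: iso_tilde.
    by rewrite -mulmxA e1 upperU_vec // mul0mx mxtrace0 mulr0 !subr0 scale0r addr0.
  by rewrite -mulmxA eT upperU_isotropic // y1 ?oner_eq0.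
have [x [Z [y [ex ey eZ eT]]]] := iso_real m_gt0 iT c0 c0 h11.
have := iso_form m_gt0 iT e1 eT; rewrite !mul0mx !mxtrace0 !mul0r !mulr0 !addr0 !mul1r => y0.
have := iso_form m_gt0 iT e6 eT; rewrite !mul0mx !mxtrace0 !mul0r !mulr0 !addr0 !mul1r !add0r => x0.
have q := isoq _ _ _ _ _ _ _ iT eT; rewrite x0 y0 mulr0 !add0r det_mx2 !mulr0 subrr in q.
have Z0 : Z != 0.
  have := unit_vec_neq0 iT (vec_neq0 0 E11 0 _).
  rewrite E11_neq0 orbT eT x0 y0 => /(_ isT); apply: contraNneq => ->.
  by rewrite (@vec0 R m m_gt0).
rewrite x0 y0 in eT.
have [V [dV eV]] := hermitian_rank1 eZ q Z0.
have SV := SL2_levi_SU22 dV.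
apply: (left _ _ SV); set S := tilde _ *m T.
have iS : iso S by apply: iso_tilde.
have s1 : S *m vec 1 0 0 = vec 1 0 0.
  by rewrite /S -mulmxA e1 SL2_levi_vec // mulmx0 mul0mx.
have s6 : S *m vec 0 0 1 = vec 0 0 1.
  by rewrite /S -mulmxA e6 SL2_levi_vec // mulmx0 mul0mx.
have s11 : S *m vec 0 E11 0 = vec 0 (V *m Z *m V^h) 0.
  by rewrite /S -mulmxA eT SL2_levi_vec.
clearbody S; case: eV => eV; rewrite eV in s11.
  by left; apply: (stabilizer_in_image m_gt0).
(* [levi D D] negates x, y and E11. With rho on the other side the signs of x and y cancel, so all
   three normalised vectors are fixed. *)
right; pose D := mx2 1 0 0 (- 1) : 'M[C]_2.
have dD : \det D = - 1 by rewrite det_mx2; ring.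
have cN1 : (- 1 : C)^* = - 1 by rewrite rmorphN /= conjC1.
have SD : SU22 R (levi D D).
  apply: levi_SU22; last by rewrite dD cN1.
  by rewrite diag_conj // mulmx2 scalarmx2; congr mx2; ring.
apply: (in_image_left m_gt0 SD); apply: (stabilizer_in_image m_gt0).
- by apply: iso_tilde => //; apply: proper_real_isometryM => //; apply: rhoC_iso.
- rewrite -!mulmxA rho_vec; have -> : vec (- 1) 0 (- 0) = - vec 1 0 0 by rewrite vecN // !oppr0.
  by rewrite mulmxN s1 vecN // levi_vec // !oppr0 mulmx0 mul0mx mulr0 dD mulN1r opprK.
- rewrite -!mulmxA rho_vec; have -> : vec (- 0) 0 (- 1) = - vec 0 0 1 by rewrite vecN // !oppr0.
  by rewrite mulmxN s6 vecN // levi_vec // !oppr0 mulmx0 mul0mx mulr0 dD mulN1r opprK.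
- rewrite -!mulmxA rho_vec oppr0 s11 levi_vec // !mulr0; congr vec.
  by rewrite /D sharp_mx2 !mulmx2; congr mx2; ring.
Qed.

Definition polar (u v : 'cV[R]_6) : R := (u^T *m S1 R m *m v) 0 0.

Lemma real_vecP (v : 'cV[R]_6) : exists (x a d y : R) (b : C),
  map_mx toC v = vec (toC x) (mx2 (toC a) b b^* (toC d)) (toC y).
Proof.
have [x [Z [y e]]] := vecP m_gt0 (map_mx toC v).
have : map_mx Num.conj (map_mx toC v) = map_mx toC v.
  by apply/matrixP => i j; rewrite !mxE conjC_toC.
rewrite e (vec_conj m_gt0) => /(vec_inj m_gt0)[ex /hermitian2P[a [d [b ->]]] ey].
by exists (complex.Re x), a, d, (complex.Re y), b; rewrite !ReK.
Qed.

Lemma toC_polar u v : toC (polar u v) = ((map_mx toC u)^T *m S1C *m map_mx toC v) 0 0.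
Proof. by rewrite /polar map_trmx -!(map_mxM toC) [RHS]mxE. Qed.

(** Together with [pos2] an orthogonal basis of a positive definite plane, both vectors having
    S1-value 2. The plane is maximal since S1 has signature (2, 4). *)
Definition pos1 : 'cV[R]_6 := map_mx (@complex.Re R) (vec 1 0 1).
Definition pos2 : 'cV[R]_6 := map_mx (@complex.Re R) (vec 0 1%:M 0).

Lemma toC_pos1 : map_mx toC pos1 = vec 1 0 1.
Proof. by apply: conj_fixed_toC; rewrite (vec_conj m_gt0) conjC1 h0. Qed.

Lemma toC_pos2 : map_mx toC pos2 = vec 0 1%:M 0.
Proof. by apply: conj_fixed_toC; rewrite (vec_conj m_gt0) conjC0 h1. Qed.

(* The Gram determinant of the projection of the image of a maximal positive
   definite plane to this plane; its sign separates the components of SO. *)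
Definition gramdet (X : 'M[R]_6) : R :=
  polar pos1 (X *m pos1) * polar pos2 (X *m pos2)
  - polar pos1 (X *m pos2) * polar pos2 (X *m pos1).

Lemma continuousMr (T : topologicalType) (f g : T -> R) :
  continuous f -> continuous g -> continuous (fun x => f x * g x).
Proof. by move=> cf cg x; apply: cvgM; [exact: cf|exact: cg]. Qed.

Lemma continuousBr (T : topologicalType) (f g : T -> R) :
  continuous f -> continuous g -> continuous (fun x => f x - g x).
Proof. by move=> cf cg x; apply: cvgB; [exact: cf|exact: cg]. Qed.

Lemma continuous_gramdet : continuous gramdet.
Proof.
have cX (u v : 'cV[R]_6) : continuous (fun X : 'M[R]_6 => polar u (X *m v)).
  apply: continuous_mx_entry; apply: continuous_mulmx; first exact: cst_continuous.
  by apply: continuous_mulmx; [move=> X|exact: cst_continuous].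
by apply: continuousBr; apply: continuousMr; apply: cX.
Qed.

Lemma polarDr u v1 v2 : polar u (v1 + v2) = polar u v1 + polar u v2.
Proof. by rewrite /polar mulmxDr mxE. Qed.

Lemma polarZr u k v : polar u (k *: v) = k * polar u v.
Proof. by rewrite /polar -scalemxAr mxE. Qed.

Lemma polar_iso X u v : SO_S1 R m X -> polar (X *m u) (X *m v) = polar u v.
Proof. by move=> [_ e]; rewrite /polar trmx_mul !mulmxA -(mulmxA _ X^T) -(mulmxA _ (X^T *m _)) e. Qed.

(** If it vanished, some nonzero u in the plane would have X u orthogonal to the plane. But u has
    positive value, and the form is negative definite on the complement. *)
Lemma gramdet_neq0 X : SO_S1 R m X -> gramdet X != 0.
Proof.
move=> SX; apply/negP => /eqP g0.
pose G := mx2 (polar pos1 (X *m pos1)) (polar pos2 (X *m pos1))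
              (polar pos1 (X *m pos2)) (polar pos2 (X *m pos2)).
have /eqP/det0P[c c0 eG] : \det G = 0 by rewrite det_mx2 -g0 /gramdet [polar pos2 (X *m pos1) * _]mulrC.
pose u := c 0 0 *: pos1 + c 0 1 *: pos2.
have e1 : polar pos1 (X *m u) = 0.
  move/matrixP: eG => /(_ 0 0); rewrite !mxE !big_ord_recl big_ord0 !mxE /= addr0 => e.
  rewrite /u mulmxDr -!scalemxAr polarDr !polarZr -[RHS]e; congr (_ + c _ _ * _); exact/val_inj.
have e2 : polar pos2 (X *m u) = 0.
  move/matrixP: eG => /(_ 0 1); rewrite !mxE !big_ord_recl big_ord0 !mxE /= addr0 => e.
  rewrite /u mulmxDr -!scalemxAr polarDr !polarZr -[RHS]e; congr (_ + c _ _ * _); exact/val_inj.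
have := polar_iso u u SX; set v := X *m u in e1 e2 *.
have [x [a [d [y [b ev]]]]] := real_vecP v.
have eu : map_mx toC u = vec (toC (c 0 0)) (toC (c 0 1))%:M (toC (c 0 0)).
  rewrite map_mxD !map_mxZ toC_pos1 toC_pos2 !vecZ // vecD // !mulr0 !mulr1 scaler0.
  by congr vec; rewrite ?addr0 ?add0r ?scalemx1.
move/(congr1 toC): e1; rewrite toC_polar toC_pos1 ev (S1_form m_gt0) mul0mx mxtrace0 mxE.
rewrite mulr1n addr0 !mul1r -rmorphD rmorph0 => /(fmorph_inj toC) e1.
move/(congr1 toC): e2; rewrite toC_polar toC_pos2 ev (S1_form m_gt0) mul1mx tr_sharp tr_mx2 mxE.
rewrite mulr1n !mul0r !add0r -rmorphD rmorph0 => /(fmorph_inj toC) e2.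
move=> /(congr1 toC); rewrite !toC_polar eu ev !(S1_form m_gt0) sharp_scalar -scalar_mxM.
rewrite mxtrace_scalar tr_herm_sharp !mxE !mulr1n => e.
have bb : toC (complex.Re (b * b^*)) = b * b^* by apply: ReK; rewrite rmorphM /= conjCK mulrC.
have b0 : 0 <= complex.Re (b * b^*) by rewrite -ler0c bb mul_conjC_ge0.
have {}e : x * y + y * x + a * d + d * a - complex.Re (b * b^*) - complex.Re (b * b^*)
    = c 0 0 * c 0 0 + c 0 0 * c 0 0 + (c 0 1 * c 0 1 + c 0 1 * c 0 1).
  apply: (fmorph_inj toC); rewrite !rmorphB !rmorphD !rmorphM /= bb.
  apply/eqP; rewrite -subr_eq0; move/eqP: e; rewrite -subr_eq0 => /eqP <-.
  by apply/eqP; ring.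
(* On the complement y = -x and d = -a, and the form is -2 (x^2 + a^2 + |b|^2). *)
have ey : y = - x by apply/eqP; rewrite -subr_eq0 -[X in _ == X]e1; apply/eqP; ring.
have ed : d = - a by apply/eqP; rewrite -subr_eq0 -[X in _ == X]e2; apply/eqP; ring.
rewrite ey ed in e.
have c00 : c 0 0 = 0 by nra.
have c01 : c 0 1 = 0 by nra.
move/eqP: c0; apply; apply/matrixP => i j; rewrite !ord1 mxE.
by case: j => [[|[|j]] hj] //; [rewrite -[RHS]c00|rewrite -[RHS]c01]; congr (c _ _); apply/val_inj.
Qed.

Lemma gramdet1 : 0 < gramdet 1%:M.
Proof.
have p11 : polar pos1 pos1 = 2.
  apply: complexI; rewrite toC_polar toC_pos1 (S1_form m_gt0) sharp0 mulmx0 mxtrace0.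
  by rewrite mxE mulr1n rmorph_nat; ring.
have p22 : polar pos2 pos2 = 2.
  apply: complexI; rewrite toC_polar toC_pos2 (S1_form m_gt0) sharp_scalar mulmx1.
  by rewrite mxtrace_scalar mxE mulr1n rmorph_nat; ring.
have p12 : polar pos1 pos2 = 0.
  apply: complexI; rewrite toC_polar toC_pos1 toC_pos2 (S1_form m_gt0) mul0mx mxtrace0.
  by rewrite mxE mulr1n rmorph0; ring.
by rewrite /gramdet !mul1mx p11 p12 p22 mul0r subr0 mulr_gt0 ?ltr0n.
Qed.

Lemma gramdet_gt0 X : SO0 R m X -> 0 < gramdet X.
Proof.
move=> [B [B1 sB cB] BX].
have : connected (gramdet @` B).
  by apply: connected_continuous_connected => //; apply: continuous_subspaceT; apply: continuous_gramdet.
move=> /connected_intervalP iB; rewrite ltNge; apply/negP => le0.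
have [Y BY Y0] : (gramdet @` B) 0.
  apply: (iB (gramdet X) (gramdet 1%:M)); [by exists X|by exists 1%:M|].
  by rewrite le0 ltW // gramdet1.
by have := gramdet_neq0 (sB _ BY); rewrite Y0 eqxx.
Qed.

Lemma gramdet_rho X : gramdet (X *m rho) = - gramdet X.
Proof.
have r1 : rho *m pos1 = - pos1.
  apply: (@toC_mx_inj R); rewrite (map_mxM toC) toC_pos1 rho_vec (map_mxN toC) toC_pos1.
  by rewrite vecN // oppr0.
have r2 : rho *m pos2 = pos2.
  by apply: (@toC_mx_inj R); rewrite (map_mxM toC) toC_pos2 rho_vec oppr0.
have pN u v : polar u (- v) = - polar u v by rewrite -scaleN1r polarZr mulN1r.
by rewrite /gramdet -!mulmxA r1 r2 !mulmxN !pN; ring.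
Qed.

Lemma SO0_in_image X : SO0 R m X -> exists2 M, SU22 R M & phi m M = X.
Proof.
move=> S0X; have SX := SO0_SO S0X; pose T := map_mx toC X.
have iT : iso T.
  case: SX => dX iX; split; last by rewrite det_map_mx /= dX rmorph1.
    by apply/matrixP => i j; rewrite !mxE conjC_toC.
  by rewrite /T map_trmx -!(map_mxM toC) iX.
have [[M SM eM]|[M SM eM]] := iso_in_image_or iT.
  by exists M => //; apply: (@toC_mx_inj R); rewrite (toC_phi m_gt0 SM).
(* Otherwise X and X rho would both lie in the identity component, though their values of [gramdet]
   are opposite. *)
have eX : phi m M = X *m rho.
  by apply: (@toC_mx_inj R); rewrite (toC_phi m_gt0 SM) eM (map_mxM toC).
have := gramdet_gt0 (SO0_phi m_gt0 SM); rewrite eX gramdet_rho oppr_gt0.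
by rewrite ltNge ltW // gramdet_gt0.
Qed.

End Surjectivity.

(** * Kernel *)

Section Kernel.
Variables (R : realType) (m : nat).
Hypothesis m_gt0 : (0 < m)%N.
Local Notation C := R[i].
Local Notation vec := (@vec6 R m).
Local Notation tilde := (@tilde R m).

Lemma SU22_N1 : SU22 R (- 1%:M).
Proof.
split; last by rewrite hN h1 mulNmx mulmxN mulNmx opprK mul1mx mulmx1.
by rewrite -scaleN1r detZ det1 mulr1 -signr_odd.
Qed.

Lemma tilde_N1 : tilde (- 1%:M) = 1%:M.
Proof.
have -> : - 1%:M = levi (- 1%:M) (- 1%:M) :> 'M[C]_4.
  by rewrite (@scalar_mx_block _ 2 2) (@opp_block_mx _ 2 2 2 2) oppr0.
have d : \det (- 1%:M : 'M[C]_2) = 1 by rewrite scalarmx2 oppmx2 det_mx2; ring.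
apply: mulmx_ext => u; have [x [Z [y ->]]] := vecP m_gt0 u.
by rewrite levi_vec // d sharpN sharp_scalar !(mulNmx, mulmxN) opprK mul1mx mulmx1 !mul1r mul1mx.
Qed.

(** The vectors (1, 0, 0) and (0, 0, 1) give det A = det D = 1 and C = B = 0. Then A Z D^# = Z for
    all Z; Z = I gives A = D, so A is central of determinant 1. *)
Lemma tilde_eq1 M : tilde M = 1%:M -> M = 1%:M \/ M = - 1%:M.
Proof.
have [A [B [C' [D ->]]]] := block4 M => e1.
have e x Z y : [/\ act_x A B x Z y = x, act_z A B C' D x Z y = Z & - act_x C' D x Z y = y].
  by have := tilde_vec m_gt0 A B C' D x Z y; rewrite e1 mul1mx => /esym/(vec_inj m_gt0).
have sim := (mulmx0, mul0mx, @mxtrace0 C 2, mulr1, mulr0, subr0, scale1r, scale0r,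
  addr0, add0r, sub0r, @sharp0 R, oppr0, mul0r, mul1r).
have dA : \det A = 1 by have [+ _ _] := e 1 0 0; rewrite /act_x !sim.
have AC : A *m sharp C' = 0.
  by have [_ + _] := e 1 0 0; rewrite /act_z !sim => /eqP; rewrite oppr_eq0 => /eqP.
have BD : B *m sharp D = 0 by have [_ + _] := e 0 0 1; rewrite /act_z !sim.
have dD : \det D = 1 by have [_ _] := e 0 0 1; rewrite /act_x !sim opprK.
have AZD Z : A *m Z *m sharp D = Z.
  have [_ + _] := e 0 Z 0; rewrite /act_z !scale0r subr0 addr0.
  have -> : B = 0 by rewrite -[B]mulmx1 -dD -mul_sharpl mulmxA BD mul0mx.
  by rewrite !mul0mx addr0.
have C0 : C' = 0.
  apply: (inv_inj (@sharpK R)); rewrite sharp0 -[LHS]mul1mx -dA -mul_sharpl -mulmxA AC mulmx0 //.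
have B0 : B = 0 by rewrite -[B]mulmx1 -dD -mul_sharpl mulmxA BD mul0mx.
have AD : A = D.
  by rewrite -[D]mul1mx -[1%:M](AZD 1%:M) mulmx1 -mulmxA mul_sharpl dD mulmx1.
have cA Z : A *m Z = Z *m A.
  by rewrite -[in RHS](AZD Z) -AD -mulmxA mul_sharpl dA mulmx1.
rewrite B0 C0 -AD in e1 *; move: dA (cA (mx2 0 1 0 0)) (cA (mx2 0 0 1 0)).
rewrite (mx2_eta A) det_mx2 !mulmx2; move: (A 0 0) (A 0 1) (A 1 0) (A 1 1) => a b c d.
rewrite !sim => dA /mx2_inj[_ ad _ c0] /mx2_inj[b0 _ _ _].
move: dA; rewrite -ad c0 b0 mulr0 subr0 => /eqP; rewrite -expr2 sqrf_eq1.
have eM (k : C) : (block_mx (mx2 k 0 0 k) 0 0 (mx2 k 0 0 k) : 'M_(2 + 2)) = k%:M.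
  by rewrite -scalarmx2 -(@scalar_mx_block _ 2 2).
by move=> /orP[]/eqP a1; rewrite eM a1; [left|right; rewrite raddfN].
Qed.

End Kernel.

(** * Arithmetic of OK and of its field of fractions *)

Section Integers.
Variables (R : realType) (m : nat).
Hypothesis sqf_m : squarefree m.
Local Notation C := R[i].
Local Notation toC := (real_complex R).
Local Notation w := (omega R m).
Local Notation OK := (OK R m).
Let m_gt0 := squarefree_gt0 sqf_m.

Definition isZ (z : C) := exists a : int, z = a%:~R.
Definition isQ (z : C) := exists n : nat, (0 < n)%N /\ isZ (n%:R * z).

(** Divide n and b by their gcd: the square of the reduced n divides k, so the reduced n is 1. *)
Lemma squarefree_dvd (k n b c : nat) : squarefree k -> (0 < n)%N ->
  (b ^ 2 * k = c * n ^ 2)%N -> (n %| b)%N.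
Proof.
move=> sk n0 e; set g := gcdn n b.
have g0 : (0 < g)%N by rewrite gcdn_gt0 n0.
have [n' en] := dvdnP (dvdn_gcdl n b); have [b' eb] := dvdnP (dvdn_gcdr n b).
rewrite -/g in en eb.
have co : coprime n' b'.
  by rewrite /coprime -(eqn_pmul2r g0) muln_gcdl -en -eb mul1n.
have d : (n' ^ 2 %| k)%N.
  rewrite -(@Gauss_dvdr _ (b' ^ 2)); last by rewrite coprimeXl // coprimeXr.
  apply/dvdnP; exists c; apply/eqP; rewrite -(eqn_pmul2r (_ : 0 < g ^ 2)%N) ?expn_gt0 ?g0 //.
  by rewrite -[X in _ == X]mulnA -expnMn -en -e eb expnMn mulnAC.
by rewrite en (sk _ d) mul1n eb dvdn_mull.
Qed.

Lemma isZ_conj z : isZ z -> z^* = z.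
Proof. by move=> [a ->]; rewrite rmorph_int. Qed.

Lemma isZ_nat (n : nat) : isZ n%:R.
Proof. by exists n; rewrite -pmulrn. Qed.

Lemma isZD x y : isZ x -> isZ y -> isZ (x + y).
Proof. by move=> [a ->] [b ->]; exists (a + b); rewrite rmorphD. Qed.

Lemma isZN x : isZ x -> isZ (- x).
Proof. by move=> [a ->]; exists (- a); rewrite rmorphN. Qed.

Lemma isZB x y : isZ x -> isZ y -> isZ (x - y).
Proof. by move=> zx zy; apply: isZD => //; apply: isZN. Qed.

Lemma isZM x y : isZ x -> isZ y -> isZ (x * y).
Proof. by move=> [a ->] [b ->]; exists (a * b); rewrite rmorphM. Qed.

Lemma int_sqr_dvd (k n : nat) (b c : int) : squarefree k -> (0 < n)%N ->
  b ^+ 2 * k%:Z = c * n%:Z ^+ 2 -> exists d : int, b = d * n%:Z.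
Proof.
move=> sk n0 e; have : (`|b| ^ 2 * k = `|c| * n ^ 2)%N.
  by move/(congr1 absz): e; rewrite !expr2 !abszM !absz_nat !mulnn.
move=> e2.
have /dvdnP[q eq] := squarefree_dvd sk n0 e2.
exists (sgz b * q); rewrite -mulrA -PoszM -eq; exact: intEsg.
Qed.

(** Used with k = 1, where it is integral closedness of Z, and with k = m for the coefficient of
    sqrt(-m). *)
Lemma isQ_isZ (k : nat) z : squarefree k -> isQ z -> isZ (k%:R * z ^+ 2) -> isZ z.
Proof.
move=> sk [n [n0 [b eb]]] [c ec].
have n0' : n%:R != 0 :> C by rewrite pnatr_eq0 -lt0n.
have e : b ^+ 2 * k%:Z = c * n%:Z ^+ 2.
  apply: (@intr_inj C); rewrite !expr2 !rmorphM /= -eb -ec -!pmulrn; ring.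
have [d ed] := int_sqr_dvd sk n0 e; exists d.
by apply: (mulfI n0'); rewrite eb ed rmorphM /= -pmulrn mulrC.
Qed.

(** Trace and norm of omega, that is, the coefficients of its minimal polynomial; the division by 4
    in [wnm] is exact when m = 3 mod 4. *)
Definition wtr : int := if (m %% 4 == 3)%N then 1 else 0.
Definition wnm : int := if (m %% 4 == 3)%N then (m.+1 %/ 4)%N else m.

Local Notation sqrtNm := ('i * toC (Num.sqrt m%:R) : C).

Lemma sqrtNm_conj : sqrtNm^* = - sqrtNm.
Proof.
by rewrite rmorphM /= conjC_toC conjCi mulNr.
Qed.

Lemma sqrtNm_sqr : sqrtNm * sqrtNm = - m%:R.
Proof.
by rewrite mulrACA -expr2 sqrCi -expr2 -rmorphXn /= sqr_sqrtr ?ler0n // rmorph_nat mulN1r.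
Qed.

Lemma omega_trE : w + w^* = wtr%:~R.
Proof.
rewrite /omega /wtr; case: ifP => _; last by rewrite sqrtNm_conj subrr.
by rewrite rmorphM rmorphD fmorphV rmorph_nat rmorph1 /= sqrtNm_conj; field.
Qed.

Lemma omega_nmE : w * w^* = wnm%:~R.
Proof.
rewrite /omega /wnm; case: ifP => m4; last first.
  by rewrite sqrtNm_conj mulrN sqrtNm_sqr opprK -pmulrn.
have e4 : (4 * (m.+1 %/ 4) = m.+1)%N by move/eqP: m4; lia.
rewrite rmorphM rmorphD fmorphV rmorph_nat rmorph1 /= sqrtNm_conj -pmulrn.
have /(congr1 (fun n : nat => n%:R : C)) := e4; rewrite natrM -[in RHS]natr1 => e.
have n4 : (4 : C) != 0 by rewrite pnatr_eq0.
apply: (mulfI n4); rewrite e; transitivity (1 - sqrtNm * sqrtNm); first by field.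
by rewrite sqrtNm_sqr opprK addrC.
Qed.

Lemma OKP z : OK z <-> exists x y, [/\ isZ x, isZ y & z = x + y * w].
Proof.
split=> [[a [b ->]]|[x [y [[a ->] [b ->] ->]]]]; last by exists a, b.
by exists a%:~R, b%:~R; split=> //; [exists a|exists b].
Qed.

Lemma OK_isZ z : isZ z -> OK z.
Proof. by move=> [a ->]; exists a, 0; rewrite mul0r addr0. Qed.

Lemma OK_w : OK w.
Proof. by exists 0, 1; rewrite mul1r add0r. Qed.

Lemma OK0 : OK 0. Proof. by apply: OK_isZ; exists 0. Qed.
Lemma OK1 : OK 1. Proof. by apply: OK_isZ; exists 1. Qed.
Lemma OK_nat (n : nat) : OK n%:R. Proof. by apply: OK_isZ; apply: isZ_nat. Qed.

Lemma OKD x y : OK x -> OK y -> OK (x + y).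
Proof.
by move=> [a [b ->]] [c [d ->]]; exists (a + c), (b + d); rewrite !rmorphD /=; ring.
Qed.

Lemma OKN x : OK x -> OK (- x).
Proof. by move=> [a [b ->]]; exists (- a), (- b); rewrite !rmorphN /=; ring. Qed.

Lemma OKB x y : OK x -> OK y -> OK (x - y).
Proof. by move=> zx zy; apply: OKD => //; apply: OKN. Qed.

Lemma OKM x y : OK x -> OK y -> OK (x * y).
Proof.
move=> [a [b ->]] [c [d ->]].
exists (a * c - b * d * wnm), (a * d + b * c + b * d * wtr).
have ww : w * w = w * wtr%:~R - wnm%:~R by rewrite -omega_trE -omega_nmE; ring.
rewrite !(rmorphD, rmorphN, rmorphM) /=.
transitivity (a%:~R * c%:~R + (a%:~R * d%:~R + b%:~R * c%:~R) * w + b%:~R * d%:~R * (w * w)).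
  by ring.
by rewrite ww; ring.
Qed.

Lemma OK_conj x : OK x -> OK x^*.
Proof.
move=> [a [b ->]]; exists (a + b * wtr), (- b).
have cw : w^* = wtr%:~R - w by rewrite -omega_trE; ring.
by rewrite !(rmorphD, rmorphN, rmorphM, rmorph_int) /= cw; ring.
Qed.

Lemma w_neq_conj : w - w^* != 0. Proof. exact: omega_sub_conj_neq0. Qed.

Lemma conj_coords x y : x^* = x -> y^* = y -> x + y * w - (x + y * w)^* = y * (w - w^*).
Proof. by move=> ex ey; rewrite rmorphD rmorphM /= ex ey; ring. Qed.

Lemma OK_coords x y : x^* = x -> y^* = y -> OK (x + y * w) -> isZ x /\ isZ y.
Proof.
move=> ex ey /OKP[a [b [za zb e]]].
have eb : y = b.
  apply: (mulIf w_neq_conj); rewrite -(conj_coords ex ey) e conj_coords //; exact: isZ_conj.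
by split; rewrite ?eb //; move: e; rewrite eb => /addIr ->.
Qed.

Lemma OK_real x : x^* = x -> OK x -> isZ x.
Proof.
move=> ex Ox; have [] // := OK_coords ex (conjC0 _) (_ : OK (x + 0 * w)).
by rewrite mul0r addr0.
Qed.

(** The field K, encoded as the numbers with a natural denominator over OK. *)
Definition KK (z : C) := exists n : nat, (0 < n)%N /\ OK (n%:R * z).

Lemma KK_OK z : OK z -> KK z.
Proof. by move=> Oz; exists 1%N; rewrite mul1r. Qed.

Lemma KKD x y : KK x -> KK y -> KK (x + y).
Proof.
move=> [n [n0 Ox]] [k [k0 Oy]]; exists (n * k)%N; split; first by rewrite muln_gt0 n0.
have -> : (n * k)%:R * (x + y) = k%:R * (n%:R * x) + n%:R * (k%:R * y) by rewrite natrM; ring.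
by apply: OKD; apply: OKM => //; apply: OK_nat.
Qed.

Lemma KKN x : KK x -> KK (- x).
Proof. by move=> [n [n0 Ox]]; exists n; rewrite mulrN; split=> //; apply: OKN. Qed.

Lemma KKB x y : KK x -> KK y -> KK (x - y).
Proof. by move=> zx zy; apply: KKD => //; apply: KKN. Qed.

Lemma KKM x y : KK x -> KK y -> KK (x * y).
Proof.
move=> [n [n0 Ox]] [k [k0 Oy]]; exists (n * k)%N; split; first by rewrite muln_gt0 n0.
by rewrite natrM mulrACA; apply: OKM.
Qed.

Lemma KK_conj x : KK x -> KK x^*.
Proof.
move=> [n [n0 Ox]]; exists n; split=> //.
by have := OK_conj Ox; rewrite rmorphM rmorph_nat.
Qed.

Lemma KKV x : KK x -> KK x^-1.
Proof.
move=> Kx; have [->|x0] := eqVneq x 0; first by rewrite invr0; apply: KK_OK; apply: OK0.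
have [n [n0 On]] := KKM Kx (KK_conj Kx).
have [a ea] : isZ (n%:R * (x * x^*)).
  by apply: OK_real => //; rewrite !rmorphM rmorph_nat /= conjCK [x^* * x]mulrC.
have n0' : n%:R != 0 :> C by rewrite pnatr_eq0 -lt0n.
have xc0 : x^* != 0 by rewrite conjC_eq0.
have a0 : a != 0.
  apply: contra_eq_neq ea => ->; by rewrite !mulf_neq0.
have a0' : a%:~R != 0 :> C by rewrite intr_eq0.
have -> : x^-1 = a%:~R^-1 * (n%:R * x^*) by rewrite -ea; field; rewrite ?mulf_neq0 ?x0 ?xc0 ?n0'.
apply: KKM; last by apply: KKM; [apply: KK_OK; apply: OK_nat|apply: KK_conj].
exists `|a|%N; rewrite absz_gt0; split=> //; apply: OK_isZ; exists (sgz a).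
by apply: (mulIf a0'); rewrite divfK // -rmorphM /= -abszEsg -pmulrn.
Qed.

Lemma KK_real z : KK z -> z^* = z -> isQ z.
Proof.
move=> [n [n0 On]] ez; exists n; split=> //; apply: OK_real => //.
by rewrite rmorphM rmorph_nat /= ez.
Qed.

Lemma isQ_KK z : isQ z -> KK z.
Proof. by move=> [n [n0 Zn]]; exists n; split=> //; apply: OK_isZ. Qed.

Lemma KK_coords z : KK z -> exists x y, [/\ isQ x, isQ y & z = x + y * w].
Proof.
move=> [n [n0 [a [b e]]]]; have n0' : n%:R != 0 :> C by rewrite pnatr_eq0 -lt0n.
exists (a%:~R / n%:R), (b%:~R / n%:R); split.
- by exists n; split=> //; exists a; rewrite mulrC divfK.
- by exists n; split=> //; exists b; rewrite mulrC divfK.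
- by apply: (mulfI n0'); rewrite e; field.
Qed.

Lemma isQ_conj x : isQ x -> x^* = x.
Proof.
move=> [n [n0 /isZ_conj]]; rewrite rmorphM rmorph_nat; apply: mulfI.
by rewrite pnatr_eq0 -lt0n.
Qed.

Lemma squarefree1 : squarefree 1.
Proof. by move=> d; rewrite dvdn1 -(exp1n 2) eqn_exp2r // => /eqP. Qed.

Lemma isQ_nat (n : nat) : isQ n%:R.
Proof. by exists 1%N; split=> //; rewrite mul1r; apply: isZ_nat. Qed.

Lemma even_or_odd_int (t : int) : exists k : int, t = 2 * k \/ t = 2 * k + 1.
Proof. by exists (t %/ 2)%Z; lia. Qed.

(** For z of trace t and norm N with z - conj(z) = v sqrt(-m), the hypothesis is 4 N = t^2 + m v^2.
    The conclusion is the classical parity condition for z to lie in OK; it rests on m not being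
    divisible by 4. *)
Lemma int_parity_norm (t v N : int) : t ^+ 2 + m%:Z * v ^+ 2 = 4 * N ->
  if (m %% 4 == 3)%N then exists k, t - v = 2 * k
  else (exists k, t = 2 * k) /\ exists k, v = 2 * k.
Proof.
have m4 : (m %% 4 != 0)%N.
  apply/negP => d4; have := sqf_m (d := 2).
  by rewrite /dvdn -[(2 ^ 2)%N]/4%N d4 => /(_ isT).
set q := (m %/ 4)%N; set r := (m %% 4)%N in m4 *.
have rlt : (r < 4)%N by rewrite ltn_mod.
have -> : m = (q * 4 + r)%N by rewrite -divn_eq.
have [t' et] := even_or_odd_int t; have [v' ev] := even_or_odd_int v.
rewrite PoszD PoszM; move: (q%:Z) => Q.
case: r m4 rlt => [|[|[|[|r]]]] //= _ _ e.
- split; [exists t'|exists v']; case: et ev e => -> [] ->; rewrite ?expr2; nia.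
- split; [exists t'|exists v']; case: et ev e => -> [] ->; rewrite ?expr2; nia.
- exists (t' - v'); case: et ev e => -> [] ->; rewrite ?expr2; nia.
Qed.

Lemma omega_disc : (w - w^*) ^+ 2 = - (if (m %% 4 == 3)%N then m else 4 * m)%N%:R.
Proof.
rewrite /omega; case: ifP => _.
  rewrite rmorphM rmorphD fmorphV rmorph_nat rmorph1 /= sqrtNm_conj.
  by rewrite -sqrtNm_sqr; field.
rewrite sqrtNm_conj natrM; transitivity (4 * (sqrtNm * sqrtNm)); first by ring.
by rewrite sqrtNm_sqr; ring.
Qed.

(** The squares of the norm and of the trace of z are integers, hence so are norm and trace.
    Squarefreeness of m makes the coefficient of sqrt(-m) in z - conj(z) an integer, and the parity
    condition concludes. *)
Lemma OK_integrally_closed z : KK z -> OK (z ^+ 2) -> OK z.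
Proof.
move=> Kz Oz2; have [x [y [Qx Qy ez]]] := KK_coords Kz.
have cx := isQ_conj Qx; have cy := isQ_conj Qy.
have Kzc := KK_conj Kz.
have cn : (z * z^*)^* = z * z^* by rewrite rmorphM /= conjCK mulrC.
have ct : (z + z^*)^* = z + z^* by rewrite rmorphD /= conjCK addrC.
have Zn : isZ (z * z^*).
  apply: (isQ_isZ squarefree1); first by apply: KK_real => //; apply: KKM.
  rewrite mul1r; apply: OK_real; first by rewrite rmorphXn /= cn.
  by rewrite exprMn -rmorphXn; apply: OKM => //; apply: OK_conj.
have Zt : isZ (z + z^*).
  apply: (isQ_isZ squarefree1); first by apply: KK_real => //; apply: KKD.
  rewrite mul1r; apply: OK_real; first by rewrite rmorphXn /= ct.
  have -> : (z + z^*) ^+ 2 = z ^+ 2 + (z ^+ 2)^* + z * z^* + z * z^*.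
    by rewrite rmorphXn /=; ring.
  by apply: OKD; [apply: OKD|]; [apply: OKD => //; exact: OK_conj|..]; apply: OK_isZ.
have ed : z - z^* = y * (w - w^*) by rewrite ez conj_coords.
have eD : (y * (w - w^*)) ^+ 2 = (z + z^*) ^+ 2 - 4 * (z * z^*) by rewrite -ed; ring.
move: (omega_disc) (omega_trE) (int_parity_norm); rewrite /wtr.
case: ifP => m4 disc wtrE par.
  have Zy : isZ y.
    apply: (isQ_isZ sqf_m) => //.
    have -> : m%:R * y ^+ 2 = 4 * (z * z^*) - (z + z^*) ^+ 2.
      by apply: oppr_inj; rewrite opprB -eD (exprMn _ y) disc; ring.
    apply: isZB; first by apply: isZM => //; apply: isZ_nat.
    by rewrite expr2; apply: isZM.
  case: (Zn) (Zt) (Zy) => N eN [t et] [v ev].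
  have [|k ek] := par t v N.
    apply: (@intr_inj C); rewrite !expr2 !(rmorphD, rmorphM) /= -et -ev -eN.
    transitivity (z * z * 0 + ((z + z^*) ^+ 2 - (y * (w - w^*)) ^+ 2)); last by rewrite eD; ring.
    by rewrite (exprMn _ y) disc -pmulrn; ring.
  exists k, v; rewrite -ev ez; congr (_ + _).
  have two0 : (2 : C) != 0 by rewrite pnatr_eq0.
  apply: (mulfI two0); rewrite -[2 in RHS]/(2%:~R) -rmorphM -ek rmorphB /= -et -ev.
  rewrite ez rmorphD rmorphM /= cx cy.
  transitivity (2 * x + y * 1%:~R - y); first by ring.
  by rewrite -wtrE; ring.
have Zv : isZ (2 * y).
  apply: (isQ_isZ sqf_m); first by apply: KK_real; [apply: KKM; apply: isQ_KK => //; apply: isQ_nat|rewrite rmorphM rmorph_nat /= cy].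
  have -> : m%:R * (2 * y) ^+ 2 = 4 * (z * z^*) - (z + z^*) ^+ 2.
    by apply: oppr_inj; rewrite opprB -eD (exprMn _ y) disc natrM; ring.
  apply: isZB; first by apply: isZM => //; apply: isZ_nat.
  by rewrite expr2; apply: isZM.
case: (Zn) (Zt) (Zv) => N eN [t et] [v ev].
have [|[k ek] [l el]] := par t v N.
  apply: (@intr_inj C); rewrite !expr2 !(rmorphD, rmorphM) /= -et -ev -eN.
  transitivity (z * z * 0 + ((z + z^*) ^+ 2 - (y * (w - w^*)) ^+ 2)); last by rewrite eD; ring.
  by rewrite (exprMn _ y) disc natrM -pmulrn; ring.
have two0 : (2 : C) != 0 by rewrite pnatr_eq0.
exists k, l; rewrite ez; congr (_ + _ * _); apply: (mulfI two0).
  rewrite -[2 in RHS]/(2%:~R) -rmorphM -ek /= -et ez rmorphD rmorphM /= cx cy.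
  transitivity (2 * x + y * 0%:~R); first by ring.
  by rewrite -wtrE; ring.
by rewrite -[2 in RHS]/(2%:~R) -rmorphM -el /= -ev.
Qed.

End Integers.

(** * Products of entries *)

Section Subring.
Variables (R : realType) (m : nat).
Hypothesis sqf_m : squarefree m.
Local Notation C := R[i].
Local Notation toC := (real_complex R).
Local Notation w := (omega R m).
Local Notation OK := (OK R m).
Local Notation vec := (@vec6 R m).
Local Notation tilde := (@tilde R m).
Local Notation amat := (@amat R m).
Let m_gt0 := squarefree_gt0 sqf_m.

(** Isolates what OK and K have in common, so that the integral and the rational case share one
    argument. *)
Record conj_subring (A : C -> Prop) : Prop := ConjSubring {
  subring_OK : forall z, OK z -> A z;
  subringD : forall x y, A x -> A y -> A (x + y);
  subringM : forall x y, A x -> A y -> A (x * y);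
  subring_conj : forall x, A x -> A x^* }.

Lemma OK_conj_subring : conj_subring OK.
Proof.
split=> //; [exact: OKD|exact: OKM|exact: OK_conj].
Qed.

Lemma KK_conj_subring : conj_subring (KK m).
Proof.
split; [exact: KK_OK|exact: KKD|exact: KKM|exact: KK_conj].
Qed.

Definition eps : 'M[C]_2 := mx2 0 1 (- 1) 0.
Definition Om : 'M[C]_4 := levi eps eps.

Lemma sharp_eps (A : 'M[C]_2) : sharp A = - (eps *m A^T *m eps).
Proof. by rewrite [in RHS](mx2_eta A) /sharp !(trmx2, mulmx2, oppmx2); congr mx2; ring. Qed.

Lemma sharp4_Om (M : 'M[C]_4) : sharp4 M = - (Om *m M^T *m Om).
Proof.
have [A [B [C' [D ->]]]] := block4 M.
rewrite sharp4_block (@tr_block_mx _ 2 2 2 2) /Om /levi.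
rewrite (@mulmx_block _ 2 2 2 2 2 2) !mul0mx !addr0 !add0r.
rewrite (@mulmx_block _ 2 2 2 2 2 2) !mulmx0 !addr0 !add0r (@opp_block_mx _ 2 2 2 2).
by rewrite !sharp_eps.
Qed.

(** This makes the inner factors cancel in (M Y M^s) J (M Z M^s)^h J = M (Y J Z^h J) M^-1. *)
Lemma sharp4_symplectic (M : 'M[C]_4) : SU22 R M ->
  sharp4 M *m Jmx R *m (sharp4 M)^h = Jmx R.
Proof.
apply: (SU22_ind (P := fun M => sharp4 M *m Jmx R *m (sharp4 M)^h = Jmx R)) => {M}.
- move=> M N eM eN; rewrite sharp4M hM !mulmxA -(mulmxA _ _ (Jmx R)).
  by rewrite -(mulmxA (sharp4 N)) eM eN.
- move=> H hH; have -> : sharp4 (upperU H) = lowerU (sharp H) :> 'M[C]_4.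
    by rewrite sharp4_block sharp_scalar sharp0.
  by apply: SU22_JmxV; apply: lowerU_SU22; rewrite sharp_h hH.
- move=> H hH; have -> : sharp4 (lowerU H) = upperU (sharp H) :> 'M[C]_4.
    by rewrite sharp4_block sharp_scalar sharp0.
  by apply: SU22_JmxV; apply: upperU_SU22; rewrite sharp_h hH.
Qed.

Definition up (Z : 'M[C]_2) : 'M[C]_4 := block_mx 0 Z 0 0 : 'M_(2 + 2).
Definition lo (Z : 'M[C]_2) : 'M[C]_4 := block_mx 0 0 Z 0 : 'M_(2 + 2).

Lemma up_lo_up X Y Z : up X *m lo Y *m up Z = up (X *m Y *m Z).
Proof.
rewrite /up /lo (@mulmx_block _ 2 2 2 2 2 2) !(mulmx0, mul0mx, addr0, add0r).
by rewrite (@mulmx_block _ 2 2 2 2 2 2) !(mulmx0, mul0mx, addr0, add0r).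
Qed.

Lemma lo_up_lo X Y Z : lo X *m up Y *m lo Z = lo (X *m Y *m Z).
Proof.
rewrite /up /lo (@mulmx_block _ 2 2 2 2 2 2) !(mulmx0, mul0mx, addr0, add0r).
by rewrite (@mulmx_block _ 2 2 2 2 2 2) !(mulmx0, mul0mx, addr0, add0r).
Qed.

Lemma delta_ur (a b : 'I_2) : delta_mx (lshift 2 a) (rshift 2 b) = up (delta_mx a b).
Proof. by rewrite delta_mx_ushift delta_mx_rshift /up /block_mx (@row_mx0 _ 2 2 2). Qed.

Lemma delta_dl (a b : 'I_2) : delta_mx (rshift 2 a) (lshift 2 b) = lo (delta_mx a b).
Proof. by rewrite delta_mx_dshift delta_mx_lshift /lo /block_mx (@row_mx0 _ 2 2 2). Qed.

Lemma antisym_h Z : (antisym 0 Z 0)^h = antisym 0 (sharp Z^h) 0 :> 'M[C]_4.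
Proof.
by rewrite /antisym h_block oppr0 raddf0 !h0 sharp_h sharpK.
Qed.

Lemma Jmx_antisym_Jmx Z :
  Jmx R *m antisym 0 Z 0 *m Jmx R = antisym 0 (sharp Z) 0.
Proof.
rewrite /antisym /Jmx !oppr0 !raddf0.
rewrite (@mulmx_block _ 2 2 2 2 2 2) !(mulmx0, mul0mx, addr0, add0r, mulNmx, mul1mx).
rewrite (@mulmx_block _ 2 2 2 2 2 2) !(mulmx0, mul0mx, addr0, add0r, mulmxN, mulmx1, opprK, oppr0).
by rewrite sharpK.
Qed.

(** The pair products of (1, 0, 0) with Hermitian vectors fill the upper right block; those of (0,
    0, 1) fill the lower left one. *)
Lemma hermitian_pair_up Z : Z^h = Z ->
  antisym 1 0 0 *m Jmx R *m (antisym 0 Z 0)^h *m Jmx R = up (- Z).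
Proof.
move=> hZ; rewrite antisym_h hZ -!mulmxA (mulmxA (Jmx R)) Jmx_antisym_Jmx sharpK /antisym.
rewrite (@mulmx_block _ 2 2 2 2 2 2) oppr0 sharp0 !raddf0.
by rewrite !(mulmx0, mul0mx, addr0, add0r) mul_scalar_mx scaleN1r.
Qed.

Lemma hermitian_pair_lo Z : Z^h = Z ->
  antisym 0 0 1 *m Jmx R *m (antisym 0 Z 0)^h *m Jmx R = lo (sharp Z).
Proof.
move=> hZ; rewrite antisym_h hZ -!mulmxA (mulmxA (Jmx R)) Jmx_antisym_Jmx sharpK /antisym.
rewrite (@mulmx_block _ 2 2 2 2 2 2) oppr0 sharp0 !raddf0.
by rewrite !(mulmx0, mul0mx, addr0, add0r) mul1mx.
Qed.

(* The products of an even number of the matrices Y below span all 4 x 4 matrices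
   (they generate the even Clifford algebra of S1), and conjugation by M maps them to
   such products. *)
Section PairProducts.
Variable A : C -> Prop.
Hypothesis AP : conj_subring A.

Let A0 : A 0. Proof. exact: (subring_OK AP (OK0 _ _)). Qed.
Let A1 : A 1. Proof. exact: (subring_OK AP (OK1 _ _)). Qed.
Let AN x : A x -> A (- x).
Proof.
move=> Ax; rewrite -mulN1r; apply: (subringM AP) => //; apply: (subring_OK AP).
by apply: OKN; apply: OK1.
Qed.

Definition mxin n p (X : 'M[C]_(n, p)) := forall i j, A (X i j).

Lemma subring_sum (I : finType) (f : I -> C) : (forall i, A (f i)) -> A (\sum_i f i).
Proof. by move=> Af; apply: big_ind => // x y; apply: (subringD AP). Qed.

Lemma mxinM n p q (X : 'M[C]_(n, p)) (Y : 'M[C]_(p, q)) : mxin X -> mxin Y -> mxin (X *m Y).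
Proof. by move=> hX hY i j; rewrite mxE; apply: subring_sum => k; apply: (subringM AP). Qed.

Lemma mxinD n p (X Y : 'M[C]_(n, p)) : mxin X -> mxin Y -> mxin (X + Y).
Proof. by move=> hX hY i j; rewrite mxE; apply: (subringD AP). Qed.

Lemma mxinN n p (X : 'M[C]_(n, p)) : mxin X -> mxin (- X).
Proof. by move=> hX i j; rewrite mxE; apply: AN. Qed.

Lemma mxinT n p (X : 'M[C]_(n, p)) : mxin X -> mxin X^T.
Proof. by move=> hX i j; rewrite mxE. Qed.

Lemma mxin_conj n p (X : 'M[C]_(n, p)) : mxin X -> mxin (map_mx Num.conj X).
Proof. by move=> hX i j; rewrite mxE; apply: (subring_conj AP). Qed.

Lemma mxin_h n p (X : 'M[C]_(n, p)) : mxin X -> mxin X^h.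
Proof. by move=> hX; apply: mxinT; apply: mxin_conj. Qed.

Lemma mxin0 n p : mxin (0 : 'M[C]_(n, p)).
Proof. by move=> i j; rewrite mxE. Qed.

Lemma mxin1 n : mxin (1%:M : 'M[C]_n).
Proof. by move=> i j; rewrite mxE; case: (i == j); rewrite ?mulr1n ?mulr0n. Qed.

Lemma mxin_mx2 (a b c d : C) : A a -> A b -> A c -> A d -> mxin (mx2 a b c d).
Proof. by move=> Aa Ab Ac Ad; case=> [[|[|i]] hi] [[|[|j]] hj] //; rewrite !mxE. Qed.

Lemma mxin_block (X Y Z T : 'M[C]_2) : mxin X -> mxin Y -> mxin Z -> mxin T ->
  mxin (block_mx X Y Z T : 'M_(2 + 2)).
Proof.
move=> hX hY hZ hT i j.
by case: (@split_ordP 2 2 i) => k ->; case: (@split_ordP 2 2 j) => l ->;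
  rewrite ?block_mxEul ?block_mxEur ?block_mxEdl ?block_mxEdr.
Qed.

Lemma mxin_Jmx : mxin (Jmx R).
Proof. by apply: mxin_block; [exact: mxin0|apply: mxinN; exact: mxin1|exact: mxin1|exact: mxin0]. Qed.

Lemma mxin_Om : mxin Om.
Proof. by apply: mxin_block; [|exact: mxin0|exact: mxin0|]; apply: mxin_mx2 => //; apply: AN. Qed.

Lemma mxin_scalar n x : A x -> mxin (x%:M : 'M[C]_n).
Proof. by move=> Ax i j; rewrite mxE; case: (i == j); rewrite ?mulr1n ?mulr0n. Qed.

Lemma mxin_sharp (Z : 'M[C]_2) : mxin Z -> mxin (sharp Z).
Proof. by move=> hZ; rewrite /sharp; apply: mxin_mx2 => //; apply: AN. Qed.

Lemma mxin_antisym x Z y : A x -> mxin Z -> A y -> mxin (antisym x Z y).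
Proof.
by move=> Ax hZ Ay; apply: mxin_block => //; [apply: mxin_scalar; apply: AN|apply: mxin_sharp|apply: mxin_scalar].
Qed.

Lemma mxin_amat_delta (j : 'I_6) : mxin (amat (delta_mx j 0)).
Proof.
have Aw : A w by apply: (subring_OK AP); apply: OK_w.
have Aw' : A w^* by apply: (subring_conj AP).
rewrite (@delta_vec R m m_gt0).
by case: j => [[|[|[|[|[|[|j]]]]]] hj] //=; rewrite amat_vec //; apply: mxin_antisym => //;
  first [exact: mxin0|apply: mxin_mx2].
Qed.

Variable M : 'M[C]_4.
Hypothesis SM : SU22 R M.
Variable N : 'M[C]_4.
Hypothesis eN : N = - (Jmx R *m M^h *m Jmx R).
Hypothesis NM : N *m M = 1%:M.

Let conjin Y := mxin (M *m Y *m N).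

Let conjinM Y Z : conjin Y -> conjin Z -> conjin (Y *m Z).
Proof.
move=> hY hZ; rewrite /conjin.
have -> : M *m (Y *m Z) *m N = (M *m Y *m N) *m (M *m Z *m N).
  by rewrite !mulmxA -(mulmxA (M *m Y) N M) NM mulmx1.
exact: mxinM.
Qed.

Let conjinN Y : conjin Y -> conjin (- Y).
Proof. by rewrite /conjin mulmxN mulNmx; apply: mxinN. Qed.

Hypothesis integral : forall j, mxin (M *m amat (delta_mx j 0) *m sharp4 M).

Let conjin_pair Y Z : mxin (M *m Y *m sharp4 M) -> mxin (M *m Z *m sharp4 M) ->
  conjin (Y *m Jmx R *m Z^h *m Jmx R).
Proof.
move=> hY hZ; rewrite /conjin.
have -> : M *m (Y *m Jmx R *m Z^h *m Jmx R) *m N =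
    (M *m Y *m sharp4 M) *m Jmx R *m (M *m Z *m sharp4 M)^h *m Jmx R.
  rewrite (hM (M *m Z)) (hM M) !mulmxA -(mulmxA (M *m Y) (sharp4 M)).
  rewrite -(mulmxA (M *m Y) _ (sharp4 M)^h) (sharp4_symplectic SM).
  rewrite eN mulmxN !mulmxA -(mulmxA _ (Jmx R) (Jmx R)) JmxJ mulmxN mulmx1 !mulNmx opprK //.
by do !apply: mxinM => //; try exact: mxin_Jmx; apply: mxin_h.
Qed.

Let amat0 : amat (delta_mx 0 0) = antisym 1 0 0.
Proof. by rewrite (@delta_vec R m m_gt0) amat_vec. Qed.

Let amat5 : amat (delta_mx (@Ordinal 6 5 isT) 0) = antisym 0 0 1.
Proof. by rewrite (@delta_vec R m m_gt0) amat_vec. Qed.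

Let conjin_up Z j : Z^h = Z -> amat (delta_mx j 0) = antisym 0 Z 0 -> conjin (up Z).
Proof.
move=> hZ ej; have -> : up Z = - up (- Z).
  by rewrite /up (@opp_block_mx _ 2 2 2 2) opprK !oppr0.
apply: conjinN; rewrite -hermitian_pair_up // -amat0 -ej; exact: conjin_pair.
Qed.

Let conjin_lo Z j : Z^h = Z -> amat (delta_mx j 0) = antisym 0 Z 0 -> conjin (lo (sharp Z)).
Proof.
by move=> hZ ej; rewrite -hermitian_pair_lo // -amat5 -ej; exact: conjin_pair.
Qed.

Let E11 := mx2 1 0 0 0 : 'M[C]_2.
Let E22 := mx2 0 0 0 1 : 'M[C]_2.
Let E12 := mx2 0 1 1 0 : 'M[C]_2.

Let conjin_basic : [/\ conjin (up E11), conjin (up E22) & conjin (up E12)]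
  /\ [/\ conjin (lo E11), conjin (lo E22) & conjin (lo E12)].
Proof.
have h11 : E11^h = E11 by rewrite h_mx2 conjC0 conjC1.
have h22 : E22^h = E22 by rewrite h_mx2 conjC0 conjC1.
have h12 : E12^h = E12 by rewrite h_mx2 conjC0 conjC1.
have e1 : amat (delta_mx (@Ordinal 6 1 isT) 0) = antisym 0 E11 0.
  by rewrite (@delta_vec R m m_gt0) amat_vec.
have e2 : amat (delta_mx (@Ordinal 6 2 isT) 0) = antisym 0 E12 0.
  by rewrite (@delta_vec R m m_gt0) amat_vec.
have e4 : amat (delta_mx (@Ordinal 6 4 isT) 0) = antisym 0 E22 0.
  by rewrite (@delta_vec R m m_gt0) amat_vec.
have s11 : sharp E11 = E22 by rewrite sharp_mx2 !oppr0.
have s22 : sharp E22 = E11 by rewrite sharp_mx2 !oppr0.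
have s12 : lo E12 = - lo (sharp E12).
  by rewrite sharp_mx2 /lo (@opp_block_mx _ 2 2 2 2) oppmx2 !oppr0 opprK.
split; split.
- exact: (conjin_up h11 e1).
- exact: (conjin_up h22 e4).
- exact: (conjin_up h12 e2).
- by rewrite -s22; apply: (conjin_lo h22 e4).
- by rewrite -s11; apply: (conjin_lo h11 e1).
- by rewrite s12; apply: conjinN; apply: (conjin_lo h12 e2).
Qed.

(** An alternating product of three off-diagonal blocks is again such a block. This is why a
    diagonal unit occurs twice in the expression of the other two units by the symmetric [E12]. *)
Let conjin_up_delta (a b : 'I_2) : conjin (up (delta_mx a b)).
Proof.
have [[u1 u2 u3] [l1 l2 _]] := conjin_basic.
have -> : delta_mx a b = (if a == 0 then if b == 0 then E11 else E11 *m E11 *m E12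
    else if b == 0 then E22 *m E22 *m E12 else E22) :> 'M[C]_2.
  rewrite /E11 /E12 /E22; case: a b => [[|[|a]] ha] [[|[|b]] hb] //=; rewrite ?mulmx2;
    by apply: mx2P; rewrite !mxE /=; ring.
case: (a == 0); case: (b == 0); [exact: u1| | |exact: u2]; rewrite -up_lo_up.
- exact: (conjinM (conjinM u1 l1) u3).
- exact: (conjinM (conjinM u2 l2) u3).
Qed.

Let conjin_lo_delta (a b : 'I_2) : conjin (lo (delta_mx a b)).
Proof.
have [[u1 u2 _] [l1 l2 l3]] := conjin_basic.
have -> : delta_mx a b = (if a == 0 then if b == 0 then E11 else E11 *m E11 *m E12
    else if b == 0 then E22 *m E22 *m E12 else E22) :> 'M[C]_2.
  rewrite /E11 /E12 /E22; case: a b => [[|[|a]] ha] [[|[|b]] hb] //=; rewrite ?mulmx2;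
    by apply: mx2P; rewrite !mxE /=; ring.
case: (a == 0); case: (b == 0); [exact: l1| | |exact: l2]; rewrite -lo_up_lo.
- exact: (conjinM (conjinM l1 u1) l3).
- exact: (conjinM (conjinM l2 u2) l3).
Qed.

Let conjin_delta (i j : 'I_4) : conjin (delta_mx i j).
Proof.
have uE (a b : 'I_2) : conjin (delta_mx (lshift 2 a) (rshift 2 b)).
  by rewrite delta_ur; apply: conjin_up_delta.
have lE (a b : 'I_2) : conjin (delta_mx (rshift 2 a) (lshift 2 b)).
  by rewrite delta_dl; apply: conjin_lo_delta.
case: (@split_ordP 2 2 i) => a ->; case: (@split_ordP 2 2 j) => b -> //.
- by rewrite -(@mul_delta_mx _ _ 4 _ (@rshift 2 2 0)); apply: conjinM.
- by rewrite -(@mul_delta_mx _ _ 4 _ (@lshift 2 2 0)); apply: conjinM.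
Qed.

Lemma mul_conj_in_aux (i j k l : 'I_4) : A (M i j * (M k l)^*).
Proof.
(* M a b * N c d is the (a, d) entry of M E_bc N, where E_bc is a matrix unit. *)
have MN_in (a b c d : 'I_4) : A (M a b * N c d).
  have := conjin_delta b c a d; rewrite !mxE (bigD1 c) //= big1 => [|e ne].
    rewrite addr0 mxE (bigD1 b) //= big1 => [|e ne].
      by rewrite mxE !eqxx mulr1 addr0.
    by rewrite mxE (negPf ne) mulr0.
  by rewrite mxE big1 ?mul0r // => f _; rewrite mxE (negPf ne) andbF mulr0.
have -> : (M k l)^* = (- (Jmx R *m N *m Jmx R)) l k.
  rewrite eN mulmxN mulNmx opprK !mulmxA JmxJ -!mulmxA JmxJ.
  by rewrite mulNmx mul1mx mulmxN mulmx1 opprK !mxE.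
have -> : M i j * (- (Jmx R *m N *m Jmx R)) l k =
    (- (Jmx R *m (M i j *: N) *m Jmx R)) l k.
  by rewrite -scalemxAr -scalemxAl -scalerN [RHS]mxE.
apply: mxinN; apply: mxinM; last exact: mxin_Jmx.
by apply: mxinM; [exact: mxin_Jmx|move=> a b; rewrite mxE; apply: MN_in].
Qed.

End PairProducts.

Lemma mul_conj_in (A : C -> Prop) (M : 'M[C]_4) : conj_subring A -> SU22 R M ->
  (forall j, mxin A (M *m amat (delta_mx j 0) *m sharp4 M)) ->
  forall i j k l, A (M i j * (M k l)^*).
Proof.
move=> AP SM integral; have [_ NM] := SU22_inv SM.
exact: (mul_conj_in_aux AP SM (erefl _) NM integral).
Qed.

End Subring.

(** * Products of two entries without conjugation *)

Section Products.
Variables (R : realType) (m : nat).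
Hypothesis sqf_m : squarefree m.
Local Notation C := R[i].
Local Notation toC := (real_complex R).
Local Notation w := (omega R m).
Local Notation OK := (OK R m).
Local Notation KK := (@KK R m).
Local Notation vec := (@vec6 R m).
Local Notation tilde := (@tilde R m).
Local Notation phi := (@phi R m).
Local Notation amat := (@amat R m).
Let m_gt0 := squarefree_gt0 sqf_m.
Let OKP := OK_conj_subring R sqf_m.
Let KKP := KK_conj_subring R sqf_m.

Lemma mxinZ (A : C -> Prop) n p k (X : 'M[C]_(n, p)) :
  (forall i j, A (k * X i j)) -> mxin A (k *: X).
Proof. by move=> AX i j; rewrite mxE. Qed.

(** Each entry of M X M^s is a combination over A of products of two entries of M. *)
Lemma act_in (A : C -> Prop) (M X : 'M[C]_4) : conj_subring m A ->
  (forall a b c d, A (M a b * M c d)) -> mxin A X -> mxin A (M *m X *m sharp4 M).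
Proof.
move=> AP AM AX; rewrite sharp4_Om mulmxN; apply: (mxinN AP); rewrite !mulmxA.
apply: (mxinM AP); last exact: (mxin_Om AP).
rewrite -(mulmxA M) => i j; have AY : mxin A (X *m Om R).
  by apply: (mxinM AP) => //; exact: (mxin_Om AP).
move: (X *m Om R) AY => Y AY; rewrite mxE; apply: (subring_sum AP) => k.
rewrite mxE mulr_suml; apply: (subring_sum AP) => l.
by rewrite mxE mulrAC; apply: (subringM AP).
Qed.

Lemma act_eq0 (M Y : 'M[C]_4) : SU22 R M -> M *m Y *m sharp4 M = 0 -> Y = 0.
Proof.
move=> SM e; have [_ NM] := SU22_inv SM.
have e2 : M *m Y = 0.
  have /(congr1 (fun X => X *m (Jmx R *m (sharp4 M)^h *m - Jmx R))) := e.
  rewrite mul0mx !mulmxA -(mulmxA (M *m Y)) -(mulmxA (M *m Y) _ (sharp4 M)^h).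
  by rewrite (sharp4_symplectic SM) -mulmxA mulmxN JmxJ opprK mulmx1.
by rewrite -[Y]mul1mx -NM -(mulmxA _ M Y) e2 mulmx0.
Qed.

(** Distributes p q over the two occurrences of X. With X = conj(M) and p, q entries of M, the
    entries of p X and q X are the accessible products p conj(r). *)
Lemma scale_sandwich (X E O : 'M[C]_4) (p q : C) i j :
  p * q * (X *m E *m - (O *m X^T *m O)) i j =
  (p *: X *m E *m - (O *m (q *: X)^T *m O)) i j.
Proof.
have -> : (q *: X)^T = q *: X^T by apply/matrixP => k l; rewrite !mxE.
rewrite -(scalemxAr q O) -(scalemxAl q) -scalerN -scalemxAr -(scalemxAl p) -(scalemxAl p).
by rewrite scalerA [q * p]mulrC [RHS]mxE.
Qed.

(* Divide by a nonzero entry q of M Y M^s, which is a sum of products of two entries. *)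
Lemma mul_in_KK (M : 'M[C]_4) : SU22 R M ->
  (forall j, mxin KK (M *m amat (delta_mx j 0) *m sharp4 M)) ->
  forall a b c d, KK (M a b * M c d).
Proof.
move=> SM integral a b c d.
have Kc := mul_conj_in sqf_m KKP SM integral.
set Y := M *m amat (delta_mx 0 0) *m sharp4 M.
have [i [j q0]] : exists i j, Y i j != 0.
  apply: contrapT => n0; have Y0 : Y = 0.
    apply/matrixP => i j; rewrite [RHS]mxE; apply: contrapT => nij; apply: n0.
    by exists i, j; apply/eqP.
  have := act_eq0 SM Y0; rewrite (@delta_vec R m m_gt0) amat_vec // => e.
  have : antisym 1 0 0 = antisym 0 0 0 :> 'M[C]_4.
    by rewrite [LHS]e /antisym oppr0 sharp0 raddf0 (@block_mx0 _ 2 2 2 2).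
  by move=> /antisym_inj[/eqP]; rewrite oner_eq0.
have Kq : KK (Y i j) := integral 0 i j.
have Kp : KK (M a b * M c d * (Y i j)^*).
  have -> : M a b * M c d * (Y i j)^* = ((M a b *: map_mx Num.conj M)
      *m map_mx Num.conj (amat (delta_mx 0 0)) *m - (Om R *m (M c d *: map_mx Num.conj M)^T *m Om R)) i j.
    have cOm : map_mx Num.conj (Om R) = Om R.
      have ce : map_mx Num.conj (eps R) = eps R.
        by rewrite /eps mapmx2 conjC0 conjC1 rmorphN /= conjC1.
      by rewrite /Om /levi (@map_block_mx _ _ _ 2 2 2 2) !map_mx0 ce.
    have -> : (Y i j)^* = (map_mx Num.conj Y) i j by rewrite [RHS]mxE.
    rewrite /Y sharp4_Om !map_mxM /= map_mxN !map_mxM /= cOm.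
    by rewrite -map_trmx scale_sandwich.
  apply: (mxinM KKP); last apply: (mxinN KKP).
    apply: (mxinM KKP); first by apply: mxinZ => k l; rewrite mxE.
    by apply: (mxin_conj KKP); apply: (mxin_amat_delta sqf_m KKP).
  apply: (mxinM KKP); last exact: (mxin_Om KKP).
  apply: (mxinM KKP); first exact: (mxin_Om KKP).
  by apply: mxinT; apply: mxinZ => k l; rewrite mxE.
have qc0 : (Y i j)^* != 0 by rewrite conjC_eq0.
rewrite -[M a b * M c d](mulfK qc0); apply: KKM => //.
by apply: KKV => //; apply: KK_conj.
Qed.

Lemma det_in (A : C -> Prop) n (X : 'M[C]_n) : conj_subring m A -> mxin A X -> A (\det X).
Proof.
move=> AP AX; rewrite /determinant; apply: (subring_sum AP) => s.
apply: (subringM AP).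
  apply: (subring_OK AP); case: (perm.odd_perm s); rewrite ?expr1 ?expr0.
    by apply: OKN; apply: OK1.
  exact: OK1.
by apply: big_ind => // [|x y]; [exact: (subring_OK AP (OK1 _ _))|exact: (subringM AP)].
Qed.

(** Scaling the rows of conj(M), a matrix of determinant 1, by the [f i] gives a matrix over OK
    whose determinant is the product. *)
Lemma prod_in_OK (M : 'M[C]_4) (f : 'I_4 -> C) : SU22 R M ->
  (forall i k l, OK (f i * (M k l)^*)) -> OK (\prod_i f i).
Proof.
move=> [dM _] Of; have -> : \prod_i f i = \det (diag_mx (\row_i f i) *m map_mx Num.conj M).
  rewrite det_mulmx det_diag det_map_mx /= dM conjC1 mulr1.
  by apply: eq_bigr => i _; rewrite mxE.
apply: (det_in OKP) => i j; rewrite mul_diag_mx !mxE; exact: Of.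
Qed.

Lemma sqr_mul_in_OK (M : 'M[C]_4) (x y : C) : SU22 R M ->
  (forall k l, OK (x * (M k l)^*)) -> (forall k l, OK (y * (M k l)^*)) ->
  OK ((x * y) ^+ 2).
Proof.
move=> SM Ox Oy; have := prod_in_OK (f := fun i : 'I_4 => if odd i then y else x) SM.
rewrite !big_ord_recl big_ord0 /= mulr1 => H.
have -> : (x * y) ^+ 2 = x * (y * (x * y)) by ring.
by apply: H => i k l; case: ifP.
Qed.

Lemma mul_in_OK (M : 'M[C]_4) : SU22 R M ->
  (forall j, mxin OK (M *m amat (delta_mx j 0) *m sharp4 M)) ->
  forall a b c d, OK (M a b * M c d).
Proof.
move=> SM integral a b c d; apply: OK_integrally_closed => //.
  by apply: mul_in_KK => // j i k; apply: KK_OK; apply: integral.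
by apply: (sqr_mul_in_OK SM) => k l; apply: (mul_conj_in sqf_m OKP SM integral).
Qed.

Lemma vec_entries (v : 'cV[C]_6) (i0 i1 i2 i3 i4 i5 : 'I_6) :
  (i0 == 0 :> nat) && (i1 == 1 :> nat) && (i2 == 2 :> nat) && (i3 == 3 :> nat)
    && (i4 == 4 :> nat) && (i5 == 5 :> nat) ->
  amat v = antisym (v i0 0) (mx2 (v i1 0) (v i2 0 + v i3 0 * w) (v i2 0 + v i3 0 * w^*) (v i4 0)) (v i5 0).
Proof.
move=> /andP[/andP[/andP[/andP[/andP[/eqP h0 /eqP h1] /eqP h2] /eqP h3] /eqP h4] /eqP h5].
have -> : mx2 (v i1 0) (v i2 0 + v i3 0 * w) (v i2 0 + v i3 0 * w^*) (v i4 0)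
    = varphi_inv m (col4 (v i1 0) (v i2 0) (v i3 0) (v i4 0)) by rewrite /varphi_inv !mxE.
rewrite -(amat_vec m_gt0) (vecE m_gt0); congr amat; apply/matrixP => i j; rewrite ord1 mxE.
by case: i => [[|[|[|[|[|[|i]]]]]] hi] //=; congr (v _ _); apply/val_inj; rewrite /= ?h0 ?h1 ?h2 ?h3 ?h4 ?h5.
Qed.

Lemma antisym_entries x Z y : [/\ antisym x Z y (@lshift 2 2 0) (@lshift 2 2 0) = - x,
  forall i j, antisym x Z y (@lshift 2 2 i) (@rshift 2 2 j) = Z i j &
  antisym x Z y (@rshift 2 2 0) (@rshift 2 2 0) = y :> C].
Proof.
split=> [|i j|]; rewrite /antisym.
- by rewrite (@block_mxEul _ 2 2 2 2) mxE.
- by rewrite (@block_mxEur _ 2 2 2 2).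
- by rewrite (@block_mxEdr _ 2 2 2 2) mxE.
Qed.

(** The off-diagonal entry beta + gamma w lies in OK with beta and gamma real, so both are integers,
    1 and w being independent over R. *)
Lemma integral_vec (v : 'cV[R]_6) : mxin OK (amat (map_mx toC v)) ->
  exists z : 'cV[int]_6, v = map_mx intr z.
Proof.
move=> Ov.
have e := vec_entries (map_mx toC v) (i0 := @Ordinal 6 0 isT) (i1 := @Ordinal 6 1 isT)
  (i2 := @Ordinal 6 2 isT) (i3 := @Ordinal 6 3 isT) (i4 := @Ordinal 6 4 isT)
  (i5 := @Ordinal 6 5 isT) isT.
rewrite e !mxE in Ov.
have [] := antisym_entries (toC (v (@Ordinal 6 0 isT) 0))
  (mx2 (toC (v (@Ordinal 6 1 isT) 0)) (toC (v (@Ordinal 6 2 isT) 0) + toC (v (@Ordinal 6 3 isT) 0) * w)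
   (toC (v (@Ordinal 6 2 isT) 0) + toC (v (@Ordinal 6 3 isT) 0) * w^*) (toC (v (@Ordinal 6 4 isT) 0)))
  (toC (v (@Ordinal 6 5 isT) 0)).
move=> e0 eZ e5.
have O0 := Ov (@lshift 2 2 0) (@lshift 2 2 0); rewrite e0 in O0.
have O5 := Ov (@rshift 2 2 0) (@rshift 2 2 0); rewrite e5 in O5.
have OZ i j := Ov (@lshift 2 2 i) (@rshift 2 2 j); move: OZ => /= OZ.
have O1 := OZ 0 0; rewrite eZ mxE in O1.
have O2 := OZ 0 1; rewrite eZ mxE /= in O2.
have O4 := OZ 1 1; rewrite eZ mxE /= in O4.
have [Z2 Z3] := OK_coords sqf_m (conjC_toC _) (conjC_toC _) O2.
have real_int (x : R) : OK (toC x) -> isZ (toC x).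
  by apply: (OK_real sqf_m); exact: conjC_toC.
have {}O0 : OK (toC (v (@Ordinal 6 0 isT) 0)) by rewrite -[toC _]opprK; apply: OKN.
have Zv i : isZ (toC (v i 0)).
  case: i => [[|[|[|[|[|[|i]]]]]] hi] //=;
  [have := real_int _ O0|have := real_int _ O1|have := Z2|have := Z3|have := real_int _ O4|have := real_int _ O5];
  by rewrite (_ : Ordinal _ = Ordinal hi) //; apply/val_inj.
have /choice[z ez] : forall i, exists a : int, v i 0 = a%:~R.
  move=> i; have [a ea] := Zv i; exists a; apply: complexI.
  by rewrite ea rmorph_int.
by exists (\col_i z i); apply/matrixP => i j; rewrite !mxE ord1.
Qed.

End Products.

(** * Rational and integral elements *)

Section Arithmetic.
Variables (R : realType) (m : nat).
Hypothesis sqf_m : squarefree m.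
Local Notation C := R[i].
Local Notation toC := (real_complex R).
Local Notation w := (omega R m).
Local Notation OK := (OK R m).
Local Notation KK := (@KK R m).
Local Notation vec := (@vec6 R m).
Local Notation tilde := (@tilde R m).
Local Notation phi := (@phi R m).
Local Notation amat := (@amat R m).
Let m_gt0 := squarefree_gt0 sqf_m.
Let OKP := OK_conj_subring R sqf_m.
Let KKP := KK_conj_subring R sqf_m.

Lemma mxin_amat (A : C -> Prop) (v : 'cV[C]_6) : conj_subring m A -> mxin A v -> mxin A (amat v).
Proof.
move=> AP Av; rewrite (vec_entries sqf_m v (i0 := @Ordinal 6 0 isT) (i1 := @Ordinal 6 1 isT)
  (i2 := @Ordinal 6 2 isT) (i3 := @Ordinal 6 3 isT) (i4 := @Ordinal 6 4 isT)
  (i5 := @Ordinal 6 5 isT) isT).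
have Aw : A w by apply: (subring_OK AP); apply: OK_w.
have Aw' : A w^* by apply: (subring_conj AP).
apply: (mxin_antisym AP) => //; apply: mxin_mx2 => //;
  by apply: (subringD AP) => //; apply: (subringM AP).
Qed.

Lemma amat_phi_col (M : 'M[C]_4) j : SU22 R M ->
  amat (map_mx toC (col j (phi M))) = M *m amat (delta_mx j 0) *m sharp4 M.
Proof.
move=> SM; rewrite -(amat_tilde m_gt0) -(toC_phi m_gt0 SM); congr amat.
by rewrite -colE map_col.
Qed.

Lemma int_columns (X : 'M[R]_6) :
  (forall j, mxin OK (amat (map_mx toC (col j X)))) -> exists Y : 'M[int]_6, X = map_mx intr Y.
Proof.
move=> OX; have /choice[z ez] : forall j, exists v : 'cV[int]_6, col j X = map_mx intr v.
  by move=> j; apply: (integral_vec sqf_m).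
exists (\matrix_(i, j) z j i 0); apply/matrixP => i j; rewrite !mxE.
by have /matrixP/(_ i 0) := ez j; rewrite !mxE.
Qed.

Lemma phi_integral (M : 'M[C]_4) : SU22 R M -> (forall a b c d, OK (M a b * M c d)) ->
  exists X : 'M[int]_6, phi M = map_mx intr X.
Proof.
move=> SM OM; apply: int_columns => j; rewrite amat_phi_col //.
by apply: (act_in OKP) => //; apply: (mxin_amat_delta sqf_m OKP).
Qed.

Lemma integral_phi (M : 'M[C]_4) (X : 'M[int]_6) : SU22 R M -> phi M = map_mx intr X ->
  forall j, mxin OK (M *m amat (delta_mx j 0) *m sharp4 M).
Proof.
move=> SM e j; rewrite -amat_phi_col // e; apply: (mxin_amat OKP) => i k.
rewrite !mxE; apply: OK_isZ; exists (X i j); exact: rmorph_int.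
Qed.

Lemma KK_ratr (q : rat) : KK (toC (ratr q)).
Proof.
exists `|denq q|%N; split; first by rewrite absz_gt0 denq_neq0.
apply: OK_isZ; exists (numq q).
have -> : `|denq q|%N%:R = toC (denq q)%:~R.
  by rewrite rmorph_int -{2}[denq q]gtz0_abs ?denq_gt0 // pmulrn.
by rewrite -rmorphM /= /ratr mulrC divfK ?intr_eq0 ?denq_neq0 // rmorph_int.
Qed.

Lemma rational_phi (M : 'M[C]_4) (X : 'M[rat]_6) : SU22 R M -> phi M = map_mx ratr X ->
  forall j, mxin KK (M *m amat (delta_mx j 0) *m sharp4 M).
Proof.
move=> SM e j; rewrite -amat_phi_col // e; apply: (mxin_amat KKP) => i k.
by rewrite !mxE; apply: KK_ratr.
Qed.

Lemma sharp4Z k (M : 'M[C]_4) : sharp4 (k *: M) = k *: sharp4 M.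
Proof.
have eT : (k *: M)^T = k *: M^T by apply/matrixP => i j; rewrite !mxE.
by rewrite !sharp4_Om eT -scalemxAr -scalemxAl scalerN.
Qed.

(** M~ is quadratic in M: for M = L / sqrt(k) the matrix k M~ is formed from products of entries of
    L and is integral. *)
Lemma GK_rational (M : 'M[C]_4) : GK R m M -> SO0_Q R m (phi M).
Proof.
move=> [SM [k [L [k0 OL eM]]]]; split; first exact: SO0_phi.
pose s := toC (Num.sqrt k%:R).
have ss : s * s = k%:R by rewrite -rmorphM -expr2 sqr_sqrtr ?ler0n // rmorph_nat.
have k0' : k%:R != 0 :> C by rewrite pnatr_eq0 -lt0n.
have s0 : s != 0 by apply: contraNneq k0' => s0; rewrite -ss s0 mul0r.
have [Y eY] : exists Y : 'M[int]_6, k%:R *: phi M = map_mx intr Y.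
  apply: int_columns => j.
  have -> : map_mx toC (col j (k%:R *: phi M)) = k%:R *: map_mx toC (col j (phi M)).
    by apply/matrixP => a b; rewrite !mxE rmorphM rmorph_nat.
  rewrite amatZ amat_phi_col // eM sharp4Z -!scalemxAl -scalemxAr !scalerA -ss.
  have -> : s * s * s^-1 * s^-1 = 1 by field.
  rewrite scale1r; apply: (act_in OKP); last exact: (mxin_amat_delta sqf_m OKP).
  by move=> a b c d; apply: OKM.
exists (\matrix_(i, j) ((Y i j)%:~R / k%:R)); apply/matrixP => i j; rewrite !mxE.
rewrite fmorph_div /= ratr_int ratr_nat.
have /matrixP/(_ i j) := eY; rewrite !mxE => <-; rewrite mulrC mulKf //.
by rewrite pnatr_eq0 -lt0n.
Qed.

Lemma common_denominator (I : finType) (z : I -> C) : (forall i, KK (z i)) ->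
  exists n : nat, (0 < n)%N /\ forall i, OK (n%:R * z i).
Proof.
move=> /choice[n hn]; exists (\prod_i n i)%N; split.
  by apply: prodn_gt0 => i; have [] := hn i.
move=> i; rewrite (bigD1 i) //= mulnC natrM -mulrA; apply: (OKM sqf_m).
  exact: OK_nat.
by have [] := hn i.
Qed.

Lemma SU22_neq0 (M : 'M[C]_4) : SU22 R M -> exists a b, M a b != 0.
Proof.
move=> [dM _]; apply: contrapT => n0; have M0 : M = 0.
  apply/matrixP => i j; rewrite [RHS]mxE; apply: contrapT => nij; apply: n0.
  by exists i, j; apply/eqP.
by move: dM => /eqP; rewrite M0 det0 // eq_sym oner_eq0.
Qed.

(** The scalar clearing the entries of M has to be real, since its square must become the natural
    number k. *)
Lemma rational_GK (X : 'M[R]_6) : SO0_Q R m X -> exists2 M, GK R m M & phi M = X.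
Proof.
move=> [S0X [Xq eX]]; have [M SM eM] := SO0_in_image m_gt0 S0X.
exists M => //; split=> //; rewrite eX in eM.
have integral := rational_phi SM eM.
have Kp := mul_in_KK sqf_m SM integral.
have Kc := mul_conj_in sqf_m KKP SM integral.
have [a [b u0]] := SU22_neq0 SM; set u := M a b in u0.
have cc (z : C) : z^*^* = z := conjCK z.
have wd := w_neq_conj R sqf_m; set dl := w - w^* in wd.
have Kd : KK dl by apply: KK_OK; apply: OKB; [apply: OK_w|apply: OK_conj => //; apply: OK_w].
have cd : dl^* = - dl by rewrite rmorphB /= cc opprB.
(* If u + conj(u) = 0, then u is purely imaginary, and multiplying u - conj(u) by the imaginary
   number [dl] gives a nonzero real number. *)
have [t [t0 ct Kt Ktt]] : exists t, [/\ t != 0, t^* = t, forall i j, KK (t * M i j) & KK (t * t)].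
  have Kcu i j : KK (u^* * M i j) by rewrite mulrC; apply: Kc.
  have Kcc : KK (u^* * u^*) by rewrite -rmorphM; apply: KK_conj => //; apply: Kp.
  have Kuu : KK (u * u) by apply: Kp.
  have Kuc : KK (u * u^*) by apply: Kc.
  have [t0|t0] := eqVneq (u + u^*) 0.
    exists (dl * (u - u^*)); split.
    - have -> : u^* = - u by apply/eqP; rewrite -addr_eq0 addrC t0.
      by rewrite opprK -mulr2n mulf_neq0 // mulrn_eq0.
    - by rewrite rmorphM /= cd rmorphB /= cc; ring.
    - move=> i j; rewrite -mulrA; apply: KKM => //; rewrite mulrBl.
      by apply: KKB => //; apply: Kp.
    - have -> : dl * (u - u^*) * (dl * (u - u^*))
          = dl * dl * (u * u + u^* * u^* - u * u^* - u * u^*) by ring.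
      by apply: KKM => //; [apply: KKM|apply: KKB => //; apply: KKB => //; apply: KKD].
  exists (u + u^*); split=> //.
  - by rewrite rmorphD /= cc addrC.
  - by move=> i j; rewrite mulrDl; apply: KKD => //; apply: Kp.
  - have -> : (u + u^*) * (u + u^*) = u * u + u^* * u^* + u * u^* + u * u^* by ring.
    by apply: KKD => //; apply: KKD => //; apply: KKD.
(* A natural multiple T of t has T M over OK and T^2 a positive integer. *)
have [n1 [n10 O1]] := common_denominator (z := fun p : 'I_4 * 'I_4 => t * M p.1 p.2)
  (fun p => Kt p.1 p.2).
have [n2 [n20 O2]] := Ktt.
pose T := (n1 * n2)%:R * t.
have cT : T^* = T by rewrite rmorphM rmorph_nat /= ct.
have T0 : T != 0 by rewrite mulf_neq0 // pnatr_eq0 -lt0n muln_gt0 n10.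
have OT i j : OK (T * M i j).
  have -> : T * M i j = n2%:R * (n1%:R * (t * M i j)) by rewrite /T natrM; ring.
  by apply: (OKM sqf_m); [apply: OK_nat|apply: (O1 (i, j))].
have [c ec] : isZ (T * T).
  apply: (OK_real sqf_m); first by rewrite rmorphM /= cT.
  have -> : T * T = (n1 * n1 * n2)%:R * (n2%:R * (t * t)) by rewrite /T !natrM; ring.
  by apply: (OKM sqf_m) => //; apply: OK_nat.
have c0 : 0 < c.
  have : 0 < T * T by rewrite -{2}cT mul_conjC_gt0.
  by rewrite ec ltr0z.
have ek : (T * T) = `|c|%N%:R by rewrite ec -{1}[c]gtz0_abs // pmulrn.
pose s := toC (Num.sqrt `|c|%N%:R).
have ss : s * s = T * T by rewrite ek -rmorphM -expr2 sqr_sqrtr ?ler0n // rmorph_nat.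
exists `|c|%N, (s *: M); split.
- by rewrite absz_gt0 gt_eqF.
- move=> i j; rewrite mxE.
  (* The root of k is T up to a sign, which does not affect integrality. *)
  have /eqP : s ^+ 2 = T ^+ 2 by rewrite !expr2.
  rewrite eqf_sqr => /orP[]/eqP->; first exact: OT.
  by rewrite mulNr; apply: OKN.
- rewrite scalerA mulVf ?scale1r //; apply: contraNneq T0 => s0.
  by move: ss; rewrite [s]s0 mul0r => /esym/eqP; rewrite mulf_eq0 orbb.
Qed.

Lemma OKideal_sum (A : C -> Prop) (I : finType) (c x : I -> C) :
  (forall i, OK (c i)) -> (forall i, A (x i)) -> OKideal m A (\sum_i c i * x i).
Proof.
move=> Oc Ax; exists #|I|, (fun i => c (enum_val i)), (fun i => x (enum_val i)); split=> //.
by rewrite (reindex _ (onW_bij _ (enum_val_bij I))).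
Qed.

Lemma OKideal_incl (A : C -> Prop) x : A x -> OKideal m A x.
Proof.
move=> Ax; exists 1%N, (fun=> 1), (fun=> x); split=> // [_|].
  exact: OK1.
by rewrite big_ord1 mul1r.
Qed.

Lemma OKideal1 u z : OKideal m [set u] z <-> exists c, OK c /\ z = c * u.
Proof.
split=> [[n [c [x [Oc ex ->]]]]|[c [Oc ->]]].
  exists (\sum_i c i); split; first by apply: (subring_sum OKP).
  by rewrite mulr_suml; apply: eq_bigr => i _; rewrite (ex i).
by exists 1%N, (fun=> c), (fun=> u); split=> //; rewrite big_ord1.
Qed.

(** A product of two entries of L lies in the squared ideal, which is generated by u^2. *)
Lemma Delta_integral (M : 'M[C]_4) : Delta2_star R m M -> forall a b c d, OK (M a b * M c d).
Proof.
move=> [SM [L [u [OL u0 Ou eI eM]]]] a b c d.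
have : OKideal m [set u ^+ 2] (L a b * L c d).
  rewrite eI; apply: OKideal_incl; exists (L a b), (L c d); split=> //.
  - by apply: OKideal_incl; exists a, b.
  - by apply: OKideal_incl; exists c, d.
move=> /OKideal1[k [Ok e]]; rewrite eM !mxE mulrACA e.
by have -> : u^-1 * u^-1 * (k * u ^+ 2) = k by field.
Qed.

Lemma prod_ord4 (f : 'I_4 -> C) : \prod_i f i = f ord0 * f (lift ord0 ord0)
  * f (lift ord0 (lift ord0 ord0)) * f (lift ord0 (lift ord0 (lift ord0 ord0))).
Proof. by rewrite !big_ord_recl big_ord0 mulr1 !mulrA. Qed.

Lemma integral_Delta (M : 'M[C]_4) : SU22 R M -> (forall a b c d, OK (M a b * M c d)) ->
  Delta2_star R m M.
Proof.
move=> SM OM; split=> //; have [a [b u0]] := SU22_neq0 SM; set u := M a b in u0.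
pose i1 : 'I_4 := lift ord0 ord0; pose i2 : 'I_4 := lift ord0 (lift ord0 ord0).
pose i3 : 'I_4 := lift ord0 (lift ord0 (lift ord0 ord0)).
exists (u *: M), u; split=> //.
- by move=> i j; rewrite mxE; apply: OM.
- by rewrite expr2; apply: OM.
- apply/seteqP; split=> z.
  + move=> /OKideal1[c [Oc ->]]; have [dM _] := SM.
    (* In u^2 = u^2 det M each Leibniz term pairs two entries of M into OK and leaves a product of
       two entries of u M. *)
    rewrite -[u ^+ 2]mulr1 -dM /determinant mulr_sumr mulr_sumr.
    rewrite (eq_bigr (fun s : 'S_4 => c * (-1) ^+ odd_perm s
        * (M ord0 (s ord0) * M i1 (s i1)) * ((u * M i2 (s i2)) * (u * M i3 (s i3))))).
      2: move=> s _; rewrite prod_ord4; move: (M ord0 _) (M i1 _) (M i2 _) (M i3 _) ((-1) ^+ _).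
      2: by move=> x0 x1 x2 x3 e; ring.
    apply: OKideal_sum => s.
      apply: (OKM sqf_m); last exact: OM.
      apply: (OKM sqf_m) => //; case: (odd_perm s); rewrite ?expr1 ?expr0.
        by apply: OKN; apply: OK1.
      exact: OK1.
    by do 2 eexists; split; last reflexivity; apply: OKideal_incl; do 2 eexists; rewrite mxE.
  + move=> [n [c [x [Oc Ix ->]]]]; apply/OKideal1.
    have /choice[k hk] : forall i, exists k, OK k /\ x i = k * u ^+ 2.
      move=> i; have [y [y' [[p [d [e [Od Ie ->]]]] [p' [d' [e' [Od' Ie' ->]]]] ->]]] := Ix i.
      (* The [e j] and [e' j'] are entries of u M; divided by u they become entries of M, whose
         products are integral. *)
      exists (\sum_j \sum_j' d j * d' j' * (e j / u * (e' j' / u))); split.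
        apply: (subring_sum OKP) => j; apply: (subring_sum OKP) => j'.
        apply: (OKM sqf_m); first exact: (OKM sqf_m).
        have [f [g ->]] := Ie j; have [f' [g' ->]] := Ie' j'.
        by rewrite !mxE ![u * _]mulrC !mulfK.
      rewrite mulr_suml mulr_suml; apply: eq_bigr => j _.
      rewrite mulr_sumr mulr_suml; apply: eq_bigr => j' _; field; exact: u0.
    exists (\sum_i c i * k i); split.
      by apply: (subring_sum OKP) => i; apply: (OKM sqf_m) => //; have [] := hk i.
    rewrite mulr_suml; apply: eq_bigr => i _; have [_ ->] := hk i; exact: mulrA.
- by rewrite scalerA mulVf // scale1r.
Qed.

End Arithmetic.

(** * The discriminant kernel *)

Section Discriminant.
Variables (R : realType) (m : nat).
Hypothesis sqf_m : squarefree m.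
Local Notation C := R[i].
Local Notation toC := (real_complex R).
Local Notation w := (omega R m).
Local Notation OK := (OK R m).
Local Notation KK := (@KK R m).
Local Notation vec := (@vec6 R m).
Local Notation tilde := (@tilde R m).
Local Notation phi := (@phi R m).
Local Notation amat := (@amat R m).
Local Notation S1C := (map_mx toC (S1 R m)).
Let m_gt0 := squarefree_gt0 sqf_m.
Let OKP := OK_conj_subring R sqf_m.
Let KKP := KK_conj_subring R sqf_m.

(** A generator of the inverse different of OK. *)
Definition sigma : C := (w - w^*)^-1.
Definition J0 : 'M[C]_4 := antisym 0 (eps R) 0.

Lemma sigma_w : sigma * (w - w^*) = 1.
Proof. by rewrite mulVf // w_neq_conj. Qed.

Lemma sigma_conj : sigma^* = - sigma.
Proof. by rewrite /sigma fmorphV rmorphB /= conjCK -invrN opprB. Qed.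

Lemma sigma_OK z : OK z -> OK (sigma * (z - z^*)).
Proof.
move=> [a [b ->]]; rewrite conj_coords ?rmorph_int // mulrCA sigma_w mulr1.
by apply: OK_isZ; exists b.
Qed.

Lemma eps_sqr : eps R *m eps R = - 1%:M.
Proof. by rewrite mulmx2 scalarmx2 oppmx2; congr mx2; ring. Qed.

Lemma sharp_epsN : sharp (eps R) = - eps R.
Proof. by rewrite sharp_mx2 oppmx2 oppr0. Qed.

Lemma Om_sqr : Om R *m Om R = - 1%:M.
Proof.
by rewrite levi_mul eps_sqr (@scalar_mx_block _ 2 2) (@opp_block_mx _ 2 2 2 2) oppr0.
Qed.

Lemma Jmx_Om : Jmx R *m Om R = - J0.
Proof.
rewrite /Jmx antidiag_levi /J0 /antisym sharp_epsN oppr0 raddf0.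
by rewrite (@opp_block_mx _ 2 2 2 2) !oppr0 opprK mulNmx !mul1mx.
Qed.

Lemma J0_Om : J0 *m Om R = Jmx R.
Proof. by rewrite -[J0]opprK -Jmx_Om mulNmx -mulmxA Om_sqr mulmxN mulmx1 opprK. Qed.

(** Because M J M^h = J, the change of J0 = - J Om under M is measured by M^T - M^h, that is, by the
    imaginary parts of the entries. *)
Lemma act_J0 (M : 'M[C]_4) : SU22 R M ->
  M *m J0 *m sharp4 M - J0 = - (M *m Jmx R *m (M^T - M^h) *m Om R).
Proof.
move=> SM; rewrite mulmxBr (SU22_JmxV SM) mulmxBl Jmx_Om opprK sharp4_Om.
by rewrite mulmxN !mulmxA -(mulmxA M) J0_Om opprD.
Qed.

Lemma S1C_vec x a b c d y : S1C *m vec x (mx2 a b c d) y =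
  \col_(i < 6) [:: y; d; - (b + c); - (w * c + w^* * b); a; x]`_i.
Proof.
apply/matrixP => i j; rewrite ord1 [RHS]mxE.
have e : (S1C *m vec x (mx2 a b c d) y) i 0 =
    ((delta_mx i 0 : 'cV[C]_6)^T *m S1C *m vec x (mx2 a b c d) y) 0 0.
  by rewrite trmx_delta -mulmxA -rowE [RHS]mxE.
rewrite {}e (@delta_vec R m m_gt0).
by case: i => [[|[|[|[|[|[|i]]]]]] hi] //=; rewrite (S1_form m_gt0) mxE mulr1n sharp_mx2
  ?mulmx2 ?tr_mx2 ?mul0mx ?mxtrace0; ring.
Qed.

Lemma mxin_S1C : mxin OK S1C.
Proof.
move=> i j; have -> : S1C i j = (S1C *m (delta_mx j 0 : 'cV_6)) i 0 by rewrite -colE [RHS]mxE.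
have Ow : OK w by apply: OK_w.
have Ow' : OK w^* by apply: OK_conj.
have O0 : OK 0 by apply: OK0.
have O1 : OK 1 by apply: OK1.
have e0 : 0 = mx2 0 0 0 0 :> 'M[C]_2 by rewrite [LHS]zeromx2.
rewrite (@delta_vec R m m_gt0).
case: j => [[|[|[|[|[|[|j]]]]]] hj] //=; rewrite ?e0 S1C_vec mxE;
  case: i => [[|[|[|[|[|[|i]]]]]] hi] //=; 
  repeat first [assumption | apply: OKN | apply: OKD | apply: (OKM sqf_m)].
Qed.

(** The columns of S1^-1 (see [dualE]), a basis of the dual lattice. Only those of index 2 and 3
    carry the denominator w - conj(w). *)
Definition dual (j : 'I_6) : 'cV[C]_6 :=
  [:: vec 0 0 1; vec 0 (mx2 0 0 0 1) 0; vec 0 (mx2 0 (- (sigma * w)) (sigma * w^*) 0) 0;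
      vec 0 (mx2 0 sigma (- sigma) 0) 0; vec 0 (mx2 1 0 0 0) 0; vec 1 0 0]`_j.

Lemma S1C_dual j : S1C *m dual j = delta_mx j 0.
Proof.
have e0 : 0 = mx2 0 0 0 0 :> 'M[C]_2 by rewrite [LHS]zeromx2.
have s1 := sigma_w.
rewrite /dual; case: j => [[|[|[|[|[|[|j]]]]]] hj] //=; rewrite ?e0 S1C_vec;
  apply/matrixP => i k; rewrite ord1 !mxE eqxx andbT;
  case: i => [[|[|[|[|[|[|i]]]]]] hi] //=; rewrite ?mulr1n ?mulr0n -?s1; ring.
Qed.

Lemma amatB u v : amat (u - v) = amat u - amat v.
Proof. by rewrite -[in LHS]scaleN1r amatD amatZ scaleN1r. Qed.

Lemma amat_dual3 : amat (dual (@Ordinal 6 3 isT)) = sigma *: J0.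
Proof.
rewrite /dual /= (amat_vec m_gt0) /J0 /antisym (@scale_block_mx _ 2 2 2 2) -sharpZ.
by rewrite oppr0 raddf0 scaler0 /eps scalemx2 !mulr0 mulr1 mulrN1.
Qed.

Lemma antisymD Z Z' : antisym 0 (Z + Z') 0 = antisym 0 Z 0 + antisym 0 Z' 0 :> 'M[C]_4.
Proof. by rewrite /antisym (@add_block_mx _ 2 2 2 2) -sharpD oppr0 raddf0 addr0. Qed.

Lemma antisymZ k Z : antisym 0 (k *: Z) 0 = k *: antisym 0 Z 0 :> 'M[C]_4.
Proof. by rewrite /antisym (@scale_block_mx _ 2 2 2 2) -sharpZ oppr0 raddf0 scaler0. Qed.

(** Modulo a matrix over OK this column is an OK-multiple of the one of index 3, so the discriminant
    condition only has to be examined on sigma J0. *)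
Lemma amat_dual2 : amat (dual (@Ordinal 6 2 isT)) =
  - w *: (sigma *: J0) + antisym 0 (mx2 0 0 (- 1) 0) 0.
Proof.
rewrite /dual /= (amat_vec m_gt0) /J0 -!antisymZ -antisymD /eps !scalemx2 addmx2.
congr antisym; congr mx2; [by ring|by ring| |by ring].
transitivity (sigma * w - sigma * (w - w^*)); first by ring.
by rewrite sigma_w; ring.
Qed.

Lemma amat_dual (j : 'I_6) : (j == 2 :> nat) = false -> (j == 3 :> nat) = false -> mxin OK (amat (dual j)).
Proof.
have O0 : OK 0 by apply: OK0.
have O1 : OK 1 by apply: OK1.
by rewrite /dual; case: j => [[|[|[|[|[|[|j]]]]]] hj] //= _ _; rewrite (amat_vec m_gt0);
  apply: (mxin_antisym OKP) => //; first [exact: (mxin0 OKP)|apply: mxin_mx2].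
Qed.

Lemma det_S1_neq0 : \det (S1 R m) != 0.
Proof.
by have := @det_S1C_neq0 R m m_gt0; rewrite det_map_mx /= fmorph_eq0.
Qed.

Lemma dualE j : dual j = invmx S1C *m delta_mx j 0.
Proof.
have uS : S1C \in unitmx by rewrite unitmxE unitfE det_S1C_neq0.
by rewrite -S1C_dual mulKmx.
Qed.

(** Membership in [Sigma] means that (M~ - 1) S1^-1 is integral, i.e. that M~ moves each [dual j] by
    an integral vector. *)
Lemma Gamma_Sigma (M : 'M[C]_4) : Gamma2 R m M -> Sigma R m (phi M).
Proof.
move=> [SM OM]; split; first exact: SO0_phi.
have uS : S1 R m \in unitmx by rewrite unitmxE unitfE det_S1_neq0.
have OMM a b c d : OK (M a b * M c d) by apply: (OKM sqf_m).
have good Y : mxin OK Y -> mxin OK (M *m Y *m sharp4 M - Y).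
  move=> OY; apply: (mxinD OKP); last exact: (mxinN OKP).
  exact: (act_in OKP).
(* The entries of M^T - M^h are of the form z - conj(z) with z in OK, so they absorb the
   denominator. *)
have goodJ : mxin OK (M *m (sigma *: J0) *m sharp4 M - sigma *: J0).
  rewrite -scalemxAr -scalemxAl -scalerBr act_J0 // scalerN scalemxAl scalemxAr.
  apply: (mxinN OKP); apply: (mxinM OKP); last exact: (mxin_Om OKP).
  apply: (mxinM OKP); first by apply: (mxinM OKP) => //; exact: (mxin_Jmx OKP).
  by move=> i j; rewrite !mxE; apply: sigma_OK.
have good_dual j : mxin OK (M *m amat (dual j) *m sharp4 M - amat (dual j)).
  have [j3|j3] := boolP (j == 3 :> nat).
    have -> : j = @Ordinal 6 3 isT by apply/val_inj/eqP.
    by rewrite amat_dual3.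
  have [j2|j2] := boolP (j == 2 :> nat).
    have -> : j = @Ordinal 6 2 isT by apply/val_inj/eqP.
    rewrite amat_dual2; set Y := sigma *: J0 in goodJ *; set Z := antisym _ _ _.
    have OZ : mxin OK Z.
      have O0 : OK 0 by apply: OK0.
      by apply: (mxin_antisym OKP) => //; apply: mxin_mx2 => //; apply: OKN; apply: OK1.
    rewrite mulmxDr mulmxDl opprD addrACA; apply: (mxinD OKP); last exact: good.
    rewrite -scalemxAr -scalemxAl -scalerBr => a b; rewrite mxE.
    apply: (OKM sqf_m); last exact: goodJ.
    by apply: OKN; apply: OK_w.
  by apply: good; apply: amat_dual; apply: negbTE.
have [Y eY] : exists Y : 'M[int]_6, (phi M - 1%:M) *m invmx (S1 R m) = map_mx intr Y.
  apply: (int_columns sqf_m) => j.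
  have -> : map_mx toC (col j ((phi M - 1%:M) *m invmx (S1 R m))) =
      tilde M *m dual j - dual j.
    rewrite map_col colE (map_mxM toC (phi M - 1%:M)) (map_mxB toC).
    by rewrite (toC_phi m_gt0 SM) map_mx1 map_invmx -mulmxA -dualE mulmxBl mul1mx.
  by rewrite amatB amat_tilde.
by exists Y; rewrite -eY mulmxKV // addrC subrK.
Qed.


Lemma integral_tilde (A : C -> Prop) (M : 'M[C]_4) : conj_subring m A -> mxin A (tilde M) ->
  forall j, mxin A (M *m amat (delta_mx j 0) *m sharp4 M).
Proof.
move=> AP AM j; rewrite -(amat_tilde m_gt0) -colE; apply: (mxin_amat sqf_m AP) => i k.
by rewrite mxE.
Qed.

(* These [z] form the inverse of the fractional ideal generated by the entries of M
   and their conjugates; if the products of two entries are integral, the square of this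
   ideal is OK, so that it is its own inverse. *)
Definition dual_entries (M : 'M[C]_4) (z : C) :=
  (forall k l, OK (z * M k l)) /\ forall k l, OK (z * (M k l)^*).

(** The square of x y is integral by the determinant argument, and x y is in K as the quotient of (x
    p)(y p) by p^2 for a nonzero entry p. *)
Lemma dual_entriesM (M : 'M[C]_4) x y : SU22 R M -> (forall a b c d, OK (M a b * M c d)) ->
  dual_entries M x -> dual_entries M y -> OK (x * y).
Proof.
move=> SM OM [Ox Oxc] [Oy Oyc]; apply: (OK_integrally_closed sqf_m); last exact: (sqr_mul_in_OK sqf_m SM).
have [a [b u0]] := SU22_neq0 SM.
have -> : x * y = (x * M a b) * (y * M a b) * (M a b * M a b)^-1 by field.
apply: (KKM sqf_m); last by apply: (KKV sqf_m); apply: KK_OK.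
by apply: (KKM sqf_m); apply: KK_OK.
Qed.

Lemma dual_entriesB (M : 'M[C]_4) x y :
  dual_entries M x -> dual_entries M y -> dual_entries M (x - y).
Proof.
by move=> [Ox Oxc] [Oy Oyc]; split=> k l; rewrite mulrBl; apply: OKB.
Qed.

Lemma dual_entriesZ (M : 'M[C]_4) c x : OK c -> dual_entries M x -> dual_entries M (c * x).
Proof.
by move=> Oc [Ox Oxc]; split=> k l; rewrite -mulrA; apply: (OKM sqf_m).
Qed.

(** Triviality on sigma J0 says that M J sigma (M^T - M^h) is over OK. Multiplication by e M^-1,
    with e an entry of M or the conjugate of one, preserves this and removes the factor M. *)
Lemma Sigma_dual_entries (M : 'M[C]_4) : SU22 R M -> Sigma R m (phi M) ->
  (forall a b c d, OK (M a b * M c d)) /\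
  forall i j, dual_entries M (sigma * (M i j - (M i j)^*)).
Proof.
move=> SM [_ [Y eY]].
have eT : tilde M = 1%:M + map_mx toC (map_mx intr Y) *m S1C.
  rewrite -(toC_phi m_gt0 SM) eY (map_mxD toC) (map_mxM toC (map_mx intr Y)).
  by rewrite (map_mx1 toC).
have OY : mxin OK (map_mx toC (map_mx intr Y)).
  by move=> i j; rewrite !mxE; apply: OK_isZ; exists (Y i j); rewrite rmorph_int.
have OT : mxin OK (tilde M).
  rewrite eT; apply: (mxinD OKP); first exact: (mxin1 OKP).
  by apply: (mxinM OKP) => //; exact: mxin_S1C.
have integral := integral_tilde OKP OT.
have OM := mul_in_OK sqf_m SM integral; split=> //.
have Oc := mul_conj_in sqf_m OKP SM integral.
pose j3 := @Ordinal 6 3 isT.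
have O3 : mxin OK (amat ((tilde M - 1%:M) *m dual j3)).
  rewrite eT addrC addKr -mulmxA S1C_dual -colE; apply: (mxin_amat sqf_m OKP) => i k.
  by rewrite mxE.
have OQ : mxin OK (M *m Jmx R *m (sigma *: (M^T - M^h))).
  have -> : M *m Jmx R *m (sigma *: (M^T - M^h)) =
      amat ((tilde M - 1%:M) *m dual j3) *m Om R.
    rewrite mulmxBl mul1mx amatB (amat_tilde m_gt0) amat_dual3.
    rewrite -(scalemxAr sigma M) -(scalemxAl sigma (M *m J0)) -scalerBr act_J0 //.
    rewrite -scalemxAl mulNmx -(mulmxA _ (Om R)) Om_sqr mulmxN mulmx1 opprK.
    by rewrite -(scalemxAr sigma (M *m Jmx R)).
  by apply: (mxinM OKP) => //; exact: (mxin_Om OKP).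
(* By the assumption on e, the matrix e M^-1 = - J (e M^h) J is over OK. *)
have key e : (forall k l, OK (e * (M k l)^*)) -> forall i j, OK (e * (sigma * (M i j - (M i j)^*))).
  move=> Oe i j.
  have [_ NM] := SU22_inv SM.
  have -> : e * (sigma * (M i j - (M i j)^*)) =
      (- (Jmx R) *m ((- (Jmx R *m (e *: M^h) *m Jmx R))
        *m (M *m Jmx R *m (sigma *: (M^T - M^h))))) j i.
    have -> : - (Jmx R *m (e *: M^h) *m Jmx R) = e *: - (Jmx R *m M^h *m Jmx R).
      by rewrite -(scalemxAr e) -(scalemxAl e) scalerN.
    rewrite -(scalemxAl e) -(mulmxA M) mulmxA -?(scalemxAr e) -?(scalemxAl e).
    move: NM; set N := - (_ *m _ *m _) => NM.
    rewrite -(mulmxA M) (mulmxA N M) NM mul1mx mulmxA mulNmx JmxJ opprK mul1mx.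
    by rewrite !mxE.
  apply: (mxinM OKP); first by apply: (mxinN OKP); exact: (mxin_Jmx OKP).
  apply: (mxinM OKP) => //; apply: (mxinN OKP).
  apply: (mxinM OKP); last exact: (mxin_Jmx OKP).
  apply: (mxinM OKP); first exact: (mxin_Jmx OKP).
  by move=> a b; rewrite !mxE; apply: Oe.
move=> i j; split=> k l; rewrite mulrC; apply: key => a b; first exact: Oc.
by have := OK_conj (OM k l a b); rewrite rmorphM.
Qed.

Lemma OK_real_nat (x : C) : x^* = x -> x != 0 -> OK (x * x) ->
  exists k : nat, (0 < k)%N /\ x * x = k%:R.
Proof.
move=> cx x0 Ox; have [c ec] : isZ (x * x).
  by apply: (OK_real sqf_m) => //; rewrite rmorphM /= cx.
have c0 : 0 < c.
  have : 0 < x * x by rewrite -{2}cx mul_conjC_gt0.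
  by rewrite ec ltr0z.
exists `|c|%N; rewrite absz_gt0 gt_eqF //; split=> //.
by rewrite ec -{1}[c]gtz0_abs // pmulrn.
Qed.

(* The real elements of the ideal above generate it and have integral products.  An
   element y0 of minimal positive square generates them over Z, so that M / y0 is
   integral; then det M = 1 forces y0 = 1 or y0 = -1. *)
Lemma Sigma_Gamma (M : 'M[C]_4) : SU22 R M -> Sigma R m (phi M) -> Gamma2 R m M.
Proof.
move=> SM Sg; split=> //; have [OM Odiff] := Sigma_dual_entries SM Sg.
have [X eX] := phi_integral sqf_m SM OM; have integral := integral_phi sqf_m SM eX.
have Oc := mul_conj_in sqf_m OKP SM integral.
have cc (z : C) : z^*^* = z := conjCK z.
have wd := w_neq_conj R sqf_m.
pose r z := z^* = z /\ dual_entries M z.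
(* For n = x + y w with x, y real, y = sigma (n - conj(n)) is in the ideal by the discriminant
   condition; hence so is x = n - y w. *)
have coords i j : exists x y, [/\ r x, r y & M i j = x + y * w].
  set n := M i j; pose y := sigma * (n - n^*).
  have ry : r y.
    by split; [rewrite rmorphM rmorphB /= sigma_conj cc /y; ring|exact: Odiff].
  have ey : y * (w - w^*) = n - n^* by rewrite /y mulrAC sigma_w mul1r.
  exists (n - y * w), y; split=> //; last by rewrite subrK.
  split.
    rewrite rmorphB rmorphM /= ry.1; apply/eqP; rewrite -subr_eq0; apply/eqP.
    transitivity (y * (w - w^*) - (n - n^*)); first by ring.
    by rewrite ey subrr.
  apply: dual_entriesB; first by split=> k l; [apply: OM|apply: Oc].
  by rewrite mulrC; apply: dual_entriesZ; [apply: OK_w|case: ry].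
have [z0 [rz0 z00]] : exists z, r z /\ z != 0.
  have [a [b u0]] := SU22_neq0 SM; have [x [y [rx ry e]]] := coords a b.
  have [y0|y0] := eqVneq y 0; last by exists y.
  by exists x; split=> //; move: u0; rewrite e y0 mul0r addr0.
have rM x y : r x -> r y -> OK (x * y) by move=> [_ dx] [_ dy]; apply: (dual_entriesM SM).
pose P k := `[< exists z, [/\ r z, z != 0 & z * z = k%:R] >].
have exP : exists k, P k.
  have [k [_ ek]] := OK_real_nat rz0.1 z00 (rM _ _ rz0 rz0).
  by exists k; apply/asboolP; exists z0.
case: (ex_minnP exP) => k /asboolP[y0 [ry0 y00 yy]] kmin.
have k0 : (0 < k)%N by rewrite lt0n -(pnatr_eq0 C) -yy mulf_neq0.
have mult z : r z -> exists q : int, z = q%:~R * y0.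
  move=> rz; have [c ec] : isZ (y0 * z).
    by apply: (OK_real sqf_m); [rewrite rmorphM /= ry0.1 rz.1|apply: rM].
  (* Division of y0 z by k = y0^2: the element z' = z - q y0 satisfies y0 z' = t with 0 <= t < k, so
     z'^2 = t^2 / k < k, which contradicts minimality unless z' = 0. *)
  exists (c %/ k%:Z)%Z; set q := (c %/ _)%Z; pose t := (c %% k%:Z)%Z.
  have ect : c = q * k%:Z + t by rewrite -divz_eq.
  have k0' : k%:Z != 0 by rewrite eqz_nat -lt0n.
  have t0 : 0 <= t by apply: modz_ge0.
  have tk : t < k%:Z by apply: ltz_pmod.
  pose z' := z - q%:~R * y0.
  have rz' : r z'.
    split; first by rewrite rmorphB rmorphM rmorph_int /= rz.1 ry0.1.
    apply: dual_entriesB; [exact: rz.2|apply: dual_entriesZ; [|exact: ry0.2]].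
    by apply: OK_isZ; exists q.
  have e' : y0 * z' = t%:~R.
    rewrite /z' mulrBr ec mulrCA yy ect rmorphD rmorphM /= -pmulrn; ring.
  have [z'0|z'0] := eqVneq z' 0; first by apply/eqP; rewrite -subr_eq0; apply/eqP.
  have [k' [k'0 ek']] := OK_real_nat rz'.1 z'0 (rM _ _ rz' rz').
  have : (k <= k')%N by apply: kmin; apply/asboolP; exists z'.
  have ekk : (k' * k)%:Z = t * t.
    apply: (@intr_inj C); rewrite PoszM !rmorphM /= -!pmulrn -ek' -yy -e'; ring.
  rewrite PoszM in ekk; nia.
have [L [OL eM]] : exists L : 'M[C]_4, mxin OK L /\ M = y0 *: L.
  exists (y0^-1 *: M); split; last by rewrite scalerA mulfV // scale1r.
  move=> i j; rewrite mxE; have [x [y [/mult[p ->] /mult[q ->] ->]]] := coords i j.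
  by exists p, q; field.
(* M = y0 L and y0^2 = k give k^2 det L = 1, where det L is an integer. *)
have k1 : k = 1%N.
  have Od := det_in OKP OL.
  have eD : (k * k)%:R * \det L = 1.
    have dM : y0 ^+ 4 * \det L = 1 by rewrite -detZ -eM; case: SM.
    by rewrite -[RHS]dM natrM -yy; ring.
  have kk0 : (k * k)%:R != 0 :> C by rewrite pnatr_eq0 -lt0n muln_gt0 k0.
  have [d ed] : isZ (\det L).
    apply: (OK_real sqf_m) => //; apply: (mulfI kk0); rewrite eD.
    by have /(congr1 Num.conj) := eD; rewrite rmorphM rmorph_nat conjC1.
  have : (k * k)%:Z * d = 1 by apply: (@intr_inj C); rewrite rmorphM /= -ed -pmulrn eD.
  by move=> /(congr1 absz)/eqP; rewrite abszM absz_nat !muln_eq1 => /andP[/andP[/eqP]].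
move: yy; rewrite k1 => /eqP; rewrite -expr2 sqrf_eq1 => yy i j; rewrite eM mxE.
by case/orP: yy => /eqP->; rewrite ?mul1r ?mulN1r //; apply: OKN.
Qed.

End Discriminant.

(** * Homomorphism, kernel and images *)

Local Open Scope complex_scope.

Theorem theorem3 (R : realType) (m : nat) (hm : squarefree m) :
  [/\ forall M : 'M[R[i]]_4, SU22 R M ->
        map_mx (real_complex R) (phi m M) = tilde m M /\ SO0 R m (phi m M),
      forall M N : 'M[R[i]]_4, SU22 R M -> SU22 R N ->
        phi m (M *m N) = phi m M *m phi m N,
      phi m @` SU22 R = SO0 R m,
      SU22 R `&` [set M | phi m M = 1%:M] = [set 1%:M; - 1%:M]
    & [/\ phi m @` GK R m = SO0_Q R m,
          phi m @` Delta2_star R m = Sigma_star R m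
        & phi m @` Gamma2 R m = Sigma R m]].
Proof.
have m_gt0 := squarefree_gt0 hm.
have phi_N1 : phi m (- 1%:M : 'M[R[i]]_4) = 1%:M.
  by apply: toC_mx_inj; rewrite (toC_phi m_gt0 (SU22_N1 R)) tilde_N1 // map_mx1.
split.
- by move=> M SM; split; [exact: toC_phi|exact: SO0_phi].
- exact: phiM.
- apply/seteqP; split=> [_ [M SM <-]|X /(SO0_in_image m_gt0)[M SM <-]].
    exact: SO0_phi.
  by exists M.
- apply/seteqP; split=> [M [SM e1]|M [->|->]].
  + have := toC_phi m_gt0 SM; rewrite e1 map_mx1 => /esym/(tilde_eq1 m_gt0)[->|->];
      by [left|right].
  + by split; [exact: SU22_1|exact: phi1].
  + by split; [exact: SU22_N1|].
split.
- apply/seteqP; split=> [_ [M GM <-]|X /(rational_GK hm)[M GM <-]].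
    exact: GK_rational.
  by exists M.
- apply/seteqP; split=> [_ [M DM <-]|X [S0X [Y eX]]].
    split; first by apply: SO0_phi => //; case: DM.
    by apply: phi_integral => //; [case: DM|exact: Delta_integral].
  have [M SM eM] := SO0_in_image m_gt0 S0X; exists M => //; rewrite eX in eM.
  apply: (integral_Delta hm SM); apply: (mul_in_OK hm SM); exact: (integral_phi hm SM eM).
- apply/seteqP; split=> [_ [M GM <-]|X SX]; first exact: Gamma_Sigma.
  have [M SM eM] := SO0_in_image m_gt0 SX.1; exists M => //.
  by apply: Sigma_Gamma; rewrite ?eM.
Qed.
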